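(* Let $p\in(0,1)$, $N=1/(1-p)$, and let $\gamma\ge 0$ be real (with $0^0=1$). (a) (Melonic dominance.) Fix an even integer $n\ge 0$ and an integer $r\ge 0$. If $G$ is a melonic graph of order $n$, then $\mathcal A_r(G)$ remains bounded and bounded away from $0$ as $N\to\infty$ (i.e. as $p\to 1$): there are constants $0<c\le C$, independent of $p$, such that $c\le \mathcal A_r(G)\le C$ for all $p\in[1/2,1)$. If $G$ is a graph of order $n$ that is not melonic, then there is a constant $C'$ independent of $p$ with $\mathcal A_r(G)\le C' N^{-1}$ for all $p\in(0,1)$. Thus the graphs whose amplitudes dominate as $N\to\infty$ in the averaged Sobolev norm are exactly the melonic graphs. (b) (Analyticity.) The melonic approximation $$S^{melo}_\gamma(t)=\sum_{r\ge 0}\frac{r^\gamma}{N}\,G_2^{melo}(r,t),\qquad G_2^{melo}(r,t)=\sum_{n\ \mathrm{even}}\frac{t^n}{n!}\,8^{-n/2}\sum_{G\ \mathrm{melonic\ of\ order}\ n}\epsilon(U)\,\mathcal A_r(G)$$ (the inner sum running over all melonic graphs $G=(U,w,w')$ of order $n$) defines an analytic function of $t$ on a disk $|t|<\rho$ for some finite radius $\rho>0$.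
   Context: Fix $p\in(0,1)$ and set $N:=1/(1-p)$. Trees. For an integer $n\ge0$, a 2-rooted ternary tree of order $n$ is a finite plane tree $U$ with a distinguished root vertex of degree 2 and $n$ further vertices, the true vertices, each of degree 4. Each edge is either internal (joining two of these vertices) or a leaf (a half-edge attached to a single vertex). Each true vertex $v$ has a parent edge $e_1(v)$ (first edge of the path from $v$ to the root) and three children edges with a fixed linear order $e_2(v),e_3(v),e_4(v)$; each is either an internal edge to a child true vertex or a leaf. The root has two edges, each a leaf or the parent edge of a true vertex; one is declared of type $\alpha$ and the other of type $\bar\alpha$. Types propagate: if $e_1(v)$ has type $\tau$, then $e_2(v)$ has the other type and $e_3(v),e_4(v)$ have type $\tau$. Leaves of type $\alpha$ are called leaves and those of type $\bar\alpha$ anti-leaves (there are $n+1$ of each). A heap-ordering is a bijective labelling of the true vertices by $\{1,\dots,n\}$ increasing from each true vertex to its children. The sign of $U$ is $\epsilon(U)=\prod_v c_v$ over true vertices, with $c_v=-i$ if $e_1(v)$ has type $\alpha$ and $c_v=+i$ otherwise. Graphs. For even $n$, a graph of order $n$ is a triple $G=(U,w,w')$ where $U$ is a heap-ordered 2-rooted ternary tree of order $n$; $w$ is a bijection from the leaves to the anti-leaves of $U$ (each pair $\{\ell,w(\ell)\}$ is a dashed edge; internal edges of $U$ are solid edges); and $w'$ is a partition of the true vertices into $n/2$ pairs (wavy edges) together with, for each pair $\{v,v'\}$ ($v$ with smaller label), a choice of one of the eight propagators, written with $(S,j,k)=(S_v,j_v,k_v)$, $(S',j',k')=(S_{v'},j_{v'},k_{v'})$: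 $\delta_{jj'}\delta_{kk'}$, $\delta_{j,S-j'}\delta_{kk'}$, $\delta_{jj'}\delta_{k,S-k'}$, $\delta_{j,S-j'}\delta_{k,S-k'}$, $\delta_{jk'}\delta_{kj'}$, $\delta_{j,S-k'}\delta_{kj'}$, $\delta_{jk'}\delta_{k,S-j'}$, $\delta_{j,S-k'}\delta_{k,S-j'}$, always together with $S=S'$. Amplitude. A momentum attribution assigns to each true vertex $v$ integers $S_v\ge0$, $0\le j_v,k_v\le S_v$, giving momenta $j_v,S_v-j_v,k_v,S_v-k_v$ to the ends at $v$ of $e_1(v),e_2(v),e_3(v),e_4(v)$. For $r\in\mathbb N$ it is admissible for $G$ if: each solid edge gets the same momentum from both ends; both root edges carry momentum $r$ (a leaf at the root has momentum $r$; a true vertex adjacent to the root has $j_v=r$); each dashed edge $e$ joins two leaves of equal momentum $m(e)$; and each wavy edge satisfies $S_v=S_{v'}$ and its chosen propagator. Then $\mathcal A_r(G):=N^{-n}\sum_{\text{admissible}}\prod_{e\ \text{dashed}}p^{m(e)}$ (finite and positive). Melonic graphs. Each propagator, with $S=S'$, identifies each of the momenta $j,S-j,k,S-k$ of $v$ with one momentum of $v'$, hence a bijection from the ends $e_1(v),\dots,e_4(v)$ at $v$ to those at $v'$. For two true vertices joined by three edges, the leading propagator is the one whose bijection sends the $v$-end of each of these three edges to its $v'$-end. The trivial graph ($n=0$) is the root with a leaf and an anti-leaf joined by a dashed edge. Insertions (new true vertices $v,v'$, always joined by a new wavy edge carrying the leading propagator): (I) replace a dashed edge with ends $x,y$: attach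 $v$ at $x$ (so $e_1(v)$ is at $x$) and $v'$ at $y$, all their children being leaves, and join by dashed edges $e_2(v)$ with $e_2(v')$ and $\{e_3(v),e_4(v)\}$ bijectively with $\{e_3(v'),e_4(v')\}$; (II) replace a dashed edge with ends $z,z'$: attach $v$ at $z$, $v'$ with $e_1(v')=e_2(v)$, and dashed edges join $e_2(v')$ with $z'$ and $\{e_3(v),e_4(v)\}$ bijectively with $\{e_3(v'),e_4(v')\}$; (III) as (II) but with $e_1(v')=e_a(v)$, $a\in\{3,4\}$, $b$ the other index, and dashed edges joining $e_2(v)$ to one of $e_3(v'),e_4(v')$, $e_b(v)$ to $e_2(v')$, and the remaining child leaf of $v'$ to $z'$; (IIs) replace a solid edge from $u$ to its child $z$: put $v$ below $u$, $e_1(v')=e_2(v)$, $e_1(z)=e_2(v')$, dashed edges joining $\{e_3(v),e_4(v)\}$ bijectively with $\{e_3(v'),e_4(v')\}$; (IIIs) as (IIs) but $e_1(v')=e_a(v)$, $a\in\{3,4\}$, $e_1(z)=e_c(v')$ for some $c\in\{3,4\}$, with dashed edges joining $e_2(v)$ to the other of $e_3(v'),e_4(v')$ and $e_b(v)$ to $e_2(v')$. A graph is melonic if, forgetting heap-orderings, it is obtained from the trivial graph by a finite sequence of insertions (any heap-ordering is then allowed). Motivation: the coefficients of the Gaussian-averaged Taylor series in $t$ of the Sobolev norm $\sum_r r^\gamma|\alpha_r(t)|^2$ for the resonant flow $i\dot\alpha_j=\sum_{S\ge j}\sum_{k=0}^SC^S_{jk}\bar\alpha_{S-j}\alpha_k\alpha_{S-k}$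 (couplings Gaussian with covariance $\tfrac{\delta_{SS'}}8\times$ the sum of the eight propagators, initial data with $\langle\alpha_j\bar\alpha_{j'}\rangle=\delta_{jj'}p^j/N$) are the same sums taken over all graphs instead of melonic ones. *)

(* Defs.v *)
From HB Require Import structures.
From mathcomp Require Import all_boot all_order all_algebra.
From mathcomp Require Import all_classical all_reals all_analysis.
From mathcomp Require Import complex perm.
Set Implicit Arguments. Unset Strict Implicit. Unset Printing Implicit Defensive.
Import Order.TTheory GRing.Theory Num.Theory.
Import numFieldNormedType.Exports.
Local Open Scope classical_set_scope.
Local Open Scope ring_scope.

HB.instance Definition _ (R : rcfType) := PseudoPointedMetric.copy R[i] (R[i])^o.

(* Encoding of (heap-ordered) 2-rooted ternary trees and graphs.            *)
(* True vertices are 'I_n.  A "slot" is a place where an edge hangs:        *)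
(*   inl true  = the root edge of type alpha,                               *)
(*   inl false = the root edge of type alpha-bar,                           *)
(*   inr (u,c) = the child edge e_{c+2}(u) of the true vertex u             *)
(*               (c = 0,1,2 stands for e2,e3,e4).                           *)
(* A slot is either occupied by a true vertex (internal/solid edge = the    *)
(* parent edge of that vertex) or is a leaf.                                *)
(* A graph of order n is a quadruple (par, dash, mate, prop):               *)
(*   par v   = the slot where e1(v) hangs (the tree U);                     *)
(*   dash    = the bijection w from leaves to anti-leaves (identity on all  *)
(*             other slots, for canonicity);                                *)
(*   mate v  = the partner of v in the wavy pairing w';                     *)
(*   prop v  = the index (0..7) of the propagator of the pair {v, mate v},  *)
(*             read with v the vertex of smaller label; prop v = 0 when     *)
(*             mate v < v (canonicity).                                     *)

Notation slot n := (bool + 'I_n * 'I_3)%type.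
Notation graph n :=
  ({ffun 'I_n -> slot n} * {ffun slot n -> slot n} *
   {ffun 'I_n -> 'I_n} * {ffun 'I_n -> 'I_8})%type.

Section Graphs.
Local Open Scope nat_scope.
Variable n : nat.
Implicit Types (G : graph n) (s t : slot n).

Definition par G : 'I_n -> slot n := G.1.1.1.
Definition dash G : slot n -> slot n := G.1.1.2.
Definition mate G : 'I_n -> 'I_n := G.1.2.
Definition prop G : 'I_n -> 'I_8 := G.2.

(* type of a slot: true = alpha, false = alpha-bar; types propagate:       *)
(* e2 gets the other type than e1, e3 and e4 the same type as e1.          *)
Fixpoint ty_fuel (pa : 'I_n -> slot n) (fuel : nat) (s : slot n) : bool :=
  match s with
  | inl b => b
  | inr (u, c) =>
      match fuel with
      | 0 => true
      | f.+1 => let t := ty_fuel pa f (pa u) in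
                if nat_of_ord c == 0%N then ~~ t else t
      end
  end.
Definition ty G s : bool := ty_fuel (par G) n s.

Definition occupied G s : bool := [exists v, par G v == s].
Definition leafA G s : bool := ~~ occupied G s && ty G s.
Definition leafB G s : bool := ~~ occupied G s && ~~ ty G s.

Definition dashed G s t : bool :=
  (leafA G s && (dash G s == t)) || (leafA G t && (dash G t == s)).

(* well-formed graph (heap-ordering not required: needed for the           *)
(* intermediate objects of the insertion procedure)                         *)
Definition wf_graph G : Prop :=
  injective (par G) /\
  (exists d : 'I_n -> nat, forall v u c, par G v = inr (u, c) -> (d u < d v)%N) /\
  (forall v, mate G (mate G v) = v /\ mate G v != v) /\
  (forall v : 'I_n, (mate G v < v)%N -> prop G v = ord0) /\
  (forall s, leafA G s -> leafB G (dash G s)) /\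
  (forall s, ~~ leafA G s -> dash G s = s) /\
  {in leafA G &, injective (dash G)} /\
  (forall t, leafB G t -> exists2 s, leafA G s & dash G s = t).

Definition hgraph G : Prop :=
  wf_graph G /\ forall v u c, par G v = inr (u, c) -> (u < v)%N.

Definition epsilon (R : rcfType) G : R[i] :=
  (\prod_(v : 'I_n) (if ty G (par G v) then - 'i else 'i))%R.

Notation attrib := ({ffun 'I_n -> nat} * {ffun 'I_n -> nat} * {ffun 'I_n -> nat})%type.
Definition aS (a : attrib) := a.1.1.
Definition aj (a : attrib) := a.1.2.
Definition ak (a : attrib) := a.2.

(* momentum of the end e_{e+1}(v) at v: j, S-j, k, S-k *)
Definition endmom (a : attrib) (v : 'I_n) (e : nat) : nat :=
  match e with
  | 0 => aj a v
  | 1 => aS a v - aj a v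
  | 2 => ak a v
  | _ => aS a v - ak a v
  end.

Definition slotmom (r : nat) (a : attrib) (s : slot n) : nat :=
  match s with
  | inl _ => r
  | inr (u, c) => endmom a u (nat_of_ord c).+1
  end.

Definition propagator (i : 'I_8) (S j k S' j' k' : nat) : Prop :=
  S = S' /\
  match nat_of_ord i with
  | 0 => j = j' /\ k = k'
  | 1 => j = S - j' /\ k = k'
  | 2 => j = j' /\ k = S - k'
  | 3 => j = S - j' /\ k = S - k'
  | 4 => j = k' /\ k = j'
  | 5 => j = S - k' /\ k = j'
  | 6 => j = k' /\ k = S - j'
  | _ => j = S - k' /\ k = S - j'
  end.

Definition admissible G (r : nat) (a : attrib) : Prop :=
  (forall v : 'I_n, aj a v <= aS a v /\ ak a v <= aS a v)%N /\
  (forall v u c, par G v = inr (u, c) -> endmom a u (nat_of_ord c).+1 = aj a v) /\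
  (forall v b, par G v = inl b -> aj a v = r) /\
  (forall s, leafA G s -> slotmom r a s = slotmom r a (dash G s)) /\
  (forall v : 'I_n, (v < mate G v)%N ->
     propagator (prop G v) (aS a v) (aj a v) (ak a v)
                (aS a (mate G v)) (aj a (mate G v)) (ak a (mate G v))).

Definition Nof (R : realType) (p : R) : R := ((1 - p)^-1)%R.

Definition amp (R : realType) (p : R) (r : nat) G : \bar R :=
  ((((Nof p)^-1 ^+ n)%R)%:E *
   \esum_(a in [set a : attrib | admissible G r a])
      ((\prod_(s | leafA G s) p ^+ slotmom r a s)%R)%:E)%E.

Definition map_slot (f : 'I_n -> 'I_n) (s : slot n) : slot n :=
  match s with inl b => inl b | inr (u, c) => inr (f u, c) end.

(* the bijection of ends of propagator i: end e_{x+1}(v) |-> e_{pm i x + 1}(v') *)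
Definition pm (i : nat) (x : nat) : nat :=
  match i, x with
  | 0, x => x
  | 1, 0 => 1 | 1, 1 => 0 | 1, x => x
  | 2, 2 => 3 | 2, 3 => 2 | 2, x => x
  | 3, 0 => 1 | 3, 1 => 0 | 3, 2 => 3 | 3, _ => 2
  | 4, 0 => 2 | 4, 1 => 3 | 4, 2 => 0 | 4, _ => 1
  | 5, 0 => 3 | 5, 1 => 2 | 5, 2 => 0 | 5, _ => 1
  | 6, 0 => 2 | 6, 1 => 3 | 6, 2 => 1 | 6, _ => 0
  | _, 0 => 3 | _, 1 => 2 | _, 2 => 1 | _, _ => 0
  end.

(* end x at v is identified with end y at mate v by the propagator of {v, mate v} *)
Definition prop_rel G (v : 'I_n) (x y : nat) : bool :=
  if (v < mate G v)%N then pm (prop G v) x == y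
  else pm (prop G (mate G v)) y == x.

Definition iso (G0 G : graph n) : Prop :=
  exists sg : {perm 'I_n},
    (forall v, par G (sg v) = map_slot sg (par G0 v)) /\
    (forall s t, dashed G0 s t = dashed G (map_slot sg s) (map_slot sg t)) /\
    (forall v, mate G (sg v) = sg (mate G0 v)) /\
    (forall v (x y : 'I_4), prop_rel G0 v x y = prop_rel G (sg v) x y).

End Graphs.

Section Insertions.
Local Open Scope nat_scope.
Variable n : nat.
Implicit Types (G : graph n) (H : graph n.+2).

Definition up (u : 'I_n) : 'I_n.+2 := widen_ord (leqW (leqnSn n)) u.
Definition newA : 'I_n.+2 := Ordinal (leqW (ltnSn n)).
Definition newB : 'I_n.+2 := ord_max.
Definition up_slot (s : slot n) : slot n.+2 :=
  match s with inl b => inl b | inr (u, c) => inr (up u, c) end.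
Definition ch (v : 'I_n.+2) (c : nat) : slot n.+2 := inr (v, inord c).

Definition upair {T} (s t x y : T) : Prop := (s = x /\ t = y) \/ (s = y /\ t = x).

Definition leading (i : 'I_8) (l : seq (nat * nat)) : bool :=
  all (fun xy => pm i xy.1 == xy.2) l.

Definition ins_common G (G' : graph n.+2) (l : seq (nat * nat)) : Prop :=
  wf_graph G' /\
  (forall u, mate G' (up u) = up (mate G u)) /\
  mate G' newA = newB /\ mate G' newB = newA /\
  (forall u, prop G' (up u) = prop G u) /\
  leading (prop G' newA) l /\ prop G' newB = ord0.

Definition ins_dashed G (G' : graph n.+2) (excl : option (slot n * slot n))
    (news : seq (slot n.+2 * slot n.+2)) : Prop :=
  forall s t, dashed G' s t <->
    (exists s0 t0, s = up_slot s0 /\ t = up_slot t0 /\ dashed G s0 t0 /\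
       (if excl is Some (x, y) then ~ upair s0 t0 x y else True))
    \/ (exists2 xy, xy \in news & upair s t xy.1 xy.2).

Definition other (c : nat) := if c == 1%N then 2%N else 1%N.

(* (I): b chooses the bijection {e3,e4}(v) -> {e3,e4}(v') *)
Definition insI G (G' : graph n.+2) : Prop :=
  exists x y (b : bool), dashed G x y /\
   let c3 := if b then 1%N else 2%N in
   (forall u, par G' (up u) = up_slot (par G u)) /\
   par G' newA = up_slot x /\ par G' newB = up_slot y /\
   ins_dashed G G' (Some (x, y))
     [:: (ch newA 0, ch newB 0); (ch newA 1, ch newB c3); (ch newA 2, ch newB (other c3))] /\
   ins_common G G' [:: (1, 1); (2, c3.+1); (3, (other c3).+1)]%N.

Definition insII G (G' : graph n.+2) : Prop :=
  exists z z' (b : bool), dashed G z z' /\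
   let c3 := if b then 1%N else 2%N in
   (forall u, par G' (up u) = up_slot (par G u)) /\
   par G' newA = up_slot z /\ par G' newB = ch newA 0 /\
   ins_dashed G G' (Some (z, z'))
     [:: (ch newB 0, up_slot z'); (ch newA 1, ch newB c3); (ch newA 2, ch newB (other c3))] /\
   ins_common G G' [:: (1, 0); (2, c3.+1); (3, (other c3).+1)]%N.

(* (III): a in {3,4} (child index ca), c the child of v' joined to e2(v) *)
Definition insIII G (G' : graph n.+2) : Prop :=
  exists z z' (ba bc : bool), dashed G z z' /\
   let ca := if ba then 1%N else 2%N in
   let cb := other ca in
   let cc := if bc then 1%N else 2%N in
   (forall u, par G' (up u) = up_slot (par G u)) /\
   par G' newA = up_slot z /\ par G' newB = ch newA ca /\
   ins_dashed G G' (Some (z, z'))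
     [:: (ch newA 0, ch newB cc); (ch newA cb, ch newB 0); (ch newB (other cc), up_slot z')] /\
   ins_common G G' [:: (ca.+1, 0); (1, cc.+1); (cb.+1, 1)]%N.

(* (IIs): z a true vertex; its parent edge (a solid edge) is replaced *)
Definition insIIs G (G' : graph n.+2) : Prop :=
  exists (z : 'I_n) (b : bool),
   let c3 := if b then 1%N else 2%N in
   (forall u, u != z -> par G' (up u) = up_slot (par G u)) /\
   par G' newA = up_slot (par G z) /\ par G' newB = ch newA 0 /\
   par G' (up z) = ch newB 0 /\
   ins_dashed G G' None
     [:: (ch newA 1, ch newB c3); (ch newA 2, ch newB (other c3))] /\
   ins_common G G' [:: (1, 0); (2, c3.+1); (3, (other c3).+1)]%N.

Definition insIIIs G (G' : graph n.+2) : Prop :=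
  exists (z : 'I_n) (ba bc : bool),
   let ca := if ba then 1%N else 2%N in
   let cb := other ca in
   let cc := if bc then 1%N else 2%N in
   (forall u, u != z -> par G' (up u) = up_slot (par G u)) /\
   par G' newA = up_slot (par G z) /\ par G' newB = ch newA ca /\
   par G' (up z) = ch newB cc /\
   ins_dashed G G' None
     [:: (ch newA 0, ch newB (other cc)); (ch newA cb, ch newB 0)] /\
   ins_common G G' [:: (ca.+1, 0); (cb.+1, 1); (1, (other cc).+1)]%N.

Definition insertion G (G' : graph n.+2) : Prop :=
  insI G G' \/ insII G G' \/ insIII G G' \/ insIIs G G' \/ insIIIs G G'.

End Insertions.

Definition triv : graph 0 :=
  ([ffun v => inl true], [ffun s => if s == inl true then inl false else s],
   [ffun v => v], [ffun v => ord0]).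

Inductive mel : forall n, graph n -> Prop :=
| mel_triv : mel triv
| mel_step n (G : graph n) (G' : graph n.+2) : mel G -> insertion G G' -> mel G'.

Definition melonic n (G : graph n) : Prop := exists G0 : graph n, mel G0 /\ iso G0 G.

Local Open Scope complex_scope.

Definition G2coef (R : realType) (p : R) (r n : nat) : R[i] :=
  if odd n then 0 else
  ((n`!%:R)^-1 * ((8 : R) ^+ n./2)^-1)%:C *
  \sum_(G : graph n | `[< hgraph G /\ melonic G >]) epsilon R G * (fine (amp p r G))%:C.

Definition G2melo (R : realType) (p : R) (r : nat) (t : R[i]) : R[i] :=
  limn (series (fun n => G2coef p r n * t ^+ n)).

Definition Sterm (R : realType) (p gamma : R) (t : R[i]) (r : nat) : R[i] :=
  ((r%:R `^ gamma) / Nof p)%:C * G2melo p r t.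

Definition Smelo (R : realType) (p gamma : R) (t : R[i]) : R[i] :=
  limn (series (Sterm p gamma t)).

(* Main.v *)
Require Import Defs.
From HB Require Import structures.
From mathcomp Require Import all_boot all_order all_algebra.
From mathcomp Require Import perm ring lra zify.
Set Implicit Arguments. Unset Strict Implicit. Unset Printing Implicit Defensive.
Import Order.TTheory GRing.Theory Num.Theory.

(** A momentum attribution is a flow on the graph whose vertices are the root and
    the true vertices and whose edges are the solid and dashed edges, subject in
    addition to the wavy edges.  The solid tree is spanning, so a flow is given by
    the [n + 1] momenta of the dashed edges; the root condition removes one of
    them, whence [N ^- n * N ^ n] as an upper bound, and one more as soon as some
    wavy edge is not a consequence of flow conservation, whence [N ^-1].

    If all wavy edges are consequences of conservation, then equal momenta come
    from two-edge cuts.  A minimal set of true vertices bounded by two edges is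
    then a pair of mates joined by three edges: such a pair is exactly what an
    insertion creates, and removing it preserves the hypothesis, so the graph is
    melonic.  Conversely each insertion adds two free natural parameters to the
    attributions, which gives the lower bound.

    For analyticity, the leaf momenta sum up to at least [r], which gives geometric
    decay in [r]; and a melonic graph is planar in the sense that, for a suitable
    order of the children, its dashed and wavy edges form a non-crossing matching
    along the contour of the tree, so that there are at most [4 * K ^ n * n!] of
    them. *)


(** * Edge cuts and flows *)

(** Redundancy of the wavy edges is tested on rational flows: differences of attributions are such
    flows, and a circuit can be used as a test flow without any positivity check. The types orient
    the edges so that, at the root and at every true vertex, as many ends point in as out; hence
    every cut has an even number of edges. This parity makes a minimal two-edge cut rigid: each
    nonempty proper part of it has at least four boundary edges, and a second two-edge cut
    separating an inner edge would require eight boundary darts where at most six exist. Propagators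
    that are not leading need not be excluded one by one: whether a wavy edge follows from
    conservation is decided by flows alone, and the leading propagator comes out of the three
    coincidences found. Finally, an insertion always gives its new pair the last two labels, while
    the reduction finds its pair anywhere and the induction returns a graph known up to isomorphism
    only; this is why insertions have to be transported along relabellings. *)

Section Darts.
Local Open Scope ring_scope.
Variables (T V : finType) (io : T -> T) (vt : T -> V) (sg : T -> bool).
Hypothesis ioK : involutive io.
Hypothesis sg_io : forall d, sg (io d) = ~~ sg d.
Implicit Types (d e c : T) (A B D : {set V}) (x y : T -> rat).

(** A dart is a half-edge: [io] passes to the other half, [vt] is the vertex it sits at, [sg]
    orients it. Below, [dv] is the divergence at a vertex, and [bd] lists each boundary edge once,
    by its half inside the set. *)
Definition sgn d : rat := (-1) ^+ sg d.
Definition dv x (w : V) : rat := \sum_(d | vt d == w) sgn d * x d.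
Definition dart_flow x := (forall d, x (io d) = x d) /\ (forall w, dv x w = 0).
Definition bd A : {set T} := [set d | (vt d \in A) && (vt (io d) \notin A)].

Lemma io_neq d : io d != d.
Proof. by apply/eqP => h; have := sg_io d; rewrite h; case: (sg d). Qed.

Lemma sgn_io d : sgn (io d) = - sgn d.
Proof. by rewrite /sgn sg_io; case: (sg d); rewrite /= ?expr0 ?expr1 ?opprK. Qed.

Lemma sgn2 d : sgn d * sgn d = 1.
Proof. by rewrite /sgn -expr2 sqrr_sign. Qed.

Definition edge1 d e : rat := ((e == d) || (e == io d))%:R.

Lemma edge1_io d e : edge1 d (io e) = edge1 d e.
Proof.
by rewrite /edge1 !(inv_eq ioK) ioK orbC.
Qed.

Lemma dv_edge1 d w : dv (edge1 d) w = sgn d * ((vt d == w)%:R - (vt (io d) == w)%:R).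
Proof.
rewrite /dv; under eq_bigr => e _.
  have -> : edge1 d e = (e == d)%:R + (e == io d)%:R.
    rewrite /edge1; case: (e =P d) => [->|_]; last by rewrite add0r.
    by rewrite [d == _]eq_sym (negbTE (io_neq d)) addr0.
  rewrite mulrDr; over.
rewrite big_split /= mulrBr; congr (_ + _).
  rewrite big_mkcond (bigD1 d) //= eqxx mulr1 big1 ?addr0.
    by case: (vt d == w); rewrite ?mulr1 ?mulr0.
  by move=> e /negbTE ->; rewrite mulr0; case: ifP.
rewrite big_mkcond (bigD1 (io d)) //= eqxx mulr1 sgn_io big1 ?addr0.
  by case: (_ == w); rewrite ?mulr1 ?mulr0 ?oppr0.
by move=> e /negbTE ->; rewrite mulr0; case: ifP.
Qed.

Lemma dvD x y w : dv (fun d => x d + y d) w = dv x w + dv y w.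
Proof. by rewrite /dv -big_split /=; apply: eq_bigr => d _; rewrite mulrDr. Qed.

Lemma dvZ a x w : dv (fun d => a * x d) w = a * dv x w.
Proof. by rewrite /dv big_distrr /=; apply: eq_bigr => d _; rewrite mulrCA. Qed.

Definition adj d e : rel V := fun a b =>
  [exists c, [&& c \notin [:: d; io d; e; io e], vt c == a & vt (io c) == b]].

(** Each step of the path contributes the signed unit flow of the edge it crosses; divergences
    telescope to the two ends, and no step uses the edges of [d] and [e]. *)
Lemma path_flow d e a b : connect (adj d e) a b -> exists y,
  [/\ forall c, y (io c) = y c, y d = 0, y e = 0 &
      forall w, dv y w = (a == w)%:R - (b == w)%:R].
Proof.
move=> /connectP [p]; elim: p a => [|a' p IH] a /=.
  by move=> _ ->; exists (fun _ => 0); split=> // w; rewrite subrr /dv big1 // => ? _; rewrite mulr0.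
case/andP => /existsP [c /and3P[hc /eqP <- /eqP hb]] /IH h /h [y [y1 y2 y3 y4]].
move: hc; rewrite !inE !negb_or => /and4P[c1 c2 c3 c4].
exists (fun k => sgn c * edge1 c k + y k); split.
- by move=> k; rewrite edge1_io y1.
- by rewrite y2 addr0 /edge1 -(inv_eq ioK) ![_ == c]eq_sym (negbTE c1) (negbTE c2) mulr0.
- by rewrite y3 addr0 /edge1 -(inv_eq ioK) ![_ == c]eq_sym (negbTE c3) (negbTE c4) mulr0.
- move=> w; rewrite dvD dvZ dv_edge1 y4 mulrA sgn2 mul1r hb.
  by rewrite addrA subrK.
Qed.

(* If no path joins the ends of [d] away from the edges of [d] and [e], the
   component of one end is bounded by these two edges; otherwise the path closes
   up to a circuit through [d] avoiding [e]. *)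
Lemma cut_lemma d e : e != d -> e != io d ->
  (forall x, dart_flow x -> x d = x e) ->
  exists A, [/\ vt d \in A, vt (io d) \notin A & bd A \subset [:: d; io d; e; io e]].
Proof.
move=> ed eid hfl.
exists [set w | connect (adj d e) (vt d) w]; rewrite inE connect0; split=> //.
  rewrite inE; apply/negP => /path_flow [y [y1 y2 y3 y4]].
  pose x k := - sgn d * edge1 d k + y k.
  have hx : dart_flow x.
    split=> [k|w]; rewrite /x ?edge1_io ?y1 //.
    by rewrite dvD dvZ dv_edge1 y4 mulrA mulNr sgn2 mulN1r addNr.
  have := hfl _ hx; rewrite /x y2 y3 /edge1 eqxx (negbTE ed) (negbTE eid) /= mulr1 mulr0 !addr0.
  by move=> /eqP; rewrite oppr_eq0 /sgn signr_eq0.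
apply/subsetP => c; rewrite inE !in_set => /andP[h1 h2].
apply: contraR h2 => hc; apply: (connect_trans h1); apply: connect1.
by apply/existsP; exists c; rewrite hc !eqxx.
Qed.

Hypothesis bal : forall w, #|[set d | (vt d == w) && sg d]| = #|[set d | (vt d == w) && ~~ sg d]|.

(** By [bal] the darts at the vertices of [A] of either sign are equinumerous. Those whose edge
    stays inside [A] are exchanged by [io], which reverses the sign, so the boundary darts of either
    sign are equinumerous too. *)
Lemma bd_even A : ~~ odd #|bd A|.
Proof.
pose S b := [set d | (vt d \in A) && (sg d == b)].
have cS : #|S true| = #|S false|.
  have aux b : #|S b| = (\sum_(w in A) #|[set d | (vt d == w) && (sg d == b)]|)%N.
    rewrite -sum1_card (partition_big vt (mem A)) /=; last by move=> d; rewrite inE => /andP[].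
    apply: eq_bigr => w wA; rewrite -sum1_card; apply: eq_bigl => d.
    by rewrite !inE andbC; case: eqP => //= ->; rewrite wA.
  rewrite !aux; apply: eq_bigr => w _.
  rewrite (eq_card (B := [set d | (vt d == w) && sg d])); last first.
    by move=> d; rewrite !inE eqb_id.
  rewrite bal; apply: eq_card => d; rewrite !inE; by case: (sg d).
pose I b := [set d | [&& vt d \in A, vt (io d) \in A & sg d == b]].
have cI : #|I true| = #|I false|.
  rewrite -(card_imset _ (can_inj ioK)); apply: eq_card => d; apply/imsetP/idP.
    by move=> [e]; rewrite !inE => /and3P[h1 h2 /eqP h3] ->; rewrite ioK h1 h2 sg_io h3.
  rewrite inE => /and3P[h1 h2 /eqP h3]; exists (io d); last by rewrite ioK.
  by rewrite inE ioK h1 h2 sg_io h3.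
pose Bb b := [set d | (d \in bd A) && (sg d == b)].
have cB b : (#|S b| = #|I b| + #|Bb b|)%N.
  rewrite -(cardsID [set d | vt (io d) \in A] (S b)); congr (_ + _)%N; apply: eq_card => d.
    by rewrite !inE -andbA; congr (_ && _); rewrite andbC.
  by rewrite !inE -!andbA andbCA.
have -> : (#|bd A| = #|Bb true| + #|Bb false|)%N.
  rewrite -(cardsID [set d | sg d] (bd A)); congr (_ + _)%N; apply: eq_card => d.
    by rewrite !inE eqb_id.
  by rewrite !inE eqbF_neg andbC.
have /eqP : (#|I true| + #|Bb true| = #|I true| + #|Bb false|)%N.
  by rewrite -cB cS cB cI.
by rewrite eqn_add2l => /eqP ->; rewrite addnn odd_double.
Qed.

Variable root : V.
Hypothesis conn : forall B, B != set0 -> root \notin B -> bd B != set0.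

Definition two_pt D := [&& D != set0, root \notin D & #|bd D| == 2%N].

(** The boundary is nonempty by [conn], even by parity, and different from two by minimality. *)
Lemma bd_ge4 D B : (forall D', two_pt D' -> (#|D| <= #|D'|)%N) -> root \notin D ->
  B != set0 -> B \proper D -> (4 <= #|bd B|)%N.
Proof.
move=> Dmin rD B0 BD; have rB : root \notin B.
  by apply: contra rD; apply: (subsetP (proper_sub BD)).
have := bd_even B; have := conn B0 rB; rewrite -card_gt0.
case hc: #|bd B| => [|[|[|[|k]]]] // _ _.
have /Dmin : two_pt B by rewrite /two_pt B0 rB hc.
by rewrite leqNgt (proper_card BD).
Qed.

(** Otherwise [cut_lemma] splits [D] into two nonempty parts with at least four boundary darts each.
    These eight darts are distinct, yet each belongs to the two boundary darts of [D] or to the four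
    halves of [d] and [e]. *)
Lemma internal_same D d e :
  two_pt D -> (forall D', two_pt D' -> (#|D| <= #|D'|)%N) ->
  vt d \in D -> vt (io d) \in D ->
  (forall x, dart_flow x -> x d = x e) -> e = d \/ e = io d.
Proof.
move=> /and3P[D0 rD /eqP cD] Dmin dD idD hfl.
case: (e =P d) => [|/eqP ed]; first by left.
case: (e =P io d) => [|/eqP eid]; [by right|exfalso].
have [A [dA idA bA]] := cut_lemma ed eid hfl.
pose B := D :&: A; pose C := D :\: A.
have hB : (4 <= #|bd B|)%N.
  apply: (bd_ge4 Dmin rD); first by apply/set0Pn; exists (vt d); rewrite inE dD.
  rewrite properEneq subsetIl andbT; apply/eqP => h.
  by move: idD; rewrite -h inE (negbTE idA) andbF.
have hC : (4 <= #|bd C|)%N.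
  apply: (bd_ge4 Dmin rD); first by apply/set0Pn; exists (vt (io d)); rewrite inE idD idA.
  rewrite properEneq subsetDl andbT; apply/eqP => h.
  by move: dD; rewrite -h inE dA.
have dis : [disjoint bd B & bd C].
  rewrite -setI_eq0; apply/eqP/setP => c; rewrite !inE.
  by case: (vt c \in A); rewrite ?andbF ?andFb.
have : (#|bd B :|: bd C| <= 6)%N.
  apply: (@leq_trans #|bd D :|: [set d; io d; e; io e]|).
    apply/subset_leq_card/subsetP => c.
    have hA k : vt k \in A -> vt (io k) \notin A -> k \in [:: d; io d; e; io e].
      by move=> h1 h2; apply: (subsetP bA); rewrite !inE h1 h2.
    have key : (vt c \in A) != (vt (io c) \in A) -> c \in [set d; io d; e; io e].
      move=> h; case cA: (vt c \in A) h; case icA: (vt (io c) \in A) => // _.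
        by have := hA c cA (negbT icA); rewrite !inE -!orbA.
      have := hA (io c); rewrite ioK icA cA !inE => /(_ isT isT).
      rewrite -!orbA !(inj_eq (can_inj ioK)).
      rewrite -(inj_eq (can_inj ioK) _ d) -(inj_eq (can_inj ioK) _ e) !ioK.
      by case/or4P => ->; rewrite ?orbT.
    rewrite [c \in bd D :|: _]in_setU; move: key; case: (c \in _) => key; first by rewrite orbT.
    have {key} hA' : (vt c \in A) = (vt (io c) \in A) by apply/eqP/negPn/negP => /key.
    rewrite orbF !inE hA'.
    by case: (vt c \in D); case: (vt (io c) \in D); case: (_ \in A).
  apply: leq_trans (leq_card_setU _ _) _; rewrite cD.
  rewrite (leq_add2l 2 _ 4).
  have h2 : (#|[set d; io d]| <= 2)%N by rewrite cards2; case: (_ != _).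
  have h3 : (#|[set d; io d; e]| <= 3)%N.
    by apply: leq_trans (leq_card_setU _ _) _; rewrite cards1 addn1.
  by apply: leq_trans (leq_card_setU _ _) _; rewrite cards1 addn1.
rewrite cardsU (disjoint_setI0 dis) cards0 subn0 => h.
by have := leq_trans (leq_add hB hC) h.
Qed.

Variables (mt : V -> V) (ph : T -> T).
Hypothesis root2 : (#|[set d | vt d == root]| <= 2)%N.
Hypothesis deg : forall w, w != root -> (3 <= #|[set d | vt d == w]|)%N.
Hypothesis phK : involutive ph.
Hypothesis vt_ph : forall d, vt (ph d) = mt (vt d).
Hypothesis mtK : involutive mt.
Hypothesis mt_neq : forall w, w != root -> mt w != w.
Hypothesis mt_root : mt root = root.
Hypothesis flow_ph : forall x, dart_flow x -> forall d, x d = x (ph d).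

(* A minimal nonempty set of vertices avoiding the root and bounded by two edges
   is a pair of mates joined by three edges. *)
Lemma three_direct w0 : w0 != root ->
  exists w d0, [/\ w != root, vt d0 = w, ph d0 != io d0 &
    forall d, vt d = w -> d != d0 -> ph d = io d].
Proof.
move=> w0r.
have [D hD Dmin] : exists2 D, two_pt D & forall D', two_pt D' -> (#|D| <= #|D'|)%N.
  have h0 : two_pt [set~ root].
    have hne : [set~ root] != set0 by apply/set0Pn; exists w0; rewrite !inE.
    rewrite /two_pt hne !inE eqxx /=; apply/eqP.
    have hr : root \notin [set~ root] by rewrite !inE eqxx.
    have := bd_even [set~ root]; have := conn hne hr; rewrite -card_gt0.
    have : (#|bd [set~ root]| <= 2)%N.
      apply: leq_trans root2; rewrite -(card_imset _ (can_inj ioK)).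
      apply/subset_leq_card/subsetP => _ /imsetP[c hc ->].
      by move: hc; rewrite !inE => /andP[_]; rewrite negbK.
    by case: #|_| => [|[|[|]]].
  by case: (arg_minnP (fun D : {set V} => #|D|) h0) => D hD h; exists D.
have /and3P[D0 rD /eqP cD] := hD.
have [u uD] := set0Pn _ D0.
have ur : u != root by apply: contraNneq rD => <-.
have u'r : mt u != root by apply: contraNneq ur => h; rewrite -(mtK u) h mt_root.
(* An inner end at [u] and its image under [ph] carry the same flow, so they lie on one edge; they
   differ because [u] is not its own mate. *)
have key d : vt d = u -> d \notin bd D -> ph d = io d.
  move=> du; rewrite inE du uD /= negbK => idD.
  have [h|//] : ph d = d \/ ph d = io d.
    by apply: (internal_same hD Dmin) => //; [rewrite du|move=> x hx; apply: flow_ph].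
  by have := mt_neq ur; rewrite -du -vt_ph h eqxx.
have [d1 d1u d1b] : exists2 d, vt d = u & d \notin bd D.
  have : ~~ ([set d | vt d == u] \subset bd D).
    by apply/negP => /subset_leq_card; rewrite cD => h; have := leq_trans (deg ur) h.
  by case/subsetPn => d; rewrite inE => /eqP du db; exists d.
have u'D : mt u \in D.
  by have h := key _ d1u d1b; move: d1b; rewrite inE d1u uD /= negbK -h vt_ph d1u.
have key' d : vt d = u -> ph d != io d -> d \in bd D /\ ph d \in bd D.
  move=> du hd; have db : d \in bd D by apply: contraNT hd => /key -> //; rewrite eqxx.
  split=> //; rewrite inE vt_ph du u'D /=; apply/negP => hi.
  have [h|h] : d = ph d \/ d = io (ph d).
    apply: (internal_same hD Dmin) => //; first by rewrite vt_ph du.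
    by move=> x hx; rewrite -flow_ph.
  - by have := mt_neq ur; rewrite -du -vt_ph -h eqxx.
  - by move: hd; rewrite {2}h ioK eqxx.
(* If every end at [u] led to its image, [u] and its mate would form a set without boundary. *)
have [d0 d0u d0n] : exists2 d, vt d = u & ph d != io d.
  case: (pickP [pred d | (vt d == u) && (ph d != io d)]) => [d /andP[/eqP h1 h2]|hn].
    by exists d.
  have hall d : vt d = u -> ph d = io d.
    by move=> du; have := hn d; rewrite /= du eqxx /= => /eqP.
  have : bd [set u; mt u] != set0.
    apply: conn; last by rewrite !inE negb_or ![root == _]eq_sym ur u'r.
    by apply/set0Pn; exists u; rewrite !inE eqxx.
  case/set0Pn => c; rewrite !inE => /andP[/orP[/eqP cu|/eqP cu]].
    by rewrite -(hall c cu) vt_ph cu eqxx orbT.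
  have pc : vt (ph c) = u by rewrite vt_ph cu mtK.
  have := hall _ pc; rewrite phK => /(congr1 io); rewrite ioK => ->.
  by rewrite pc eqxx.
exists u, d0; split=> // d du dd0; apply/eqP/negPn/negP => dn.
(* A second exceptional end would produce three distinct boundary darts of [D]. *)
have [b1 b2] := key' _ du dn; have [b3 b4] := key' _ d0u d0n.
have vv a b : vt a = u -> vt b = u -> a != ph b.
  move=> au bu; apply/eqP => h; have := mt_neq ur.
  by rewrite -{1}bu -vt_ph -h au eqxx.
have : (#|[set d; d0; ph d]| <= #|bd D|)%N.
  by apply/subset_leq_card/subsetP => c; rewrite !inE -orbA => /or3P[] /eqP ->; move: b1 b2 b3; rewrite !inE.
rewrite cD -setUA cardsU1 cards2 !inE negb_or dd0 (vv d d) // (vv d0 d) //.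
Qed.

End Darts.

Local Open Scope nat_scope.

(** * Graphs and their flows *)

Section Propagators.
Local Notation I4 := (iota 0 4).
Local Notation I8 := (iota 0 8).

(** The permutations of the four ends given by the propagators are involutions, except those of
    indices 5 and 6, which are four-cycles inverse to each other. *)
Definition invp (i : nat) : nat := if i == 5 then 6 else if i == 6 then 5 else i.

Lemma all_ord m (P : pred nat) : all P (iota 0 m) -> forall i : 'I_m, P i.
Proof. by move=> /allP h i; apply: h; rewrite mem_iota ltn_ord. Qed.

Lemma all_ord2 k m (P : nat -> nat -> bool) :
  all (fun i => all (P i) (iota 0 m)) (iota 0 k) -> forall (i : 'I_k) (j : 'I_m), P i j.
Proof. by move=> h i j; apply: (all_ord (all_ord h i)). Qed.

Lemma pm_lt (i : 'I_8) (x : 'I_4) : pm i x < 4.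
Proof. exact: (all_ord2 (P := fun i x => pm i x < 4)). Qed.
Lemma pmK (i : 'I_8) (x : 'I_4) : pm (invp i) (pm i x) = x.
Proof. by apply/eqP; apply: (all_ord2 (P := fun i x => pm (invp i) (pm i x) == x)). Qed.
Lemma pmKV (i : 'I_8) (x : 'I_4) : pm i (pm (invp i) x) = x.
Proof. by apply/eqP; apply: (all_ord2 (P := fun i x => pm i (pm (invp i) x) == x)). Qed.
Lemma pm_inv_lt (i : 'I_8) (x : 'I_4) : pm (invp i) x < 4.
Proof. exact: (all_ord2 (P := fun i x => pm (invp i) x < 4)). Qed.
Lemma invp_lt (i : 'I_8) : invp i < 8.
Proof. exact: (all_ord (P := fun i => invp i < 8)). Qed.
Lemma pm_inv_sym (i : 'I_8) (x y : 'I_4) : (pm (invp i) x == y) = (pm i y == x).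
Proof. by apply/eqP/eqP => <-; rewrite ?pmKV ?pmK. Qed.
End Propagators.

(** * Types, well-formedness, and graphs built from a tree and a dashed relation *)

Section Graph.
Variables (n : nat).
Implicit Types (G : graph n) (s t : slot n).

Definition acyclic (pa : 'I_n -> slot n) :=
  exists d : 'I_n -> nat, forall v u c, pa v = inr (u, c) -> d u < d v.

Lemma ty_fuel_inl (pa : 'I_n -> slot n) f b : ty_fuel pa f (inl b) = b.
Proof. by case: f. Qed.

(** The number of vertices of rank at most that of [u] drops strictly at each step towards the root,
    so it bounds the length of the recursion; fuel beyond it changes nothing. *)
Lemma ty_fuel_stable (pa : 'I_n -> slot n) (d : 'I_n -> nat) :
  (forall v u c, pa v = inr (u, c) -> d u < d v) -> forall f f' s,
  let rk := if s is inr (u, _) then #|[set w | d w <= d u]| else 0 in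
  rk <= f -> rk <= f' -> ty_fuel pa f s = ty_fuel pa f' s.
Proof.
move=> hd; elim=> [|f IH] f' [b|[u c]] /=; rewrite ?ty_fuel_inl //.
  rewrite leqn0 cards_eq0 => /eqP/setP/(_ u).
  by rewrite !inE leqnn.
move=> h1; case: f' => [|f'] h2.
  move: h2; rewrite leqn0 cards_eq0 => /eqP/setP/(_ u).
  by rewrite !inE leqnn.
rewrite /=; suff -> : ty_fuel pa f (pa u) = ty_fuel pa f' (pa u) by [].
case pu: (pa u) => [b|[w c']]; first by rewrite !ty_fuel_inl.
have lt : #|[set x | d x <= d w]| < #|[set x | d x <= d u]|.
  apply: proper_card; apply/properP; split.
    by apply/subsetP => x; rewrite !inE => /leq_trans; apply; apply: ltnW (hd _ _ _ pu).
  by exists u; rewrite !inE // -ltnNge (hd _ _ _ pu).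
by apply: IH => /=; rewrite -ltnS; apply: leq_trans lt _.
Qed.

Lemma ty_inl G b : ty G (inl b) = b.
Proof. exact: ty_fuel_inl. Qed.

Lemma ty_inr G u c : acyclic (par G) ->
  ty G (inr (u, c)) = (c == 0 :> nat) (+) ty G (par G u).
Proof.
case=> d hd; have n0 : 0 < n by case: (n) u => // -[].
rewrite /ty (ty_fuel_stable hd (f' := n.+1)) /=; last 2 first.
- by apply: leq_trans (max_card _) _; rewrite card_ord.
- by apply: leq_trans (max_card _) _; rewrite card_ord.
by case: ifP => _; rewrite ?addTb ?addFb.
Qed.

(** The propagation rule determines types along the path to the root. Types of a modified tree are
    identified through this characterisation, without following the fuel. *)
Lemma ty_uniq G (T : slot n -> bool) : acyclic (par G) ->
  (forall b, T (inl b) = b) ->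
  (forall u c, T (inr (u, c)) = (c == 0 :> nat) (+) T (par G u)) -> T =1 ty G.
Proof.
move=> hac h0 h1; have [d hd] := hac.
have hp v : T (par G v) = ty G (par G v).
  elim: {v}(d v) {-2}v (leqnn (d v)) => [|k IH] v hv; case pv: (par G v) => [b|[u c]];
    rewrite ?h0 ?ty_inl ?h1 ?ty_inr // ?IH //.
    by have := hd _ _ _ pv; rewrite (eqP (_ : d v == 0)) // -leqn0.
  by rewrite -ltnS; apply: leq_trans (hd _ _ _ pv) hv.
by case=> [b|[u c]]; rewrite ?h0 ?ty_inl ?h1 ?ty_inr // hp.
Qed.

Lemma par_occ G v : occupied G (par G v).
Proof. by apply/existsP; exists v. Qed.

Lemma dashed_sym G s t : dashed G s t = dashed G t s.
Proof. by rewrite /dashed orbC. Qed.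

Section WF.
Variable G : graph n.
Hypothesis wf : wf_graph G.

Lemma wf_inj : injective (par G). Proof. by case: wf. Qed.
Lemma wf_acyclic : acyclic (par G). Proof. by case: wf => _ []. Qed.
Lemma mateK : involutive (mate G).
Proof. by case: wf => _ [_ [h _]] v; case: (h v). Qed.
Lemma mate_neq v : mate G v != v.
Proof. by case: wf => _ [_ [h _]]; case: (h v). Qed.
Lemma wf_prop v : mate G v < v -> prop G v = ord0.
Proof. by case: wf => _ [_ [_ [h _]]]; apply: h. Qed.
Lemma dash_leafB s : leafA G s -> leafB G (dash G s).
Proof. by case: wf => _ [_ [_ [_ [h _]]]]; apply: h. Qed.
Lemma dash_id s : ~~ leafA G s -> dash G s = s.
Proof. by case: wf => _ [_ [_ [_ [_ [h _]]]]]; apply: h. Qed.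
Lemma dash_inj : {in leafA G &, injective (dash G)}.
Proof. by case: wf => _ [_ [_ [_ [_ [_ [h _]]]]]]. Qed.
Lemma dash_surj t : leafB G t -> exists2 s, leafA G s & dash G s = t.
Proof. by case: wf => _ [_ [_ [_ [_ [_ [_ h]]]]]]; apply: h. Qed.

Lemma dashed_leaf s t : dashed G s t ->
  [/\ ~~ occupied G s, ~~ occupied G t & ty G s = ~~ ty G t].
Proof.
case/orP => /andP[hA /eqP <-]; have /andP[h1 h2] := dash_leafB hA;
  case/andP: hA => h3 h4; split=> //; first by rewrite h4 (negbTE h2).
by rewrite h4 (negbTE h2).
Qed.

Lemma dashed_fun s t t' : dashed G s t -> dashed G s t' -> t = t'.
Proof.
move=> h h'; have [s1 t1 st1] := dashed_leaf h; have [_ t1' st1'] := dashed_leaf h'.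
have tyt : ty G t = ~~ ty G s by rewrite st1 negbK.
have tyt' : ty G t' = ~~ ty G s by rewrite st1' negbK.
move: h h'; rewrite /dashed /leafA s1 t1 t1' tyt tyt' /=.
case tys: (ty G s) => /=; first by rewrite !orbF => /eqP -> /eqP.
move=> /eqP h /eqP h'.
by apply: dash_inj; rewrite ?h // unfold_in /= /leafA ?t1 ?t1' ?tyt ?tyt' ?tys.
Qed.

Lemma dashed_tot s : ~~ occupied G s -> exists t, dashed G s t.
Proof.
move=> s1; case tys: (ty G s).
  by exists (dash G s); rewrite /dashed /leafA s1 tys eqxx.
have /dash_surj [t ht hts] : leafB G s by rewrite /leafB s1 tys.
by exists t; rewrite dashed_sym /dashed ht hts eqxx.
Qed.

Lemma dashed_neq s t : dashed G s t -> s != t.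
Proof.
by move=> /dashed_leaf[_ _ h]; apply/eqP => e; move: h; rewrite e; case: ty.
Qed.
End WF.

Definition leafp (pa : 'I_n -> slot n) s := ~~ [exists v, pa v == s].

(** Dashed edges are handled as a symmetric relation [Dr]; the canonical form of [dash], the
    identity off the alpha leaves, is restored only here. *)
Definition mkgraph (pa : 'I_n -> slot n) (Dr : rel (slot n)) (mt : 'I_n -> 'I_n)
    (pr : 'I_n -> 'I_8) : graph n :=
  ([ffun v => pa v],
   [ffun s => if leafp pa s && ty_fuel pa n s then odflt s [pick t | Dr s t] else s],
   [ffun v => mt v], [ffun v => pr v]).

Section Mk.
Variables (pa : 'I_n -> slot n) (Dr : rel (slot n)) (mt : 'I_n -> 'I_n) (pr : 'I_n -> 'I_8).
Let M := mkgraph pa Dr mt pr.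

Lemma mk_par v : par M v = pa v. Proof. by rewrite /par ffunE. Qed.
Lemma mk_mate v : mate M v = mt v. Proof. by rewrite /mate ffunE. Qed.
Lemma mk_prop v : prop M v = pr v. Proof. by rewrite /prop ffunE. Qed.

Lemma ty_fuel_ext (pa1 pa2 : 'I_n -> slot n) f s : pa1 =1 pa2 -> ty_fuel pa1 f s = ty_fuel pa2 f s.
Proof. by move=> h; elim: f s => [|f IH] [b|[u c]] //=; rewrite h IH. Qed.

Lemma mk_ty s : ty M s = ty_fuel pa n s.
Proof. by apply: ty_fuel_ext => v; rewrite mk_par. Qed.
Lemma mk_occ s : occupied M s = [exists v, pa v == s].
Proof. by apply: eq_existsb => v; rewrite mk_par. Qed.

Hypothesis pa_inj : injective pa.
Hypothesis pa_ac : acyclic pa.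
Hypothesis mtP : forall v, mt (mt v) = v /\ mt v != v.
Hypothesis prP : forall v, mt v < v -> pr v = ord0.
Hypothesis DrS : forall s t, Dr s t -> Dr t s.
Hypothesis DrF : forall s t t', Dr s t -> Dr s t' -> t = t'.
Hypothesis DrL : forall s t, Dr s t -> leafp pa s.
Hypothesis DrTot : forall s, leafp pa s -> exists t, Dr s t.
Hypothesis DrTy : forall s t, Dr s t -> ty M s = ~~ ty M t.

Lemma mk_leafA s : leafA M s = leafp pa s && ty M s.
Proof. by rewrite /leafA mk_occ. Qed.

Lemma mk_dash s t : leafA M s -> Dr s t -> dash M s = t.
Proof.
rewrite mk_leafA /dash /= ffunE mk_ty => -> h; case: pickP => [t' /= h'|/(_ t)].
  exact: DrF h' h.
by rewrite h.
Qed.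

Lemma mk_dashed s t : dashed M s t = Dr s t.
Proof.
have aux x y : leafA M x -> dash M x == y -> Dr x y.
  move=> hA /eqP <-; have /DrTot [y' hy'] : leafp pa x by move: hA; rewrite mk_leafA => /andP[].
  by rewrite (mk_dash hA hy').
apply/idP/idP => [/orP[] /andP[h1 h2]|h].
- exact: aux.
- by apply: DrS; apply: aux.
have hs := DrL h; have ht := DrL (DrS h); have hty := DrTy h.
rewrite /dashed !mk_leafA hs ht /=; case e: (ty M s) hty => /= he.
  by rewrite (mk_dash _ h) ?eqxx // mk_leafA hs e.
move/esym/negPn: he => he.
by rewrite he (mk_dash _ (DrS h)) ?eqxx // mk_leafA ht he.
Qed.

Lemma mk_wf : wf_graph M.
Proof.
split; first by move=> u v; rewrite !mk_par => /pa_inj.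
split; first by have [d hd] := pa_ac; exists d => v u c; rewrite mk_par; apply: hd.
split; first by move=> v; rewrite !mk_mate.
split; first by move=> v; rewrite mk_mate mk_prop; apply: prP.
split.
  move=> s hA; have /andP[/DrTot [t ht] hty] : leafp pa s && ty M s by rewrite -mk_leafA.
  rewrite (mk_dash hA ht) /leafB mk_occ (DrTy (DrS ht)) hty andbT; exact: DrL (DrS ht).
split.
  by move=> s; rewrite mk_leafA mk_ty /dash /= ffunE => /negbTE ->.
split.
  move=> s s' hs hs' he.
  have /andP[/DrTot [t ht] _] : leafp pa s && ty M s by rewrite -mk_leafA.
  have /andP[/DrTot [t' ht'] _] : leafp pa s' && ty M s' by rewrite -mk_leafA.
  move: he; rewrite (mk_dash hs ht) (mk_dash hs' ht') => e; rewrite -e in ht'.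
  exact: DrF (DrS ht) (DrS ht').
move=> t /andP[]; rewrite mk_occ => /DrTot [s hs] hty; exists s.
  by rewrite mk_leafA (DrL (DrS hs)) (DrTy (DrS hs)) hty.
apply: mk_dash; last exact: DrS.
by rewrite mk_leafA (DrL (DrS hs)) (DrTy (DrS hs)) hty.
Qed.
End Mk.

End Graph.

(** * Flows on slots, propagators, and the half-edges of a graph *)

Section Flows.
Variable n : nat.
Implicit Types (G : graph n) (s t : slot n) (v u : 'I_n) (i j : 'I_4) (c : 'I_3).

Definition c0 : 'I_3 := @Ordinal 3 0 isT.
Definition c1 : 'I_3 := @Ordinal 3 1 isT.
Definition c2 : 'I_3 := @Ordinal 3 2 isT.

Definition endslot G v i : slot n :=
  if unlift ord0 i is Some c then inr (v, c) else par G v.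

Lemma endslot0 G v : endslot G v ord0 = par G v.
Proof. by rewrite /endslot unlift_none. Qed.
Lemma endslotS G v c : endslot G v (lift ord0 c) = inr (v, c).
Proof. by rewrite /endslot liftK. Qed.

Lemma big_I4 (W : nmodType) (F : 'I_4 -> W) :
  (\sum_i F i = F ord0 + F (lift ord0 c0) + F (lift ord0 c1) + F (lift ord0 c2))%R.
Proof.
rewrite !big_ord_recl big_ord0 addr0 !addrA.
by congr (_ + F _ + F _ + F _)%R; apply: val_inj.
Qed.

Lemma I3P c : [\/ c = c0, c = c1 | c = c2].
Proof.
by case: c => [[|[|[|]]]] // h; [apply: Or31|apply: Or32|apply: Or33]; apply: val_inj.
Qed.

Lemma I4P i : i = ord0 \/ exists c, i = lift ord0 c.
Proof. by case: (unliftP ord0 i) => [c ->|->]; [right; exists c|left]. Qed.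

(** Conservation in the form [S = j + (S - j) = k + (S - k)]. Indexing by slots gives each solid
    edge a single momentum. The codomain is any commutative monoid, since both natural attributions
    and rational test flows occur. *)
Definition gflow (W : nmodType) G (x : slot n -> W) :=
  [/\ x (inl true) = x (inl false),
      forall v, (x (par G v) + x (inr (v, c0)) = x (inr (v, c1)) + x (inr (v, c2)))%R &
      forall s t, dashed G s t -> x s = x t].

Definition matched (W : Type) G (x : slot n -> W) :=
  forall v i j, prop_rel G v i j -> x (endslot G v i) = x (endslot G (mate G v) j).

Definition redundant G := forall x : slot n -> rat, gflow G x -> matched G x.

Section WF.
Variable G : graph n.
Hypothesis wf : wf_graph G.
Local Notation mate := (mate G).
Local Notation par := (par G).
Local Notation ty := (ty G).

Lemma prop_rel_sym v i j : prop_rel G v i j = prop_rel G (mate v) j i.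
Proof.
rewrite /prop_rel (mateK wf); case: ltngtP => // h.
by case/eqP: (mate_neq wf v); apply: val_inj; rewrite /= h.
Qed.

Lemma prop_rel_ex v i : exists j, prop_rel G v i j.
Proof.
rewrite /prop_rel; case: (v < mate v); first by exists (Ordinal (pm_lt (prop G v) i)) => /=.
by exists (Ordinal (pm_inv_lt (prop G (mate v)) i)); rewrite /= pmKV.
Qed.

Lemma prop_rel_inj v i i' j : prop_rel G v i j -> prop_rel G v i' j -> i = i'.
Proof.
rewrite /prop_rel; case: ifP => _ /eqP h1 /eqP h2; apply: val_inj => /=; last by rewrite -h1 h2.
by rewrite -[LHS](pmK (prop G v)) h1 -h2 pmK.
Qed.

Lemma prop_rel_fun v i j j' : prop_rel G v i j -> prop_rel G v i j' -> j = j'.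
Proof. by rewrite !(prop_rel_sym v); apply: prop_rel_inj. Qed.

Definition pend v i : 'I_4 := odflt ord0 [pick j | prop_rel G v i (nat_of_ord j)].

Lemma pendP v i : prop_rel G v i (pend v i).
Proof.
rewrite /pend; case: pickP => //= h; have [j] := prop_rel_ex v i.
by rewrite h.
Qed.

Lemma pendK v i : pend (mate v) (pend v i) = i.
Proof.
apply: (prop_rel_fun (v := mate v) (i := pend v i)); first exact: pendP.
by rewrite -prop_rel_sym pendP.
Qed.

(** The half-edges of the graph in which the root is the additional vertex [None]: [top s] is the
    half attached at the slot [s], and [bot v] the half of the parent edge at [v]. Both halves of a
    dashed edge are of the form [top]. *)
Definition dart : finType := (bool + 'I_n * 'I_4)%type.
Implicit Types d : dart.

Definition top s : dart := match s with inl b => inl b | inr (u, c) => inr (u, lift ord0 c) end.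
Definition bot v : dart := inr (v, ord0).

Lemma top_inj : injective top.
Proof.
case=> [b|[u c]] [b'|[u' c']] //=; first by case=> ->.
by move=> /eqP; rewrite [_ == _]xpair_eqE => /andP[/eqP -> /eqP /lift_inj ->].
Qed.
Lemma top_bot s v : top s <> bot v.
Proof.
by case: s => [b|[u c]] //= /eqP; rewrite [_ == _]xpair_eqE andbC eq_sym (negbTE (neq_lift _ _)).
Qed.

Lemma dartP d : (exists s, d = top s) \/ (exists v, d = bot v).
Proof.
case: d => [b|[v i]]; first by left; exists (inl b).
case: (unliftP ord0 i) => [c ->|->]; last by right; exists v.
by left; exists (inr (v, c)).
Qed.

Definition ptn s := odflt s [pick t | dashed G s t].
Lemma ptnP s t : dashed G s t -> ptn s = t.
Proof.
rewrite /ptn => h; case: pickP => [t' h'|/(_ t)]; last by rewrite h.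
exact: dashed_fun h' h.
Qed.

Definition dio d : dart :=
  match d with
  | inl b => if [pick v | par v == inl b] is Some v then bot v else top (ptn (inl b))
  | inr (v, i) =>
    if unlift ord0 i is Some c then
      if [pick w | par w == inr (v, c)] is Some w then bot w else top (ptn (inr (v, c)))
    else top (par v)
  end.

Definition dvt d : option 'I_n := match d with inl _ => None | inr (v, _) => Some v end.
(** Orientation by type. The half at a slot has the type of the slot and a parent half the opposite
    one, so the halves of a solid edge disagree; those of a dashed edge disagree because it joins
    opposite types. *)
Definition dsg d : bool :=
  match d with
  | inl b => b
  | inr (v, i) => if unlift ord0 i is Some c then ty (inr (v, c)) else ~~ ty (par v)
  end.
Definition dph d : dart := match d with inl b => inl b | inr (v, i) => inr (mate v, pend v i) end.

Lemma dio_bot v : dio (bot v) = top (par v). Proof. by rewrite /= unlift_none. Qed.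
Lemma dio_par v : dio (top (par v)) = bot v.
Proof.
have h s : par v = s -> (if [pick w | par w == s] is Some w then bot w else top (ptn s)) = bot v.
  move=> hs; case: pickP => [w /eqP|/(_ v)]; last by rewrite hs eqxx.
  by rewrite -hs => /(wf_inj wf) ->.
by case e: (par v) => [b|[u c]] /=; rewrite ?liftK h.
Qed.
Lemma dio_dashed s t : dashed G s t -> dio (top s) = top t.
Proof.
move=> h; have [h1 _ _] := dashed_leaf wf h.
have h2 : [pick w | par w == s] = None.
  by case: pickP => // w /= hw; case/negP: h1; apply/existsP; exists w.
by case: s h h1 h2 => [b|[u c]] h h1 h2 /=; rewrite ?liftK h2 (ptnP h).
Qed.

Lemma slotP s : (exists v, s = par v) \/ (exists t, dashed G s t).
Proof.
case: (boolP (occupied G s)) => [/existsP[v /eqP <-]|/(dashed_tot wf)]; [left; by exists v|by right].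
Qed.

Lemma dioK : involutive dio.
Proof.
move=> d; case: (dartP d) => [[s ->]|[v ->]]; last by rewrite dio_bot dio_par.
case: (slotP s) => [[v ->]|[t h]]; first by rewrite dio_par dio_bot.
by rewrite (dio_dashed h) (dio_dashed (t := s)) // dashed_sym.
Qed.

Lemma dsg_top s : dsg (top s) = ty s.
Proof. by case: s => [b|[u c]] /=; rewrite ?liftK // ty_inl. Qed.
Lemma dsg_bot v : dsg (bot v) = ~~ ty (par v).
Proof. by rewrite /= unlift_none. Qed.

Lemma dsg_io d : dsg (dio d) = ~~ dsg d.
Proof.
case: (dartP d) => [[s ->]|[v ->]]; last by rewrite dio_bot dsg_top dsg_bot negbK.
case: (slotP s) => [[v ->]|[t h]]; first by rewrite dio_par dsg_top dsg_bot.
by rewrite (dio_dashed h) !dsg_top; have [_ _ ->] := dashed_leaf wf h; rewrite negbK.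
Qed.

Lemma ty_inr0 v : ty (inr (v, c0)) = ~~ ty (par v).
Proof. by rewrite (ty_inr _ _ (wf_acyclic wf)). Qed.
Lemma ty_inr1 v : ty (inr (v, c1)) = ty (par v).
Proof. by rewrite (ty_inr _ _ (wf_acyclic wf)). Qed.
Lemma ty_inr2 v : ty (inr (v, c2)) = ty (par v).
Proof. by rewrite (ty_inr _ _ (wf_acyclic wf)). Qed.

(** By the type rule the ends of e1 and e2 at [v] have one sign and those of e3 and e4 the other;
    reversing the order of the ends exchanges these pairs. *)
Lemma dsg_rev v i : dsg (inr (v, rev_ord i)) = ~~ dsg (inr (v, i)).
Proof.
have e0 : dsg (inr (v, ord0)) = ~~ ty (par v) by rewrite dsg_bot.
have eS c : dsg (inr (v, lift ord0 c)) = ty (inr (v, c)) by rewrite -dsg_top.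
have r0 : rev_ord (ord0 : 'I_4) = lift ord0 c2 by apply: val_inj.
have r1 : rev_ord (lift ord0 c0 : 'I_4) = lift ord0 c1 by apply: val_inj.
have r2 : rev_ord (lift ord0 c1 : 'I_4) = lift ord0 c0 by apply: val_inj.
have r3 : rev_ord (lift ord0 c2 : 'I_4) = ord0 by apply: val_inj.
case: (I4P i) => [->|[c ->]]; first by rewrite r0 eS e0 ty_inr2 negbK.
by case: (I3P c) => ->; rewrite ?r1 ?r2 ?r3 !eS ?e0 ?ty_inr0 ?ty_inr1 ?ty_inr2 ?negbK.
Qed.

Lemma dart_bal w : #|[set d | (dvt d == w) && dsg d]| = #|[set d | (dvt d == w) && ~~ dsg d]|.
Proof.
pose sw d : dart := match d with inl b => inl (~~ b) | inr (v, i) => inr (v, rev_ord i) end.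
have swK : involutive sw by case=> [b|[v i]] /=; rewrite ?negbK ?rev_ordK.
have swvt d : dvt (sw d) = dvt d by case: d => [b|[v i]].
have swsg d : dsg (sw d) = ~~ dsg d by case: d => [b|[v i]] //; apply: dsg_rev.
rewrite -(card_imset _ (can_inj swK)); apply: eq_card => d; apply/imsetP/idP.
  by move=> [e]; rewrite !inE => /andP[h1 h2] ->; rewrite swvt swsg h1 h2.
by rewrite inE => /andP[h1 h2]; exists (sw d); rewrite ?swK // inE swvt swsg h1 h2.
Qed.

Lemma dart_deg w : w != None -> 3 <= #|[set d | dvt d == w]|.
Proof.
case: w => [v|] // _; apply: (@leq_trans #|[set (inr (v, i) : dart) | i : 'I_4]|).
  by rewrite card_imset ?card_ord // => i j [].
by apply/subset_leq_card/subsetP => d /imsetP[i _ ->]; rewrite inE.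
Qed.

Lemma dart_root : #|[set d | dvt d == None]| <= 2.
Proof.
apply: (@leq_trans #|[set (inl b : dart) | b : bool]|).
  apply/subset_leq_card/subsetP => -[b|[v i]]; rewrite inE //= => _.
  by apply/imsetP; exists b.
by apply: leq_trans (leq_imset_card _ _) _; rewrite card_bool.
Qed.

(** The parent edge of a vertex of least rank in [B] leaves [B]. *)
Lemma dart_conn (B : {set option 'I_n}) : B != set0 -> None \notin B -> bd dio dvt B != set0.
Proof.
have [dd hd] := wf_acyclic wf.
case/set0Pn => -[v|] hB hN; last by rewrite hB in hN.
case: (@arg_minnP _ v (fun u => Some u \in B) dd hB) => u uB umin.
apply/set0Pn; exists (bot u); rewrite inE dio_bot /= uB /=.
case e: (par u) => [b|[w c]] //=; apply/negP => wB.
by have := umin _ wB; rewrite leqNgt (hd _ _ _ e).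
Qed.

Lemma dphK : involutive dph.
Proof. by case=> [b|[v i]] //=; rewrite pendK (mateK wf). Qed.

Lemma dart_flow_gflow (X : dart -> rat) : dart_flow dio dvt dsg X ->
  gflow G (fun s => X (top s)) /\ forall v i, X (top (endslot G v i)) = X (inr (v, i)).
Proof.
move=> [hio hdv]; split; last first.
  by move=> v i; case: (I4P i) => [->|[c ->]]; rewrite ?endslot0 ?endslotS // -dio_bot hio.
split.
- have := hdv None; rewrite /dv (reindex (fun b : bool => inl b : dart)) /=; last first.
    by exists (fun d : dart => if d is inl b then b else true) => [//|[b|[v i]]] //; rewrite inE.
  rewrite !big_bool /= /sgn /= expr0 expr1 mul1r mulN1r => /eqP.
  by rewrite addrC subr_eq0 => /eqP.
- move=> v; have := hdv (Some v).
  rewrite /dv (reindex (fun i : 'I_4 => inr (v, i) : dart)) /=; last first.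
    exists (fun d : dart => if d is inr (_, i) then i else ord0) => [//|[b|[w i]]] //.
    by rewrite inE => /eqP [->].
  under eq_bigl => i do rewrite eqxx.
  have e0 : dsg (inr (v, ord0)) = ~~ ty (par v) by rewrite dsg_bot.
  have eS c : dsg (inr (v, lift ord0 c)) = ty (inr (v, c)) by rewrite -dsg_top.
  rewrite big_I4 /sgn e0 !eS ty_inr0 ty_inr1 ty_inr2.
  rewrite -(hio (top (par v))) dio_par /bot /=.
  move: (X (inr (v, ord0))) => a0.
  move: (X _) (X _) (X _) => a1 a2 a3.
  by case: (ty _); rewrite /= ?expr0 ?expr1 => h; lra.
- by move=> s t h; rewrite -hio (dio_dashed h).
Qed.

Lemma redundant_direct : redundant G -> 'I_n -> exists v d0, dvt d0 = Some v /\
  forall i, inr (v, i) != d0 -> dio (inr (v, i)) = inr (mate v, pend v i).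
Proof.
move=> red v0.
pose mt (w : option 'I_n) := omap mate w.
have [] := @three_direct dart _ dio dvt dsg dioK dsg_io dart_bal None dart_conn mt dph
   dart_root dart_deg dphK _ _ _ _ _ (Some v0) isT.
- by case=> [b|[v i]].
- by case=> [v|] //=; rewrite (mateK wf).
- by case=> [v|] //= _; apply/eqP => -[] /eqP; rewrite (negbTE (mate_neq wf v)).
- by [].
- move=> X /dart_flow_gflow [hX he] [b|[v i]] //.
  by have := red _ hX v i (pend v i) (pendP v i); rewrite !he.
move=> [v|] [d0 [//= _ h1 _ h2]]; exists v, d0; split=> // i hi.
exact/esym/(h2 (inr (v, i)) erefl hi).
Qed.

(* When the end of [v] not shared with its mate is a child end, the parent of
   [v] is its mate, and the roles can be exchanged. *)
Lemma free_top : redundant G -> 'I_n -> exists v, forall c, exists j,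
  prop_rel G v (lift ord0 c : 'I_4) j /\
  ((j = ord0 /\ par (mate v) = inr (v, c)) \/
   exists2 c', j = lift ord0 c' & dashed G (inr (v, c)) (inr (mate v, c'))).
Proof.
move=> red v0; have [v [d0 [hv0 h]]] := redundant_direct red v0.
have dir u c j : dio (top (inr (u, c))) = inr (mate u, j) ->
    (j = ord0 /\ par (mate u) = inr (u, c)) \/
    exists2 c', j = lift ord0 c' & dashed G (inr (u, c)) (inr (mate u, c')).
  case: (slotP (inr (u, c))) => [[w ->]|[t ht]].
    by rewrite dio_par => -[-> <-]; left.
  rewrite (dio_dashed ht) => e; right; case: t e ht => [b|[w c']] //= [-> <-] ht.
  by exists c'.
case: (boolP (d0 == bot v)) => [/eqP hd0|hd0].
  exists v => c; exists (pend v (lift ord0 c)); split; first exact: pendP.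
  by apply: dir; apply: h; rewrite hd0; apply/eqP; apply: (@top_bot (inr (v, c))).
have hb : top (par v) = inr (mate v, pend v ord0).
  by rewrite -dio_bot; apply: h; rewrite eq_sym.
case: (I4P (pend v ord0)) => [e|[c e]].
  by move: hb; rewrite e => /top_bot.
have pv : par v = inr (mate v, c).
  by apply: top_inj; rewrite hb e.
have hd i : inr (v, i) != d0 -> dio (inr (mate v, pend v i)) = inr (v, i).
  by move=> hu; rewrite -h // dioK.
exists (mate v) => c'; exists (pend (mate v) (lift ord0 c')); split; first exact: pendP.
apply: dir; rewrite (mateK wf).
set i := pend (mate v) _.
have ei : lift ord0 c' = pend v i by rewrite -(pendK (mate v) (lift ord0 c')) (mateK wf).
have -> : top (inr (mate v, c')) = inr (mate v, pend v i) by rewrite /= ei.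
apply: (hd); apply/eqP => hi.
have : inr (v, ord0) != d0 by rewrite eq_sym.
rewrite -hi => /eqP hi0.
(* if the remaining end is paired with a child end of the mate, its parent end would be direct *)
have : exists2 k, pend v k = ord0 & inr (v, k) != d0.
  exists (pend (mate v) ord0); first by rewrite -{1}(mateK wf v) pendK.
  rewrite -hi; apply/eqP => -[] hk.
  have := ei; rewrite -hk -{1}(mateK wf v) pendK => /eqP.
  by rewrite eq_sym (negbTE (neq_lift _ _)).
case=> k hk /hd; rewrite hk dio_bot => hm.
have [dd hdd] := wf_acyclic wf.
case pm: (par (mate v)) hm => [b|[u c'']] //= [eu _].
have := hdd _ _ _ pv; have := hdd _ _ _ pm; rewrite eu => l1 l2.
by have := ltn_trans l1 l2; rewrite ltnn.
Qed.

End WF.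
End Flows.

(** * Isomorphisms and relabelling *)

Section Iso.
Variable n : nat.
Implicit Types (G : graph n) (k : {perm 'I_n}) (s t : slot n).

Lemma map_slotK (f g : 'I_n -> 'I_n) : cancel f g -> cancel (map_slot f) (map_slot g).
Proof. by move=> h [b|[u c]] //=; rewrite h. Qed.

Lemma map_slot_permK k : cancel (map_slot k) (map_slot (k^-1)%g).
Proof. exact: map_slotK (permK k). Qed.
Lemma map_slot_permKV k : cancel (map_slot (k^-1)%g) (map_slot k).
Proof. exact: map_slotK (permKV k). Qed.

Lemma map_slot_comp (f g : 'I_n -> 'I_n) s : map_slot f (map_slot g s) = map_slot (f \o g) s.
Proof. by case: s => [b|[u c]]. Qed.
Lemma eq_map_slot (f g : 'I_n -> 'I_n) : f =1 g -> map_slot f =1 map_slot g.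
Proof. by move=> h [b|[u c]] //=; rewrite h. Qed.

Definition iso_by k G0 G :=
  [/\ forall v, par G (k v) = map_slot k (par G0 v),
      forall s t, dashed G0 s t = dashed G (map_slot k s) (map_slot k t),
      forall v, mate G (k v) = k (mate G0 v) &
      forall v (x y : 'I_4), prop_rel G0 v x y = prop_rel G (k v) x y].

Lemma iso_byP G0 G : iso G0 G <-> exists k, iso_by k G0 G.
Proof.
split=> [[k [h1 [h2 [h3 h4]]]]|[k [h1 h2 h3 h4]]]; exists k.
  by split.
by do !split.
Qed.

Lemma iso_by_sym k G0 G : iso_by k G0 G -> iso_by k^-1 G G0.
Proof.
move=> [h1 h2 h3 h4]; split.
- by move=> v; rewrite -{2}(permKV k v) h1 map_slot_permK.
- by move=> s t; rewrite h2 !map_slot_permKV.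
- by move=> v; rewrite -{2}(permKV k v) h3 permK.
- by move=> v x y; rewrite h4 permKV.
Qed.

Lemma iso_trans G1 G2 G3 : iso G1 G2 -> iso G2 G3 -> iso G1 G3.
Proof.
move=> /iso_byP [k [h1 h2 h3 h4]] /iso_byP [l [g1 g2 g3 g4]]; apply/iso_byP; exists (k * l)%g.
have e : map_slot (k * l)%g =1 map_slot l \o map_slot k.
  by move=> s /=; rewrite map_slot_comp; apply: eq_map_slot => v; rewrite permM.
split=> *; rewrite ?permM ?e /=.
- by rewrite g1 h1.
- by rewrite h2 g2.
- by rewrite g3 h3.
- by rewrite h4 g4.
Qed.

Lemma iso_by_endslot k G0 G v i : iso_by k G0 G ->
  endslot G (k v) i = map_slot k (endslot G0 v i).
Proof. by case=> h1 _ _ _; case: (I4P i) => [->|[c ->]]; rewrite ?endslot0 ?endslotS. Qed.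

Lemma iso_by_gflow (W : nmodType) k G0 G (x : slot n -> W) :
  iso_by k G0 G -> gflow G x -> gflow G0 (x \o map_slot k).
Proof.
move=> [h1 h2 h3 h4] [x1 x2 x3]; split=> //= [v|s t].
  by rewrite -h1 -x2.
by rewrite h2; apply: x3.
Qed.

Lemma iso_by_matched (W : Type) k G0 G (x : slot n -> W) :
  iso_by k G0 G -> matched G x -> matched G0 (x \o map_slot k).
Proof.
move=> h hm v i j /= hp; rewrite -!(iso_by_endslot _ _ h); have [h1 h2 h3 h4] := h.
by rewrite -h3; apply: hm; rewrite -h4.
Qed.

Lemma iso_by_redundant k G0 G : iso_by k G0 G -> redundant G -> redundant G0.
Proof.
move=> h red x /(iso_by_gflow (iso_by_sym h)) /red /(iso_by_matched h) hm v i j hp.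
by have := hm v i j hp; rewrite /= !map_slot_permK.
Qed.

Lemma iso_by_ty k (pa0 pa : 'I_n -> slot n) : (forall v, pa (k v) = map_slot k (pa0 v)) ->
  forall f s, ty_fuel pa f (map_slot k s) = ty_fuel pa0 f s.
Proof. by move=> h; elim=> [|f IH] [b|[u c]] //=; rewrite h IH. Qed.

(** The propagator indices are a separate argument: [k] may exchange which vertex of a pair has the
    smaller label, and then the index has to change. *)
Definition pull k (pr : 'I_n -> 'I_8) G : graph n :=
  mkgraph (fun u => map_slot (k^-1)%g (par G (k u)))
    (fun s t => dashed G (map_slot k s) (map_slot k t))
    (fun u => (k^-1)%g (mate G (k u))) pr.

Lemma pullP k pr G : wf_graph G ->
  (forall u, (k^-1)%g (mate G (k u)) < u -> pr u = ord0) ->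
  (forall u (i j : 'I_4), prop_rel (pull k pr G) u i j = prop_rel G (k u) i j) ->
  wf_graph (pull k pr G) /\ iso_by k (pull k pr G) G.
Proof.
move=> wf hpr hrel; set pa := fun u => map_slot (k^-1)%g (par G (k u)).
have hpa v : par G (k v) = map_slot k (pa v) by rewrite map_slot_permKV.
have hleaf s t : dashed G (map_slot k s) (map_slot k t) -> leafp pa s.
  move=> /(dashed_leaf wf) [h _ _]; apply: contra h => /existsP[v /eqP <-].
  by apply/existsP; exists (k v); rewrite hpa.
have pinj : injective pa.
  move=> u v /(congr1 (map_slot k)); rewrite -!hpa => /(wf_inj wf).
  exact: perm_inj.
have pac : acyclic pa.
  have [d hd] := wf_acyclic wf; exists (fun v => d (k v)) => v u c e.
  by apply: (hd (k v) (k u) c); rewrite hpa e.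
have pmt v : (k^-1)%g (mate G (k ((k^-1)%g (mate G (k v))))) = v /\ (k^-1)%g (mate G (k v)) != v.
  rewrite permKV (mateK wf) permK; split=> //.
  by rewrite -(inj_eq (@perm_inj _ k)) permKV mate_neq.
have dS s t : dashed G (map_slot k s) (map_slot k t) -> dashed G (map_slot k t) (map_slot k s).
  by rewrite dashed_sym.
have dF s t t' : dashed G (map_slot k s) (map_slot k t) ->
    dashed G (map_slot k s) (map_slot k t') -> t = t'.
  by move=> h /(dashed_fun wf h) /(can_inj (map_slot_permK k)).
have dT s : leafp pa s -> exists t, dashed G (map_slot k s) (map_slot k t).
  move=> hs; have [|t ht] := dashed_tot wf (s := map_slot k s).
    apply: contra hs => /existsP[v /eqP hv]; apply/existsP; exists ((k^-1)%g v).
    by rewrite /pa permKV hv map_slot_permK.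
  by exists (map_slot (k^-1)%g t); rewrite map_slot_permKV.
have dTy s t : dashed G (map_slot k s) (map_slot k t) ->
    ty (pull k pr G) s = ~~ ty (pull k pr G) t.
  have e u : ty (pull k pr G) u = ty G (map_slot k u).
    rewrite /ty (iso_by_ty (pa0 := par (pull k pr G))) // => v.
    by rewrite mk_par map_slot_permKV.
  by rewrite !e => /(dashed_leaf wf) [].
have hd := mk_dashed (mt := fun u => (k^-1)%g (mate G (k u))) (pr := pr) dS dF hleaf dT dTy.
split; first exact: (mk_wf pinj pac pmt hpr dS dF hleaf dT dTy).
split=> //.
- by move=> v; rewrite mk_par map_slot_permKV.
- by move=> v; rewrite mk_mate permKV.
Qed.

(** When [k] reverses the order of the two labels of a pair, its bijection of ends is read
    backwards, which replaces the index by [invp]. *)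
Lemma relabel k G : wf_graph G -> exists G1, wf_graph G1 /\ iso_by k G1 G.
Proof.
move=> wf; pose m u := (k^-1)%g (mate G (k u)).
have mK u : m (m u) = u by rewrite /m permKV (mateK wf) permK.
pose q u : 'I_8 := if k u < k (m u) then prop G (k u)
                   else Ordinal (invp_lt (prop G (k (m u)))).
pose pr (u : 'I_n) := if u < m u then q u else ord0.
have hpr (u : 'I_n) : m u < u -> pr u = ord0 by move=> h; rewrite /pr ltnNge (ltnW h).
exists (pull k pr G); apply: pullP => // u i j.
have km v : k (m v) = mate G (k v) by rewrite permKV.
have qrel v : m v != v -> (pm (q v) i == j) = prop_rel G (k v) i j.
  move=> hv; rewrite /q km /prop_rel; case: ifP => // _; rewrite /= pm_inv_sym.
  by [].
have qrel' v : (pm (q v) j == i) = prop_rel G (k v) j i.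
  rewrite /q km /prop_rel; case: ifP => // _; rewrite /= pm_inv_sym.
  by [].
rewrite {1}/prop_rel mk_mate !mk_prop -/(m u).
have mu : m u != u by rewrite -(inj_eq (@perm_inj _ k)) km mate_neq.
case: ltngtP => [h|h|h]; last by case/eqP: mu; apply: val_inj.
  by rewrite /pr h qrel.
by rewrite /pr mK h qrel' km [RHS](prop_rel_sym wf).
Qed.

End Iso.

(** * Insertions *)

Section Up.
Variable n : nat.
Implicit Types (u : 'I_n) (w : 'I_n.+2) (s t : slot n).
Local Notation A := (newA n).
Local Notation B := (newB n).

Lemma inord_c0 : inord 0 = c0. Proof. by apply: val_inj; rewrite /= inordK. Qed.
Lemma inord_c1 : inord 1 = c1. Proof. by apply: val_inj; rewrite /= inordK. Qed.
Lemma inord_c2 : inord 2 = c2. Proof. by apply: val_inj; rewrite /= inordK. Qed.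

Definition old w : option 'I_n := insub (val w).

Lemma old_up u : old (up u) = Some u. Proof. by rewrite /old /= valK. Qed.
Lemma old_newA : old A = None. Proof. by rewrite /old insubN //= ltnn. Qed.
Lemma old_newB : old B = None. Proof. by rewrite /old insubN //= ltnNge leqnSn. Qed.

Lemma up_inj : injective (@up n).
Proof. by move=> u v /(congr1 old); rewrite !old_up => -[]. Qed.
Lemma up_neqA u : up u != A. Proof. by apply/eqP => /(congr1 old); rewrite old_up old_newA. Qed.
Lemma up_neqB u : up u != B. Proof. by apply/eqP => /(congr1 old); rewrite old_up old_newB. Qed.
Lemma newAB : A != B. Proof. by apply/eqP => /(congr1 val) /= /n_Sn. Qed.

Variant old_spec w : Prop :=
  | IsUp u of w = up u | IsA of w = A | IsB of w = B.

Lemma oldP w : old_spec w.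
Proof.
case: (ltngtP w n) => h; first by apply: (@IsUp _ (Ordinal h)); apply: val_inj.
  by apply: IsB; apply: val_inj => /=; apply/eqP; rewrite eqn_leq h andbT -ltnS.
by apply: IsA; apply: val_inj.
Qed.

Lemma up_slot_inj : injective (@up_slot n).
Proof.
case=> [b|[u c]] [b'|[u' c']] //=; first by case=> ->.
by move=> /eqP; rewrite [_ == _]xpair_eqE => /andP[/eqP /up_inj -> /eqP ->].
Qed.

Variant slot_spec (s : slot n.+2) : Prop :=
  | SlotUp t of s = up_slot t | SlotA c of s = inr (A, c) | SlotB c of s = inr (B, c).

Lemma slot_oldP (s : slot n.+2) : slot_spec s.
Proof.
case: s => [b|[w c]]; first by apply: (@SlotUp _ (inl b)).
by case: (oldP w) => [u ->|->|->]; [apply: (@SlotUp _ (inr (u, c)))|apply: SlotA|apply: SlotB].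
Qed.

Lemma up_slotA s c : up_slot s != inr (A, c).
Proof. by case: s => [b|[u c']] //=; rewrite [_ == _]xpair_eqE (negbTE (up_neqA _)). Qed.
Lemma up_slotB s c : up_slot s != inr (B, c).
Proof. by case: s => [b|[u c']] //=; rewrite [_ == _]xpair_eqE (negbTE (up_neqB _)). Qed.

Definition extv (W : Type) (vA vB : 'I_3 -> W) (x : slot n -> W) (s : slot n.+2) : W :=
  match s with
  | inl b => x (inl b)
  | inr (w, c) => if old w is Some u then x (inr (u, c)) else if w == A then vA c else vB c
  end.

Lemma extv_up W vA vB x s : @extv W vA vB x (up_slot s) = x s.
Proof. by case: s => [b|[u c]] //=; rewrite old_up. Qed.
Lemma extv_A W vA vB x c : @extv W vA vB x (inr (A, c)) = vA c.
Proof. by rewrite /= old_newA eqxx. Qed.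
Lemma extv_B W vA vB x c : @extv W vA vB x (inr (B, c)) = vB c.
Proof. by rewrite /= old_newB eq_sym (negbTE newAB). Qed.

End Up.

Section Extend.
Variables (n : nat) (W : nmodType).
Implicit Types (G : graph n) (H : graph n.+2).
Local Notation A := (newA n).
Local Notation B := (newB n).
Local Open Scope ring_scope.

(** Solutions of e1 + e2 = e3 + e4 with e1 = [m], with two free parameters and without subtraction,
    so that they exist over [nat]. There they are only part of all solutions, which is enough for a
    lower bound. *)
Definition newend (m a b : W) (i : nat) : W :=
  match i with 0%N => m | 1%N => a + b | 2%N => m + a | _ => b end.

Definition ext (p : nat) (m a b : W) (x : slot n -> W) : slot n.+2 -> W :=
  extv (fun c => newend m a b c.+1) (fun c => newend m a b (pm (invp p) c.+1)) x.

Arguments ext : simpl never.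

Lemma ins_common_insertion G H : insertion G H -> exists l, ins_common G H l.
Proof.
case=> [|[|[|[]]]].
- by move=> [x [y [b [_ [_ [_ [_ [_ h]]]]]]]]; eexists; exact: h.
- by move=> [x [y [b [_ [_ [_ [_ [_ h]]]]]]]]; eexists; exact: h.
- by move=> [x [y [ba [bc [_ [_ [_ [_ [_ h]]]]]]]]]; eexists; exact: h.
- by move=> [x [b [_ [_ [_ [_ [_ h]]]]]]]; eexists; exact: h.
- by move=> [x [ba [bc [_ [_ [_ [_ [_ h]]]]]]]]; eexists; exact: h.
Qed.

Lemma insertion_wf G H : insertion G H -> wf_graph H.
Proof. by move=> /ins_common_insertion [l []]. Qed.

(** The three prescribed coincidences of the leading propagator force the fourth end of [newB] to be
    matched with e1 of [newA]. It thus carries [x z], the momentum of the edge that was cut, and the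
    old edges fit again. *)
Lemma insertion_core G H : insertion G H -> exists z, par H A = up_slot z /\
  forall (x : slot n -> W) a b (y : slot n.+2 -> W), gflow G x ->
  (forall s, y (up_slot s) = x s) ->
  (forall c, y (inr (A, c)) = newend (x z) a b c.+1) ->
  (forall c, y (inr (B, c)) = newend (x z) a b (pm (invp (prop H A)) c.+1)) ->
  [/\ forall s t, dashed H s t -> y s = y t,
      forall u, y (par H (up u)) = x (par G u) &
      y (par H B) = newend (x z) a b (pm (invp (prop H A)) 0)].
Proof.
have lead (i : 'I_8) (e f : nat) : (e < 4)%N -> pm i e = f -> pm (invp i) f = e.
  by move=> h <-; rewrite (pmK i (Ordinal h)).
have dsh (y : slot n.+2 -> W) x excl news : (forall s, y (up_slot s) = x s) ->
    gflow G x -> ins_dashed G H excl news ->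
    (forall xy, xy \in news -> y xy.1 = y xy.2) -> forall s t, dashed H s t -> y s = y t.
  move=> hy [_ _ hx] hd hn s t /hd [[s0 [t0 [-> [-> [h _]]]]]|[xy /hn e [[-> ->]|[-> ->]]]] //.
  by rewrite !hy; apply: hx.
case=> [|[|[|[]]]].
- move=> [z [z' [b [hz [hpar [hA [hB [hd [_ [_ [_ [_ [_ [hl _]]]]]]]]]]]]]]; exists z; split=> // x a1 a2 y hx yup yA yB.
  have ezz : x z = x z' by have [_ _] := hx; apply.
  split; last 2 first.
  + by move=> u; rewrite hpar yup.
  + rewrite hB yup -ezz (_ : pm _ 0 = 0%N) //.
    by move: hl; case: (prop H A) => -[|[|[|[|[|[|[|[|]]]]]]]] //= ? /and4P[]; case: (b).
  apply: dsh hd _ => // xy; rewrite !inE => /or3P[] /eqP -> /=; rewrite /ch.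
  + by rewrite inord_c0 yA yB /= (lead _ 1%N) //; move: hl => /and4P[/eqP].
  + move: hl => /and4P[_ /eqP hl _ _]; rewrite inord_c1 yA; case: (b) hl => hl;
      by rewrite ?inord_c1 ?inord_c2 yB /= (lead _ 2%N).
  + move: hl => /and4P[_ _ /eqP hl _]; rewrite inord_c2 yA; case: (b) hl => hl;
      by rewrite ?inord_c1 ?inord_c2 yB /= (lead _ 3%N).
- move=> [z [z' [b [hz [hpar [hA [hB [hd [_ [_ [_ [_ [_ [hl _]]]]]]]]]]]]]]; exists z; split=> // x a1 a2 y hx yup yA yB.
  have ezz : x z = x z' by have [_ _] := hx; apply.
  split; last 2 first.
  + by move=> u; rewrite hpar yup.
  + by rewrite hB /ch inord_c0 yA /= (lead _ 1%N) //; move: hl => /and4P[/eqP].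
  apply: dsh hd _ => // xy; rewrite !inE => /or3P[] /eqP -> /=; rewrite /ch.
  + rewrite yup -ezz inord_c0 yB /= (lead _ 0%N) //.
    by move: hl; case: (prop H A) => -[|[|[|[|[|[|[|[|]]]]]]]] //= ? /and4P[]; case: (b).
  + move: hl => /and4P[_ /eqP hl _ _]; rewrite inord_c1 yA; case: (b) hl => hl;
      by rewrite ?inord_c1 ?inord_c2 yB /= (lead _ 2%N).
  + move: hl => /and4P[_ _ /eqP hl _]; rewrite inord_c2 yA; case: (b) hl => hl;
      by rewrite ?inord_c1 ?inord_c2 yB /= (lead _ 3%N).
- move=> [z [z' [ba [bc [hz [hpar [hA [hB [hd [_ [_ [_ [_ [_ [hl _]]]]]]]]]]]]]]]; exists z; split=> // x a1 a2 y hx yup yA yB.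
  have ezz : x z = x z' by have [_ _] := hx; apply.
  split; last 2 first.
  + by move=> u; rewrite hpar yup.
  + move: hl => /and4P[/eqP hl _ _ _]; rewrite hB /ch.
    by case: (ba) hl => hl; rewrite ?inord_c1 ?inord_c2 yA /= (lead _ _ _ _ hl).
  apply: dsh hd _ => // xy; rewrite !inE => /or3P[] /eqP -> /=; rewrite /ch.
  + move: hl => /and4P[_ /eqP hl _ _]; rewrite inord_c0 yA.
    by case: (bc) hl => hl; rewrite ?inord_c1 ?inord_c2 yB /= (lead _ _ _ _ hl).
  + move: hl => /and4P[_ _ /eqP hl _]; rewrite inord_c0.
    by case: (ba) hl => hl; rewrite ?inord_c1 ?inord_c2 yA yB /= (lead _ _ _ _ hl).
  + rewrite yup -ezz.
    have h0 : pm (prop H A) 0 = (other (if bc then 1 else 2)%N).+1.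
      move: hl; case: (prop H A) => -[|[|[|[|[|[|[|[|]]]]]]]] //= ?; case: (ba); case: (bc) => //=; by case/and4P.
    by case: (bc) h0 => h0; rewrite /= ?inord_c1 ?inord_c2 yB /= (lead _ _ _ _ h0).
- move=> [z [b [hpar [hA [hB [hz [hd [_ [_ [_ [_ [_ [hl _]]]]]]]]]]]]]; exists (par G z); split=> // x a1 a2 y hx yup yA yB.
  split; last 2 first.
  + move=> u; case: (u =P z) => [->|/eqP/hpar ->]; last by rewrite yup.
    rewrite hz /ch inord_c0 yB /= (lead _ 0%N) //.
    by move: hl; case: (prop H A) => -[|[|[|[|[|[|[|[|]]]]]]]] //= ? /and4P[]; case: (b).
  + by rewrite hB /ch inord_c0 yA /= (lead _ 1%N) //; move: hl => /and4P[/eqP].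
  apply: dsh hd _ => // xy; rewrite !inE => /orP[] /eqP -> /=; rewrite /ch.
  + move: hl => /and4P[_ /eqP hl _ _]; rewrite inord_c1 yA; case: (b) hl => hl;
      by rewrite ?inord_c1 ?inord_c2 yB /= (lead _ 2%N).
  + move: hl => /and4P[_ _ /eqP hl _]; rewrite inord_c2 yA; case: (b) hl => hl;
      by rewrite ?inord_c1 ?inord_c2 yB /= (lead _ 3%N).
- move=> [z [ba [bc [hpar [hA [hB [hz [hd [_ [_ [_ [_ [_ [hl _]]]]]]]]]]]]]]; exists (par G z); split=> // x a1 a2 y hx yup yA yB.
  split; last 2 first.
  + move=> u; case: (u =P z) => [->|/eqP/hpar ->]; last by rewrite yup.
    have h0 : pm (prop H A) 0 = (if bc then 1 else 2)%N.+1.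
      move: hl; case: (prop H A) => -[|[|[|[|[|[|[|[|]]]]]]]] //= ?; case: (ba); case: (bc) => //=; by case/and4P.
    by rewrite hz /ch; case: (bc) h0 => h0; rewrite /= ?inord_c1 ?inord_c2 yB /= (lead _ _ _ _ h0).
  + move: hl => /and4P[/eqP hl _ _ _]; rewrite hB /ch.
    by case: (ba) hl => hl; rewrite ?inord_c1 ?inord_c2 yA /= (lead _ _ _ _ hl).
  apply: dsh hd _ => // xy; rewrite !inE => /orP[] /eqP -> /=; rewrite /ch.
  + move: hl => /and4P[_ _ /eqP hl _]; rewrite inord_c0 yA.
    by case: (bc) hl => hl; rewrite /= ?inord_c1 ?inord_c2 yB /= (lead _ _ _ _ hl).
  + move: hl => /and4P[_ /eqP hl _ _]; rewrite inord_c0.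
    by case: (ba) hl => hl; rewrite ?inord_c1 ?inord_c2 yA yB /= (lead _ _ _ _ hl).
Qed.

(** Over [rat] this carries redundancy from the larger graph back to the smaller one; over [nat] it
    provides two new parameters of attributions. *)
Lemma insertion_flow G H : insertion G H -> exists z, 
  forall (x : slot n -> W) a b, gflow G x -> let y := ext (prop H A) (x z) a b x in
  [/\ gflow H y, forall u i, y (endslot H (up u) i) = x (endslot G u i) &
      matched G x -> matched H y].
Proof.
move=> hins; have [z [hA hcore]] := insertion_core hins; exists z => x a b hx y.
have [l hc] := ins_common_insertion hins.
have [wf [hm [mA [mB [hp [_ pB]]]]]] := hc.
have yup s : y (up_slot s) = x s by apply: extv_up.
have yA c : y (inr (A, c)) = newend (x z) a b c.+1 by apply: extv_A.
have yB c : y (inr (B, c)) = newend (x z) a b (pm (invp (prop H A)) c.+1) by apply: extv_B.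
have [y1 y2 y3] := hcore x a b y hx yup yA yB.
have eup u i : y (endslot H (up u) i) = x (endslot G u i).
  case: (I4P i) => [->|[c ->]]; rewrite ?endslot0 ?endslotS ?y2 //.
  by rewrite -yup.
have eA (i : 'I_4) : y (endslot H A i) = newend (x z) a b i.
  by case: (I4P i) => [->|[c ->]]; rewrite ?endslot0 ?endslotS ?hA ?yup ?yA.
have eB (i : 'I_4) : y (endslot H B i) = newend (x z) a b (pm (invp (prop H A)) i).
  by case: (I4P i) => [->|[c ->]]; rewrite ?endslot0 ?endslotS ?y3 ?yB.
have [x1 x2 x3] := hx.
split=> //.
  split=> //.
  move=> w; case: (oldP w) => [u ->|->|->].
  - have yu c : y (inr (up u, c)) = x (inr (u, c)) by rewrite -yup.
    by rewrite y2 !yu x2.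
  - by rewrite hA yup !yA /= addrA.
  - have : newend (x z) a b 0 + newend (x z) a b 1 = newend (x z) a b 2 + newend (x z) a b 3.
      by rewrite /= addrA.
    rewrite y3 !yB; move: (newend _ _ _) => e eK.
    by case: (prop H A) => -[|[|[|[|[|[|[|[|]]]]]]]] //= _; rewrite /invp /=
      ?(addrC (e 1%N) (e 0%N)) ?(addrC (e 3%N) (e 2%N)) eK.
move=> xm w i j; case: (oldP w) => [u ->|->|->].
- rewrite hm !eup /prop_rel hm => hr; apply: xm.
  by move: hr; rewrite /prop_rel !hp.
- rewrite mA eA eB /prop_rel mA /= ltnSn => /eqP <-; congr newend.
  by rewrite pmK.
- rewrite mB eA eB /prop_rel mB /= ltnNge leqnSn /= => /eqP <-; congr newend.
  by rewrite pmK.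
Qed.

End Extend.

(** * Removing a pair of mates *)

Section Remove.
Variable n : nat.
Local Notation A := (newA n).
Local Notation B := (newB n).
Variable H : graph n.+2.
Hypothesis wf : wf_graph H.
Hypothesis mAB : mate H A = B.

Lemma mate_newB : mate H B = A. Proof. by rewrite -mAB (mateK wf). Qed.

Definition dmate (u : 'I_n) : 'I_n := odflt u (old (mate H (up u))).
Lemma up_dmate u : up (dmate u) = mate H (up u).
Proof.
rewrite /dmate; case: (oldP (mate H (up u))) => [v ->|/(congr1 (mate H))|/(congr1 (mate H))].
- by rewrite old_up.
- by rewrite (mateK wf) mAB => /eqP; rewrite (negbTE (up_neqB _)).
- by rewrite (mateK wf) mate_newB => /eqP; rewrite (negbTE (up_neqA _)).
Qed.

Variables (pa : 'I_n -> slot n) (Dr : rel (slot n)).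
Hypothesis pa_inj : injective pa.
Hypothesis pa_ac : acyclic pa.
Hypothesis pa_ty : forall u, ty H (up_slot (pa u)) = ty H (par H (up u)).
Hypothesis DrS : forall s t, Dr s t -> Dr t s.
Hypothesis DrF : forall s t t', Dr s t -> Dr s t' -> t = t'.
Hypothesis DrL : forall s t, Dr s t -> leafp pa s.
Hypothesis DrTot : forall s, leafp pa s -> exists t, Dr s t.
Hypothesis DrTy : forall s t, Dr s t -> ty H (up_slot s) = ~~ ty H (up_slot t).

Definition removed : graph n := mkgraph pa Dr dmate (fun u => prop H (up u)).

Lemma removed_ty s : ty removed s = ty H (up_slot s).
Proof.
apply/esym; move: s; apply: ty_uniq.
- by have [d hd] := pa_ac; exists d => v u c; rewrite mk_par; apply: hd.
- by move=> b; rewrite ty_inl.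
- by move=> u c; rewrite mk_par pa_ty (ty_inr _ _ (wf_acyclic wf)).
Qed.

Lemma dmateP u : dmate (dmate u) = u /\ dmate u != u.
Proof.
split; first by apply: up_inj; rewrite !up_dmate (mateK wf).
by rewrite -(inj_eq (@up_inj _)) up_dmate mate_neq.
Qed.

Lemma dprop0 u : dmate u < u -> prop H (up u) = ord0.
Proof. by move=> h; apply: (wf_prop wf); rewrite -up_dmate. Qed.

Lemma removed_DrTy s t : Dr s t -> ty removed s = ~~ ty removed t.
Proof. by rewrite !removed_ty; apply: DrTy. Qed.

Lemma removed_wf : wf_graph removed.
Proof. exact: (mk_wf pa_inj pa_ac dmateP dprop0 DrS DrF DrL DrTot removed_DrTy). Qed.

Lemma removed_dashed s t : dashed removed s t = Dr s t.
Proof. exact: (mk_dashed DrS DrF DrL DrTot removed_DrTy). Qed.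

Lemma removed_common l : leading (prop H A) l -> ins_common removed H l.
Proof.
move=> hl; split=> //; split; first by move=> u; rewrite mk_mate up_dmate.
split=> //; split; first exact: mate_newB.
split; first by move=> u; rewrite mk_prop.
by split=> //; apply: (wf_prop wf); rewrite mate_newB /=.
Qed.

End Remove.

Section Reduce.
Variable n : nat.
Local Notation A := (newA n).
Local Notation B := (newB n).
Variable H : graph n.+2.
Hypothesis wf : wf_graph H.
Hypothesis mAB : mate H A = B.

(** A left inverse of [up_slot]; the value [inl true] at the new slots is a dummy. *)
Definition dns (s : slot n.+2) : slot n :=
  match s with
  | inl b => inl b
  | inr (w, c) => if old w is Some u then inr (u, c) else inl true
  end.
Lemma dns_up s : dns (up_slot s) = s.
Proof. by case: s => [b|[u c]] //=; rewrite old_up. Qed.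

Lemma acyclic_up (pa : 'I_n -> slot n) :
  (forall u, up_slot (pa u) = par H (up u)) -> acyclic pa.
Proof.
move=> h; have [d hd] := wf_acyclic wf; exists (fun u => d (up u)) => v u c e.
by apply: (hd _ _ c); rewrite -h e.
Qed.

Lemma ins_dashedI (G : graph n) excl news :
  (forall s t, dashed H (up_slot s) (up_slot t) <->
    dashed G s t /\ if excl is Some (x, y) then ~ upair s t x y else True) ->
  (forall xy, xy \in news -> dashed H xy.1 xy.2) ->
  (forall s t c, dashed H s t -> s = inr (A, c) \/ s = inr (B, c) ->
    exists2 xy, xy \in news & upair s t xy.1 xy.2) ->
  ins_dashed G H excl news.
Proof.
move=> hold hn1 hn3 s t; split; last first.
  move=> [[s0 [t0 [-> [-> /hold]]]]|[xy /hn1 h [[-> ->]|[-> ->]]]] //.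
  by rewrite dashed_sym.
move=> h; case: (slot_oldP s) => [s0 es|c es|c es]; last 2 first.
- by right; apply: (hn3 _ _ c) => //; left.
- by right; apply: (hn3 _ _ c) => //; right.
have hsw c : t = inr (A, c) \/ t = inr (B, c) -> exists2 xy, xy \in news & upair s t xy.1 xy.2.
  move=> et; have [|xy h1 h2] := hn3 t s c _ et; first by rewrite dashed_sym.
  by exists xy => //; case: h2 => -[-> ->]; [right|left].
case: (slot_oldP t) => [t0 et|c et|c et]; last 2 first.
- by right; apply: (hsw c); left.
- by right; apply: (hsw c); right.
by left; exists s0, t0; split=> //; split=> //; apply/hold; rewrite -es -et.
Qed.

(* [z] and [y] are the two old slots freed by the removal. *)
Lemma remove_dashed (z y : slot n) :
  (forall u, exists s, par H (up u) = up_slot s) ->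
  par H A = up_slot z ->
  ty H (up_slot z) = ~~ ty H (up_slot y) ->
  (forall u, par H (up u) != up_slot y) ->
  (forall t, ~~ dashed H (up_slot y) (up_slot t)) ->
  (forall s, s != z -> s != y -> ~~ occupied H (up_slot s) -> exists t, dashed H (up_slot s) (up_slot t)) ->
  (forall s, occupied H (up_slot s) -> s != z -> s != y -> exists u, par H (up u) = up_slot s) ->
  exists G, [/\ wf_graph G, dashed G z y,
    forall u, par H (up u) = up_slot (par G u),
    forall l, leading (prop H A) l -> ins_common G H l &
    forall news, (forall xy, xy \in news -> dashed H xy.1 xy.2) ->
      (forall s t c, dashed H s t -> s = inr (A, c) \/ s = inr (B, c) -> exists2 xy, xy \in news & upair s t xy.1 xy.2) ->
      ins_dashed G H (Some (z, y)) news].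
Proof.
move=> hold hA hty hy hyd htot hocc.
pose pa u := dns (par H (up u)).
have paE u : up_slot (pa u) = par H (up u).
  by rewrite /pa; have [s ->] := hold u; rewrite dns_up.
have hz u : par H (up u) != up_slot z.
  by rewrite -hA (inj_eq (wf_inj wf)) up_neqA.
have hzd t : ~~ dashed H (up_slot z) (up_slot t).
  by apply/negP => /(dashed_leaf wf) []; rewrite -hA par_occ.
have zy : z != y by apply/eqP => e; move: hty; rewrite e; case: (ty _ _).
(* The two freed slots are joined by the dashed edge that the insertion replaces. *)
pose Dr s t := dashed H (up_slot s) (up_slot t) || ((s, t) \in [:: (z, y); (y, z)]).
have pa_inj : injective pa.
  by move=> u v e; apply: up_inj; apply: (wf_inj wf); rewrite -!paE e.
have DrS s t : Dr s t -> Dr t s.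
  rewrite /Dr !inE !xpair_eqE => /or3P[h|/andP[/eqP-> /eqP->]|/andP[/eqP-> /eqP->]].
  - by rewrite dashed_sym h.
  - by rewrite !eqxx !orbT.
  - by rewrite !eqxx !orbT.
have DrF s t t' : Dr s t -> Dr s t' -> t = t'.
  rewrite /Dr !inE !xpair_eqE => /or3P[h|/andP[/eqP-> /eqP->]|/andP[/eqP-> /eqP->]]
     /or3P[h'|/andP[/eqP e /eqP->]|/andP[/eqP e /eqP->]] //.
  - exact: up_slot_inj (dashed_fun wf h h').
  - by move: h; rewrite e (negbTE (hzd _)).
  - by move: h; rewrite e (negbTE (hyd _)).
  - by move: h'; rewrite (negbTE (hzd _)).
  - by move: h'; rewrite (negbTE (hyd _)).
have DrL s t : Dr s t -> leafp pa s.
  rewrite /Dr !inE !xpair_eqE => h; apply/existsP => -[u /eqP e]; move: h; rewrite -e paE.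
  rewrite -!(inj_eq (@up_slot_inj n)) paE (negbTE (hz u)) (negbTE (hy u)) /= orbF.
  by move/(dashed_leaf wf) => []; rewrite par_occ.
have DrTot s : leafp pa s -> exists t, Dr s t.
  move=> hs; rewrite /Dr; case: (s =P z) => [->|/eqP sz]; first by exists y; rewrite !inE eqxx orbT.
  case: (s =P y) => [->|/eqP sy]; first by exists z; rewrite !inE eqxx !orbT.
  have [|t ht] := htot _ sz sy; last by exists t; rewrite ht.
  apply: contra hs => /hocc /(_ sz sy) [u hu]; apply/existsP; exists u.
  by apply/eqP; apply: up_slot_inj; rewrite paE.
have DrTy s t : Dr s t -> ty H (up_slot s) = ~~ ty H (up_slot t).
  rewrite /Dr !inE !xpair_eqE => /or3P[/(dashed_leaf wf) []|/andP[/eqP-> /eqP->]|/andP[/eqP-> /eqP->]] //.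
  by rewrite hty negbK.
have pa_ty u : ty H (up_slot (pa u)) = ty H (par H (up u)) by rewrite paE.
have pac := acyclic_up paE.
have hd s t := removed_dashed wf pac pa_ty DrS DrF DrL DrTot DrTy s t.
exists (removed H pa Dr); split.
- exact: (removed_wf wf mAB).
- by rewrite hd /Dr !inE eqxx orbT.
- by move=> u; rewrite mk_par paE.
- exact: (removed_common wf mAB).
move=> news hn1 hn3; apply: ins_dashedI => // s t; split=> [h|[]].
  split; first by rewrite hd /Dr h.
  have [hs ht _] := dashed_leaf wf h.
  by move=> [[e1 e2]|[e1 e2]]; [move: hs|move: ht]; rewrite ?e1 ?e2 -hA par_occ.
rewrite hd => /orP[//|]; rewrite !inE !xpair_eqE => /orP[] /andP[/eqP -> /eqP ->] [];
  by [left|right].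
Qed.

(** The vertex [w] below [newB] moves up to the slot of [newA], and no dashed edge is created. As
    the slots it leaves and reaches have the same type, the types in its subtree do not change. *)
Lemma remove_solid (z : slot n) (w : 'I_n) f :
  (forall u, u != w -> exists s, par H (up u) = up_slot s) ->
  par H A = up_slot z -> par H (up w) = inr (B, f) ->
  (exists a, par H B = inr (A, a)) ->
  ty H (up_slot z) = ty H (inr (B, f)) ->
  (forall s, ~~ occupied H (up_slot s) -> exists t, dashed H (up_slot s) (up_slot t)) ->
  exists G, [/\ wf_graph G, par G w = z,
    forall u, u != w -> par H (up u) = up_slot (par G u),
    forall l, leading (prop H A) l -> ins_common G H l &
    forall news, (forall xy, xy \in news -> dashed H xy.1 xy.2) ->
      (forall s t c, dashed H s t -> s = inr (A, c) \/ s = inr (B, c) -> exists2 xy, xy \in news & upair s t xy.1 xy.2) ->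
      ins_dashed G H None news].
Proof.
move=> hold hA hw [a hB] hty htot.
pose pa u := if u == w then z else dns (par H (up u)).
have paE u : u != w -> up_slot (pa u) = par H (up u).
  by move=> uw; rewrite /pa (negbTE uw); have [s ->] := hold u uw; rewrite dns_up.
have paw : pa w = z by rewrite /pa eqxx.
pose Dr s t := dashed H (up_slot s) (up_slot t).
have pa_inj : injective pa.
  move=> u v; case: (u =P w) => [->|/eqP uw]; case: (v =P w) => [->|/eqP vw] // /(congr1 (@up_slot _)).
  - by rewrite paw paE // -hA => /(wf_inj wf) /esym/eqP; rewrite (negbTE (up_neqA _)).
  - by rewrite paw paE // -hA => /(wf_inj wf) /eqP; rewrite (negbTE (up_neqA _)).
  - by rewrite !paE // => /(wf_inj wf)/up_inj.
have pac : acyclic pa.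
  have [d hd] := wf_acyclic wf; exists (fun u => d (up u)) => v u c.
  case: (v =P w) => [->|/eqP vw] e; last by apply: (hd _ _ c); rewrite -paE // e.
  move: e; rewrite paw => e; move: hA; rewrite e => /hd h1; move: hB hw => /hd h2 /hd h3.
  exact: ltn_trans (ltn_trans h1 h2) h3.
have pa_ty u : ty H (up_slot (pa u)) = ty H (par H (up u)).
  by case: (u =P w) => [->|/eqP uw]; [rewrite paw hw hty|rewrite paE].
have DrS s t : Dr s t -> Dr t s by rewrite /Dr dashed_sym.
have DrF s t t' : Dr s t -> Dr s t' -> t = t'.
  by move=> h h'; apply: up_slot_inj (dashed_fun wf h h').
have DrL s t : Dr s t -> leafp pa s.
  move=> h; apply/existsP => -[u /eqP e]; have [] := dashed_leaf wf h; rewrite -e.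
  by case: (u =P w) => [->|/eqP uw]; rewrite ?paw -?hA ?paE // par_occ.
have DrTot s : leafp pa s -> exists t, Dr s t.
  move=> hs; apply: htot; apply: contra hs => /existsP[v /eqP]; case: (oldP v) => [u ->|->|->] hv.
  - apply/existsP; exists u; apply/eqP; apply: up_slot_inj; rewrite paE //.
    by apply/eqP => uw; move: hv; rewrite uw hw => /esym/eqP; rewrite (negbTE (up_slotB _ _)).
  - by apply/existsP; exists w; rewrite paw; apply/eqP/up_slot_inj; rewrite -hA.
  - by move: hv; rewrite hB => /esym/eqP; rewrite (negbTE (up_slotA _ _)).
have DrTy s t : Dr s t -> ty H (up_slot s) = ~~ ty H (up_slot t).
  by move=> /(dashed_leaf wf) [].
have hd s t := removed_dashed wf pac pa_ty DrS DrF DrL DrTot DrTy s t.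
exists (removed H pa Dr); split.
- exact: (removed_wf wf mAB).
- by rewrite mk_par.
- by move=> u uw; rewrite mk_par paE.
- exact: (removed_common wf mAB).
move=> news hn1 hn3; apply: ins_dashedI => // s t.
by rewrite hd /Dr; split=> [|[]].
Qed.

End Reduce.

Section Forms.
Variable n : nat.
Local Notation A := (newA n).
Local Notation B := (newB n).
Variable H : graph n.+2.
Hypothesis wf : wf_graph H.
Hypothesis mAB : mate H A = B.

Definition covered (news : seq (slot n.+2 * slot n.+2)) s :=
  occupied H s \/ exists2 t, dashed H s t & (s, t) \in news \/ (t, s) \in news.

Lemma covered_news news : (forall c, covered news (inr (A, c)) /\ covered news (inr (B, c))) ->
  forall s t c, dashed H s t -> s = inr (A, c) \/ s = inr (B, c) ->
    exists2 xy, xy \in news & upair s t xy.1 xy.2.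
Proof.
move=> hc s t c h hs; have [h1 _ _] := dashed_leaf wf h.
have : covered news s by case: (hc c) => ? ?; case: hs => ->.
case=> [|[t' h' hn]]; first by rewrite (negbTE h1).
rewrite -(dashed_fun wf h h') in hn; case: hn => hn.
  by exists (s, t) => //; left.
by exists (t, s) => //; right.
Qed.

Lemma par_newA_old : (forall c, par H A != inr (B, c)) -> exists z, par H A = up_slot z.
Proof.
move=> h; case: (slot_oldP (par H A)) => [z hz|c hc|c hc]; first by exists z.
  by have [d hd] := wf_acyclic wf; have := hd _ _ _ hc; rewrite ltnn.
by have := h c; rewrite hc eqxx.
Qed.

(** The configuration produced by (I). The hypothesis on types says that the slots of the two
    vertices may be joined by a dashed edge once the pair is gone. *)
Lemma reduce_side_by_side (sg : {perm 'I_3}) :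
  (forall c, dashed H (inr (A, c)) (inr (B, sg c))) -> ty H (par H A) = ~~ ty H (par H B) ->
  exists z y G, [/\ wf_graph G, dashed G z y, par H A = up_slot z /\ par H B = up_slot y,
    forall u, par H (up u) = up_slot (par G u) &
    (forall l, leading (prop H A) l -> ins_common G H l) /\
    forall news, (forall xy, xy \in news -> dashed H xy.1 xy.2) ->
      (forall c, covered news (inr (A, c)) /\ covered news (inr (B, c))) ->
      ins_dashed G H (Some (z, y)) news].
Proof.
move=> hd hty.
have hd' c : dashed H (inr (B, c)) (inr (A, (sg^-1)%g c)).
  by rewrite dashed_sym -{2}(permKV sg c) hd.
have lA c v : par H v != inr (A, c).
  by have [h _ _] := dashed_leaf wf (hd c); apply: contra h => h; apply/existsP; exists v.
have lB c v : par H v != inr (B, c).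
  by have [h _ _] := dashed_leaf wf (hd' c); apply: contra h => h; apply/existsP; exists v.
have [z hz] : exists z, par H A = up_slot z by apply: par_newA_old.
have [y hy] : exists y, par H B = up_slot y.
  by case: (slot_oldP (par H B)) (lA^~ B) (lB^~ B) => [y -> _ _|c -> h _|c -> _ h]; [exists y|have := h c; rewrite eqxx..].
have [||||||| G [h1 h2 h3 h4 h5]] := @remove_dashed n H wf mAB z y.
- move=> u; case: (slot_oldP (par H (up u))) => [s hs|c hc|c hc]; first by exists s.
    by have := lA c (up u); rewrite hc eqxx.
  by have := lB c (up u); rewrite hc eqxx.
- by [].
- by rewrite -hz -hy.
- by move=> u; rewrite -hy (inj_eq (wf_inj wf)) up_neqB.
- by move=> t; apply/negP => /(dashed_leaf wf) []; rewrite -hy par_occ.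
- move=> s sz sy /(dashed_tot wf) [t]; case: (slot_oldP t) => [t0 ->|c ->|c ->] ht; first by exists t0.
    have := up_slotB s (sg c); rewrite (dashed_fun wf (t := up_slot s) _ (hd c)) ?eqxx //.
    by rewrite dashed_sym.
  have := up_slotA s ((sg^-1)%g c); rewrite (dashed_fun wf (t := up_slot s) _ (hd' c)) ?eqxx //.
  by rewrite dashed_sym.
- move=> s /existsP[v /eqP]; case: (oldP v) => [u ->|->|->]; first by exists u.
    by rewrite hz => /up_slot_inj ->; rewrite eqxx.
  by rewrite hy => /up_slot_inj -> _; rewrite eqxx.
exists z, y, G; split=> //; split=> // news n1 n2.
by apply: h5 => //; apply: covered_news.
Qed.

(** The configuration of the other insertions: [newB] is the child [a] of [newA], and [f] is the
    only child slot of [newB] not joined to [newA]. The alternative is whether [f] is a leaf, as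
    after (II) and (III), or carries a vertex, as after (IIs) and (IIIs). *)
Lemma reduce_nested (a f : 'I_3) : par H B = inr (A, a) ->
  (forall c, c != a -> exists2 c', c' != f & dashed H (inr (A, c)) (inr (B, c'))) ->
  (forall c', c' != f -> exists2 c, c != a & dashed H (inr (A, c)) (inr (B, c'))) ->
  ty H (inr (B, f)) = ty H (par H A) ->
  exists z, par H A = up_slot z /\ ((exists y G, [/\ wf_graph G,
    dashed G z y, dashed H (inr (B, f)) (up_slot y),
    forall u, par H (up u) = up_slot (par G u) &
    (forall l, leading (prop H A) l -> ins_common G H l) /\
    forall news, (forall xy, xy \in news -> dashed H xy.1 xy.2) ->
      (forall c, covered news (inr (A, c)) /\ covered news (inr (B, c))) ->
      ins_dashed G H (Some (z, y)) news]) \/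
  (exists w G, [/\ wf_graph G, par G w = z, par H (up w) = inr (B, f),
    forall u, u != w -> par H (up u) = up_slot (par G u) &
    (forall l, leading (prop H A) l -> ins_common G H l) /\
    forall news, (forall xy, xy \in news -> dashed H xy.1 xy.2) ->
      (forall c, covered news (inr (A, c)) /\ covered news (inr (B, c))) ->
      ins_dashed G H None news])).
Proof.
move=> hB hAc hBc hty.
have [d hd] := wf_acyclic wf.
have nAB c : par H A != inr (B, c).
  apply/eqP => hA; have := ltn_trans (hd _ _ _ hA) (hd _ _ _ hB).
  by rewrite ltnn.
have [z hz] := par_newA_old nAB; exists z; split=> //.
have lA c v : c != a -> par H v != inr (A, c).
  move=> /hAc [c' _ h]; have [h' _ _] := dashed_leaf wf h.
  by apply: contra h' => e; apply/existsP; exists v.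
have lB c v : c != f -> par H v != inr (B, c).
  move=> /hBc [c' _ h]; have [_ h' _] := dashed_leaf wf h.
  by apply: contra h' => e; apply/existsP; exists v.
have lA' c u : par H (up u) != inr (A, c).
  case: (c =P a) => [->|/eqP ca]; last exact: lA.
  by rewrite -hB (inj_eq (wf_inj wf)) up_neqB.
(* leaves of old slots are not attached to the new children, except through [f] *)
have oldt s : ~~ occupied H (up_slot s) ->
    (exists t, dashed H (up_slot s) (up_slot t)) \/ dashed H (up_slot s) (inr (B, f)).
  move=> /(dashed_tot wf) [t]; case: (slot_oldP t) => [t0 ->|c ->|c ->] ht; first by left; exists t0.
    case: (c =P a) => [e|/eqP/hAc [c' _ h]].
      by have [_] := dashed_leaf wf ht; rewrite e -hB par_occ.
    have := up_slotB s c'; rewrite (dashed_fun wf (t := up_slot s) _ h) ?eqxx //.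
    by rewrite dashed_sym.
  case: (c =P f) => [e|/eqP/hBc [c' _ h]]; first by right; rewrite -e.
  have := up_slotA s c'; rewrite (dashed_fun wf (s := inr (B, c)) (t := up_slot s) (t' := inr (A, c'))) ?eqxx //.
    by rewrite dashed_sym.
  by rewrite dashed_sym.
case: (boolP (occupied H (inr (B, f)))) => [/existsP[v /eqP hv]|hf].
  right; have [w ew] : exists w, v = up w.
    case: (oldP v) => [w ->|e|e]; first by exists w.
      by have := nAB f; rewrite -hv e eqxx.
    by have := hd _ _ _ hv; rewrite e ltnn.
  rewrite {v}ew in hv.
  have [|||| G [h1 h2 h3 h4 h5]] := @remove_solid n H wf mAB z w f _ hz hv.
  - move=> u uw; case: (slot_oldP (par H (up u))) => [s hs|c hc|c hc]; first by exists s.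
      by have := lA' c u; rewrite hc eqxx.
    case: (c =P f) => [e|/eqP cf]; last by have := lB c (up u) cf; rewrite hc eqxx.
    by move: uw; rewrite -(inj_eq (@up_inj n)) -(inj_eq (wf_inj wf)) hv hc e eqxx.
  - by exists a.
  - by rewrite -hz hty.
  - move=> s /oldt [//|] /(dashed_leaf wf) [_]; rewrite -hv par_occ //.
  exists w, G; split=> //; split=> // news n1 n2.
  by apply: h5 => //; apply: covered_news.
left; have [t ht] := dashed_tot wf hf.
have [y ey] : exists y, t = up_slot y.
  case: (slot_oldP t) => [y ->|c e|c e]; first by exists y.
    case: (c =P a) => [ca|/eqP/hAc [c' c'f h]].
      by have [_] := dashed_leaf wf ht; rewrite e ca -hB par_occ.
    move: ht; rewrite e dashed_sym => ht; have := dashed_fun wf ht h => -[] e'.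
    by move: c'f; rewrite e' eqxx.
  case: (c =P f) => [cf|/eqP/hBc [c' _ h]]; first by have := dashed_neq wf ht; rewrite e cf eqxx.
  move: ht h; rewrite e dashed_sym => ht; rewrite dashed_sym => h.
  by have /eqP := dashed_fun wf ht h; rewrite [_ == _]xpair_eqE eq_sym (negbTE (newAB n)).
rewrite {t}ey in ht.
have [||||||| G [h1 h2 h3 h4 h5]] := @remove_dashed n H wf mAB z y.
- move=> u; case: (slot_oldP (par H (up u))) => [s hs|c hc|c hc]; first by exists s.
    by have := lA' c u; rewrite hc eqxx.
  case: (c =P f) => [e|/eqP cf]; last by have := lB c (up u) cf; rewrite hc eqxx.
  by case/existsP: hf; exists (up u); rewrite hc e.
- by [].
- by rewrite -hz -hty; have [] := dashed_leaf wf ht.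
- move=> u; have [_ h _] := dashed_leaf wf ht; apply: contra h => h.
  by apply/existsP; exists (up u).
- move=> t; apply/negP => h; have := up_slotB t f; rewrite (dashed_fun wf h (t' := inr (B, f))) ?eqxx //.
  by rewrite dashed_sym.
- move=> s sz sy /oldt [//|]; rewrite dashed_sym => h.
  by have /up_slot_inj e := dashed_fun wf h ht; rewrite e eqxx in sy.
- move=> s /existsP[v /eqP]; case: (oldP v) => [u ->|->|->]; first by exists u.
    by rewrite hz => /up_slot_inj ->; rewrite eqxx.
  by rewrite hB => /esym/eqP; rewrite (negbTE (up_slotA _ _)).
exists y, G; split=> //; split=> // news n1 n2.
by apply: h5 => //; apply: covered_news.
Qed.

End Forms.

(** * The three shapes of a removable pair *)

Section Reduction.
Variable n : nat.
Local Notation A := (newA n).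
Local Notation B := (newB n).
Variable H : graph n.+2.
Hypothesis wf : wf_graph H.
Hypothesis mAB : mate H A = B.

Lemma covered_l news s t : (forall xy, xy \in news -> dashed H xy.1 xy.2) ->
  (s, t) \in news -> covered H news s.
Proof. by move=> h hn; right; exists t; [apply: (h _ hn)|left]. Qed.
Lemma covered_r news s t : (forall xy, xy \in news -> dashed H xy.1 xy.2) ->
  (s, t) \in news -> covered H news t.
Proof. by move=> h hn; right; exists s; [rewrite dashed_sym; apply: (h _ hn)|right]. Qed.
Lemma covered_occ news v s : par H v = s -> covered H news s.
Proof. by move=> <-; left; apply: par_occ. Qed.

(** The two ways in which a child edge of [newA] can end exactly at its image under the propagator:
    along a dashed edge, or as the parent edge of [newB]. *)
Definition link (c c' : 'I_3) := pm (prop H A) c.+1 = c'.+1 /\ dashed H (inr (A, c)) (inr (B, c')).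
Definition below (c : 'I_3) := pm (prop H A) c.+1 = 0 /\ par H B = inr (A, c).

Lemma link_ty c c' : link c c' ->
  (c == 0 :> nat) (+) ty H (par H A) = ~~ ((c' == 0 :> nat) (+) ty H (par H B)).
Proof. by case=> _ /(dashed_leaf wf) [_ _]; rewrite !(ty_inr _ _ (wf_acyclic wf)). Qed.

Lemma below_ty c : below c -> ty H (par H B) = (c == 0 :> nat) (+) ty H (par H A).
Proof. by case=> _ ->; rewrite (ty_inr _ _ (wf_acyclic wf)). Qed.

Lemma link_inj c d c' : link c c' -> link d c' -> c = d.
Proof.
move=> [_ h1] [_]; rewrite dashed_sym in h1; rewrite dashed_sym => h2.
by have /eqP := dashed_fun wf h1 h2; rewrite [_ == _]xpair_eqE => /andP[_ /eqP].
Qed.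

Lemma below_inj c d : below c -> below d -> c = d.
Proof. by move=> [_ e] [_]; rewrite e => /eqP; rewrite [_ == _]xpair_eqE => /andP[_ /eqP]. Qed.

Definition cc (b : bool) := if b then c1 else c2.

Variant form : Prop :=
  | FormI b of link c0 c0 & link c1 (cc b) & link c2 (cc (~~ b)) & ty H (par H A) = ~~ ty H (par H B)
  | FormII b of below c0 & link c1 (cc b) & link c2 (cc (~~ b)) & ty H (inr (B, c0)) = ty H (par H A)
  | FormIII ba bc of below (cc ba) & link (cc (~~ ba)) c0 & link c0 (cc bc) &
      ty H (inr (B, cc (~~ bc))) = ty H (par H A).

(** At most one child edge of [newA] is the parent edge of [newB]. According to whether this is
    none, e2, or one of e3 and e4, the rule that dashed edges join opposite types leaves exactly the
    links of (I), (II) or (III). *)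
Lemma formP : (forall c : 'I_3, exists j : 'I_4, prop_rel H A (lift ord0 c : 'I_4) j /\
    ((j = ord0 /\ par H (mate H A) = inr (A, c)) \/
     exists2 c', j = lift ord0 c' & dashed H (inr (A, c)) (inr (mate H A, c')))) -> form.
Proof.
move=> ft; have {}ft c : below c \/ exists c', link c c'.
  have [j []] := ft c; rewrite /prop_rel mAB /= ltnSn => /eqP hj [[ej hb]|[c' ej hd]].
    by left; split=> //; move: hj; rewrite ej.
  by right; exists c'; split=> //; move: hj; rewrite ej.
case: (ft c0) => [k0|[x l0]].
  case: (ft c1) => [k1|[y l1]]; first by have := below_inj k0 k1.
  case: (ft c2) => [k2|[w l2]]; first by have := below_inj k0 k2.
  have tB := below_ty k0; have t1 := link_ty l1; have t2 := link_ty l2.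
  have t0 : ty H (inr (B, c0)) = ty H (par H A).
    by rewrite (ty_inr _ _ (wf_acyclic wf)) tB /= negbK.
  move: t1 t2; rewrite tB => t1 t2.
  case: (I3P y) => ey; subst y; case: (I3P w) => ew; subst w;
    try (by move: t1; case: (ty _ _)); try (by move: t2; case: (ty _ _));
    try (by have := link_inj l1 l2).
    exact: (@FormII true).
  exact: (@FormII false).
case: (ft c1) => [k1|[y l1]].
  case: (ft c2) => [k2|[w l2]]; first by have := below_inj k1 k2.
  have tB := below_ty k1; have tt0 := link_ty l0; have t2 := link_ty l2.
  move: tt0 t2; rewrite tB => t1 t2.
  have tt (c : 'I_3) : c != c0 -> ty H (inr (B, c)) = ty H (par H A).
    by rewrite (ty_inr _ _ (wf_acyclic wf)) tB; case: (I3P c) => ->.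
  case: (I3P x) => ey; subst x; case: (I3P w) => ew; subst w;
    try (by move: t1; case: (ty _ _)); try (by move: t2; case: (ty _ _)).
    by apply: (@FormIII true true) => //; apply: tt.
  by apply: (@FormIII true false) => //; apply: tt.
case: (ft c2) => [k2|[w l2]].
  have tB := below_ty k2; have tt0 := link_ty l0; have t2 := link_ty l1.
  move: tt0 t2; rewrite tB => t1 t2.
  have tt (c : 'I_3) : c != c0 -> ty H (inr (B, c)) = ty H (par H A).
    by rewrite (ty_inr _ _ (wf_acyclic wf)) tB; case: (I3P c) => ->.
  case: (I3P x) => ey; subst x; case: (I3P y) => ew; subst y;
    try (by move: t1; case: (ty _ _)); try (by move: t2; case: (ty _ _)).
    by apply: (@FormIII false true) => //; apply: tt.
  by apply: (@FormIII false false) => //; apply: tt.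
have t0 := link_ty l0; have t1 := link_ty l1; have t2 := link_ty l2.
case: (I3P x) => ex; subst x; case: (I3P y) => ey; subst y; case: (I3P w) => ew; subst w;
  try (by have := link_inj l1 l2); try (by have := link_inj l0 l1); try (by have := link_inj l0 l2).
- by apply: (@FormI true) => //; move: t1; rewrite /= !addFb.
- by apply: (@FormI false) => //; move: t1; rewrite /= !addFb.
- by move: t0 t1 t2; case: (ty _ (par H A)); case: (ty _ (par H B)).
- by move: t0 t1 t2; case: (ty _ (par H A)); case: (ty _ (par H B)).
- by move: t0 t1 t2; case: (ty _ (par H A)); case: (ty _ (par H B)).
- by move: t0 t1 t2; case: (ty _ (par H A)); case: (ty _ (par H B)).
Qed.

Lemma ccP b c : c = c0 \/ c = cc b \/ c = cc (~~ b).
Proof. by case: (I3P c) => ->; case: b; rewrite /cc /=; tauto. Qed.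

Lemma ccE b : inord (if b then 1 else 2) = cc b.
Proof. by case: b; rewrite ?inord_c1 ?inord_c2. Qed.
Lemma ccE' b : inord (other (if b then 1 else 2)) = cc (~~ b).
Proof. by case: b; rewrite /= ?inord_c1 ?inord_c2. Qed.
Lemma ccS b : (if b then 1 else 2) = cc b :> nat. Proof. by case: b. Qed.
Lemma ccS' b : other (if b then 1 else 2) = cc (~~ b) :> nat. Proof. by case: b. Qed.

Lemma form_insertion : form -> exists G, wf_graph G /\ insertion G H.
Proof.
case=> [b l0 l1 l2 tAB|b k0 l1 l2 tB|ba bc k l0 l1 tB].
- pose sg : {perm 'I_3} := if b then 1%g else tperm c1 c2.
  have hsg c : dashed H (inr (A, c)) (inr (B, sg c)).
    case: l0 => _ l0; case: l1 => _; case: l2 => _; rewrite /sg.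
    by case: (b) => l2 l1; case: (I3P c) => ->; rewrite ?perm1 ?tpermL ?tpermR ?tpermD.
  have [z [y [G [wG hzy [hA hB] hpar [hc hd]]]]] := reduce_side_by_side wf mAB hsg tAB.
  exists G; split=> //; left; exists z, y, b; split=> //.
  split=> //; split=> //; split=> //.
  rewrite /ch inord_c0 inord_c1 inord_c2 !ccE !ccE'; split.
    set news := [:: _; _; _].
    have hn xy : xy \in news -> dashed H xy.1 xy.2.
      by rewrite !inE => /or3P[] /eqP -> /=; [case: l0|case: l1|case: l2].
    apply: hd => // c; split.
      case: (I3P c) => ->; [apply: (covered_l (t := inr (B, c0)) hn)|
        apply: (covered_l (t := inr (B, cc b)) hn)|apply: (covered_l (t := inr (B, cc (~~ b))) hn)];
        by rewrite !inE !eqxx ?orbT.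
    case: (ccP b c) => [->|[->|->]]; [apply: (covered_r (s := inr (A, c0)) hn)|
        apply: (covered_r (s := inr (A, c1)) hn)|apply: (covered_r (s := inr (A, c2)) hn)];
        by rewrite !inE !eqxx ?orbT.
  apply: hc; rewrite !ccS' !ccS /=; case: l0 => /= -> _; case: l1 => /= -> _; case: l2 => /= -> _.
  by rewrite !eqxx.
- have hB : par H B = inr (A, c0) by case: k0.
  have [||| z [hA hz]] := @reduce_nested n H wf mAB c0 c0 hB.
  + move=> c; case: (I3P c) => -> // _; first by exists (cc b); [case: (b)|case: l1].
    by exists (cc (~~ b)); [case: (b)|case: l2].
  + move=> c cc0; have : c = cc b \/ c = cc (~~ b).
      by move: cc0; case: (I3P c) => -> //; case: (b); [left|right|right|left].
    by case=> ->; [exists c1 => //; case: l1|exists c2 => //; case: l2].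
  + exact: tB.
  case: hz => [[y [G [wG hzy hfy hpar [hc hd]]]]|[w [G [wG hw hfw hpar [hc hd]]]]]; exists G; split=> //.
    right; left; exists z, y, b; split=> //.
    split=> //; split=> //; split; first by rewrite /ch inord_c0.
    rewrite /ch inord_c0 inord_c1 inord_c2 !ccE !ccE'; split.
      set news := [:: _; _; _].
      have hn xy : xy \in news -> dashed H xy.1 xy.2.
        by rewrite !inE => /or3P[] /eqP -> //=; [case: l1|case: l2].
      apply: hd => // c; split.
        case: (I3P c) => ->; first exact: covered_occ hB.
          by apply: (covered_l (t := inr (B, cc b)) hn); rewrite !inE !eqxx ?orbT.
        by apply: (covered_l (t := inr (B, cc (~~ b))) hn); rewrite !inE !eqxx ?orbT.
      case: (ccP b c) => [->|[->|->]]; [apply: (covered_l (t := up_slot y) hn)|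
        apply: (covered_r (s := inr (A, c1)) hn)|apply: (covered_r (s := inr (A, c2)) hn)];
        by rewrite !inE !eqxx ?orbT.
    apply: hc; rewrite !ccS' !ccS /=; case: k0 => /= -> _; case: l1 => /= -> _; case: l2 => /= -> _.
    by rewrite !eqxx.
  right; right; right; left; exists w, b; split=> //; split; first by rewrite hw.
  split; first by rewrite /ch inord_c0.
  split; first by rewrite /ch inord_c0.
  rewrite /ch inord_c1 inord_c2 !ccE !ccE'; split.
    set news := [:: _; _].
    have hn xy : xy \in news -> dashed H xy.1 xy.2.
      by rewrite !inE => /orP[] /eqP -> //=; [case: l1|case: l2].
    apply: hd => // c; split.
      case: (I3P c) => ->; first exact: covered_occ hB.
        by apply: (covered_l (t := inr (B, cc b)) hn); rewrite !inE !eqxx ?orbT.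
      by apply: (covered_l (t := inr (B, cc (~~ b))) hn); rewrite !inE !eqxx ?orbT.
    case: (ccP b c) => [->|[->|->]]; [exact: covered_occ hfw|
      apply: (covered_r (s := inr (A, c1)) hn)|apply: (covered_r (s := inr (A, c2)) hn)];
      by rewrite !inE !eqxx ?orbT.
  apply: hc; rewrite !ccS' !ccS /=; case: k0 => /= -> _; case: l1 => /= -> _; case: l2 => /= -> _.
  by rewrite !eqxx.
- have hB : par H B = inr (A, cc ba) by case: k.
  have [||| z [hA hz]] := @reduce_nested n H wf mAB (cc ba) (cc (~~ bc)) hB.
  + move=> c; case: (ccP ba c) => [->|[->|->]] => [h|/eqP//|h].
      by exists (cc bc); [case: (bc)|case: l1].
    by exists c0; [case: (bc)|case: l0].
  + move=> c; case: (ccP bc c) => [->|[->|->]] => [h|h|/eqP//].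
      by exists (cc (~~ ba)); [case: (ba)|case: l0].
    by exists c0; [case: (ba)|case: l1].
  + exact: tB.
  case: hz => [[y [G [wG hzy hfy hpar [hc hd]]]]|[w [G [wG hw hfw hpar [hc hd]]]]]; exists G; split=> //.
    right; right; left; exists z, y, ba, bc; split=> //.
    split=> //; split=> //; split; first by rewrite /ch ccE.
    rewrite /ch inord_c0 !ccE !ccE'; split.
      set news := [:: _; _; _].
      have hn xy : xy \in news -> dashed H xy.1 xy.2.
        by rewrite !inE => /or3P[] /eqP -> //=; [case: l1|case: l0].
      apply: hd => // c; split.
        case: (ccP ba c) => [->|[->|->]].
        - by apply: (covered_l (t := inr (B, cc bc)) hn); rewrite !inE !eqxx ?orbT.
        - exact: covered_occ hB.
        - by apply: (covered_l (t := inr (B, c0)) hn); rewrite !inE !eqxx ?orbT.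
      case: (ccP bc c) => [->|[->|->]].
      - by apply: (covered_r (s := inr (A, cc (~~ ba))) hn); rewrite !inE !eqxx ?orbT.
      - by apply: (covered_r (s := inr (A, c0)) hn); rewrite !inE !eqxx ?orbT.
      - by apply: (covered_l (t := up_slot y) hn); rewrite !inE !eqxx ?orbT.
    apply: hc; rewrite !ccS' !ccS /=; case: k => /= -> _; case: l0 => /= -> _; case: l1 => /= -> _.
    by rewrite !eqxx.
  (* In (IIIs) the second choice names the child of [newB] that carries the old vertex, whereas [bc]
     names the one linked to e2 of [newA]; hence the negation. *)
  right; right; right; right; exists w, ba, (~~ bc); split=> //; split; first by rewrite hw.
  split; first by rewrite /ch ccE.
  split; first by rewrite /ch ccE.
  rewrite /ch inord_c0 !ccE' negbK; split.
    set news := [:: _; _].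
    have hn xy : xy \in news -> dashed H xy.1 xy.2.
      by rewrite !inE => /orP[] /eqP -> //=; [case: l1|case: l0].
    apply: hd => // c; split.
      case: (ccP ba c) => [->|[->|->]].
      - by apply: (covered_l (t := inr (B, cc bc)) hn); rewrite !inE !eqxx ?orbT.
      - exact: covered_occ hB.
      - by apply: (covered_l (t := inr (B, c0)) hn); rewrite !inE !eqxx ?orbT.
    case: (ccP bc c) => [->|[->|->]].
    - by apply: (covered_r (s := inr (A, cc (~~ ba))) hn); rewrite !inE !eqxx ?orbT.
    - by apply: (covered_r (s := inr (A, c0)) hn); rewrite !inE !eqxx ?orbT.
    - exact: covered_occ hfw.
  apply: hc; rewrite !ccS' !ccS negbK /=; case: k => /= -> _; case: l0 => /= -> _; case: l1 => /= -> _.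
  by rewrite !eqxx.
Qed.

End Reduction.

(** * Transport of an insertion along an isomorphism *)

Section Transport.
Variable n : nat.
Local Notation A := (newA n).
Local Notation B := (newB n).
Variables (G0 M0 : graph n) (H : graph n.+2) (k : {perm 'I_n}).
Hypothesis wM : wf_graph M0.
Hypothesis hk : iso_by k M0 G0.
Hypothesis ins : insertion G0 H.

Definition extk (w : 'I_n.+2) := if old w is Some u then up (k u) else w.
Lemma extk_up u : extk (up u) = up (k u). Proof. by rewrite /extk old_up. Qed.
Lemma extk_A : extk A = A. Proof. by rewrite /extk old_newA. Qed.
Lemma extk_B : extk B = B. Proof. by rewrite /extk old_newB. Qed.
Lemma extk_inj : injective extk.
Proof.
move=> v w; case: (oldP v) => [u ->|->|->]; case: (oldP w) => [u' ->|->|->];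
  rewrite ?extk_up ?extk_A ?extk_B //.
- by move/up_inj/perm_inj ->.
- by move/eqP; rewrite (negbTE (up_neqA _)).
- by move/eqP; rewrite (negbTE (up_neqB _)).
- by move/esym/eqP; rewrite (negbTE (up_neqA _)).
- by move/esym/eqP; rewrite (negbTE (up_neqB _)).
Qed.
Definition kx : {perm 'I_n.+2} := perm extk_inj.
Lemma kx_up u : kx (up u) = up (k u). Proof. by rewrite permE extk_up. Qed.
Lemma kx_A : kx A = A. Proof. by rewrite permE extk_A. Qed.
Lemma kx_B : kx B = B. Proof. by rewrite permE extk_B. Qed.
Lemma kxV_up u : (kx^-1)%g (up u) = up ((k^-1)%g u).
Proof. by apply: (@perm_inj _ kx); rewrite permKV kx_up permKV. Qed.
Lemma kxV_A : (kx^-1)%g A = A. Proof. by rewrite -{1}kx_A permK. Qed.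
Lemma kxV_B : (kx^-1)%g B = B. Proof. by rewrite -{1}kx_B permK. Qed.
Lemma kx_slot s : map_slot kx (up_slot s) = up_slot (map_slot k s).
Proof. by case: s => [b|[u c]] //=; rewrite kx_up. Qed.
Lemma kxV_slot s : map_slot (kx^-1)%g (up_slot s) = up_slot (map_slot (k^-1)%g s).
Proof. by case: s => [b|[u c]] //=; rewrite kxV_up. Qed.

(** As [k] need not preserve the order of labels, the indices of old pairs are those of [M0]; the
    new pair keeps its order and its index in [H]. *)
Definition kpr (w : 'I_n.+2) : 'I_8 :=
  if old w is Some u then prop M0 u else if w == A then prop H A else ord0.

Let M1 := pull kx kpr H.

Lemma transport_wf_iso : wf_graph M1 /\ iso_by kx M1 H.
Proof.
have [l [wf [hm [mA [mB [hp [hl pB]]]]]]] := ins_common_insertion ins.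
have [_ _ hmate hrel] := hk.
have hpr u : kpr (up u) = prop M0 u by rewrite /kpr old_up.
have hprA : kpr A = prop H A by rewrite /kpr old_newA eqxx.
have hprB : kpr B = ord0 by rewrite /kpr old_newB eq_sym (negbTE (newAB n)).
have hm1 u : (kx^-1)%g (mate H (kx (up u))) = up (mate M0 u).
  by rewrite kx_up hm hmate kxV_up permK.
apply: pullP => // [w|w i j]; case: (oldP w) => [u ->|->|->].
- by rewrite hm1 hpr => h; apply: (wf_prop wM).
- by rewrite kx_A mA kxV_B /= ltnNge leqnSn.
- by [].
- rewrite /prop_rel mk_mate !mk_prop hm1 !hpr kx_up hm !hp.
  by have := hrel u i j; rewrite /prop_rel.
- by rewrite /prop_rel mk_mate !mk_prop kx_A mA kxV_B hprA hprB /= ltnSn.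
- by rewrite /prop_rel mk_mate !mk_prop kx_B mB kxV_A hprA /= ltnNge leqnSn.
Qed.

Let k1 := (kx^-1)%g.

Lemma transport_par w u : par H (up u) = up_slot w ->
  par M1 (up ((k^-1)%g u)) = up_slot (map_slot (k^-1)%g w).
Proof. by move=> h; rewrite mk_par kx_up permKV h kxV_slot. Qed.

Lemma transport_old (P : pred 'I_n) :
  (forall u, P u -> par H (up u) = up_slot (par G0 u)) ->
  forall u, P (k u) -> par M1 (up u) = up_slot (par M0 u).
Proof.
move=> h u Pu; have [hpar _ _ _] := hk.
by rewrite -{1}(permK k u) (transport_par (h _ Pu)) hpar map_slot_permK.
Qed.

Lemma transport_common l : ins_common G0 H l -> ins_common M0 M1 l.
Proof.
move=> [wf [hm [mA [mB [hp [hl pB]]]]]]; have [wM1 _] := transport_wf_iso.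
have [_ _ hmate hrel] := hk.
split=> //; split.
  by move=> u; rewrite mk_mate kx_up hm hmate kxV_up permK.
split; first by rewrite mk_mate kx_A mA kxV_B.
split; first by rewrite mk_mate kx_B mB kxV_A.
split; first by move=> u; rewrite mk_prop /kpr old_up.
by rewrite !mk_prop /kpr old_newA old_newB eqxx eq_sym (negbTE (newAB n)).
Qed.

Definition mapp (f : 'I_n -> 'I_n) (xy : slot n * slot n) := (map_slot f xy.1, map_slot f xy.2).

Lemma transport_dashed excl news :
  ins_dashed G0 H excl news ->
  ins_dashed M0 M1 (omap (mapp (k^-1)%g) excl)
    [seq (map_slot (kx^-1)%g xy.1, map_slot (kx^-1)%g xy.2) | xy <- news].
Proof.
move=> hd s t; have [_ [_ hds _ _]] := transport_wf_iso; have [_ hdk _ _] := hk.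
have kk r x : map_slot kx r = x -> r = map_slot (kx^-1)%g x.
  by move=> <-; rewrite map_slot_permK.
rewrite hds hd; split.
- move=> [[s0 [t0 [hs [ht [h1 h2]]]]]|[xy hxy hu]]; [left|right].
    exists (map_slot (k^-1)%g s0), (map_slot (k^-1)%g t0).
    rewrite -!kxV_slot -hs -ht !map_slot_permK; split=> //; split=> //; split.
      by rewrite hdk !map_slot_permKV.
    case: (excl) h2 => [[x y]|] //= h2 h3; apply: h2.
    by case: h3 => -[/(can_inj (map_slot_permKV k)) -> /(can_inj (map_slot_permKV k)) ->]; [left|right].
  exists (map_slot (kx^-1)%g xy.1, map_slot (kx^-1)%g xy.2); first exact: (map_f _ hxy).
  by case: hu => -[/kk -> /kk ->]; [left|right].
- move=> [[s0 [t0 [-> [-> [h1 h2]]]]]|[xy /mapP[xy' hxy' ->] /= hu]]; [left|right].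
    exists (map_slot k s0), (map_slot k t0).
    rewrite !kx_slot -hdk; split=> //; split=> //; split=> //.
    case: (excl) h2 => [[x y]|] //= h2 h3; apply: h2.
    by case: h3 => -[<- <-]; rewrite /mapp !map_slot_permK; [left|right].
  exists xy' => //.
  by case: hu => -[-> ->]; rewrite !map_slot_permKV; [left|right].
Qed.

Lemma kxV_chA c : map_slot (kx^-1)%g (ch A c) = ch A c.
Proof. by rewrite /ch /= kxV_A. Qed.
Lemma kxV_chB c : map_slot (kx^-1)%g (ch B c) = ch B c.
Proof. by rewrite /ch /= kxV_B. Qed.
Lemma transport_parA s : par H A = s -> par M1 A = map_slot (kx^-1)%g s.
Proof. by move=> <-; rewrite mk_par kx_A. Qed.
Lemma transport_parB s : par H B = s -> par M1 B = map_slot (kx^-1)%g s.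
Proof. by move=> <-; rewrite mk_par kx_B. Qed.

(** The induction on the order yields [mel] for a graph [M0] that is only isomorphic to the reduced
    graph [G0]; the insertion is replayed on [M0]. *)
Lemma transport_insertion : insertion M0 M1.
Proof.
have [hpar hdk _ _] := hk; pose kV := map_slot (k^-1)%g.
have hz u : par G0 u = map_slot k (par M0 ((k^-1)%g u)) by rewrite -hpar permKV.
case: (ins) => [[z [z' [b [hzz [hp [hA [hB [hd hc]]]]]]]]|].
  left; exists (kV z), (kV z'), b; split; first by rewrite hdk !map_slot_permKV.
  split; first by move=> u; apply: (transport_old (P := xpredT)).
  split; first by rewrite (transport_parA hA) kxV_slot.
  split; first by rewrite (transport_parB hB) kxV_slot.
  split; last exact: transport_common.
  by have := transport_dashed hd; cbn [map fst snd]; rewrite !kxV_chA !kxV_chB.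
case=> [[z [z' [b [hzz [hp [hA [hB [hd hc]]]]]]]]|].
  right; left; exists (kV z), (kV z'), b; split; first by rewrite hdk !map_slot_permKV.
  split; first by move=> u; apply: (transport_old (P := xpredT)).
  split; first by rewrite (transport_parA hA) kxV_slot.
  split; first by rewrite (transport_parB hB) kxV_chA.
  split; last exact: transport_common.
  by have := transport_dashed hd; cbn [map fst snd]; rewrite !kxV_chA !kxV_chB kxV_slot.
case=> [[z [z' [ba [bc [hzz [hp [hA [hB [hd hc]]]]]]]]]|].
  right; right; left; exists (kV z), (kV z'), ba, bc; split; first by rewrite hdk !map_slot_permKV.
  split; first by move=> u; apply: (transport_old (P := xpredT)).
  split; first by rewrite (transport_parA hA) kxV_slot.
  split; first by rewrite (transport_parB hB) kxV_chA.
  split; last exact: transport_common.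
  by have := transport_dashed hd; cbn [map fst snd]; rewrite !kxV_chA !kxV_chB kxV_slot.
case=> [[z [b [hp [hA [hB [hw [hd hc]]]]]]]|[z [ba [bc [hp [hA [hB [hw [hd hc]]]]]]]]].
  right; right; right; left; exists ((k^-1)%g z), b; split.
    move=> u uz; apply: (transport_old (P := fun u => u != z)); first exact: hp.
    by rewrite -(inj_eq (@perm_inj _ (k^-1)%g)) permK.
  split; first by rewrite (transport_parA hA) kxV_slot hz map_slot_permK.
  split; first by rewrite (transport_parB hB) kxV_chA.
  split; first by rewrite mk_par kx_up permKV hw kxV_chB.
  split; last exact: transport_common.
  by have := transport_dashed hd; cbn [map fst snd]; rewrite !kxV_chA !kxV_chB.
right; right; right; right; exists ((k^-1)%g z), ba, bc; split.
  move=> u uz; apply: (transport_old (P := fun u => u != z)); first exact: hp.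
  by rewrite -(inj_eq (@perm_inj _ (k^-1)%g)) permK.
split; first by rewrite (transport_parA hA) kxV_slot hz map_slot_permK.
split; first by rewrite (transport_parB hB) kxV_chA.
split; first by rewrite mk_par kx_up permKV hw kxV_chB.
split; last exact: transport_common.
by have := transport_dashed hd; cbn [map fst snd]; rewrite !kxV_chA !kxV_chB.
Qed.

End Transport.

Section MelWf.

Lemma triv_wf : wf_graph triv.
Proof.
have hocc s : occupied triv s = false by apply/existsP => -[[]].
have hA s : leafA triv s = (s == inl true).
  by rewrite /leafA hocc; case: s => [b|[[]]] //; rewrite ty_inl; case: b.
split; first by case.
split; first by exists (fun _ => 0) => -[].
split; first by case.
split; first by case.
split; first by move=> s; rewrite hA => /eqP ->; rewrite /dash /= ffunE eqxx /leafB hocc ty_inl.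
split; first by move=> s; rewrite hA /dash /= ffunE => /negbTE ->.
split.
  move=> s t hs ht _; have /eqP -> : s == inl true by rewrite -hA.
  by have /eqP -> : t == inl true by rewrite -hA.
move=> t; rewrite /leafB hocc; case: t => [b|[[]]] //; rewrite ty_inl => hb.
exists (inl true); first by rewrite hA.
by rewrite /dash /= ffunE eqxx; case: b hb.
Qed.

Lemma mel_wf n (G : graph n) : mel G -> wf_graph G.
Proof. by elim=> [|m G1 G2 _ _ /insertion_wf //]; apply: triv_wf. Qed.

Lemma iso_triv (G : graph 0) : wf_graph G -> iso triv G.
Proof.
move=> wf; exists 1%g; split; first by case.
split; last by split; case.
have hd G' : wf_graph G' -> forall s t : slot 0, dashed G' s t = (s != t).
  move=> w' s t; apply/idP/idP => [/(dashed_neq w') //|].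
  have hocc r : occupied G' r = false by apply/existsP => -[[]].
  have [|r hr] := dashed_tot w' (s := s); first by rewrite hocc.
  have hn := dashed_neq w' hr; move: hn hr; case: s => [bs|[[]]] //; case: t => [bt|[[]]] //; case: r => [br|[[]]] //.
  by case: bs; case: bt; case: br.
move=> s t; rewrite !hd //; last exact: triv_wf.
by case: s => [bs|[[]]] //; case: t => [bt|[[]]].
Qed.

End MelWf.

(* Induction on the order: three edges join some pair of mates; removing the
   pair preserves redundancy since flows extend over an insertion. *)
Theorem redundant_melonic n (G : graph n) : wf_graph G -> redundant G -> melonic G.
Proof.
have [m] := ubnP n; elim: m n G => // m IH [|[|n]] G hm wf red.
- by exists triv; split; [apply: mel_triv|apply: iso_triv].
- by have := mate_neq wf ord0; rewrite [mate G ord0]ord1 [ord0]ord1 eqxx.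
have [v hv] := free_top wf red ord0.
(* Sends [newA] to [v] and [newB] to the mate of [v]: the second transposition fixes [v]. *)
pose k : {perm 'I_n.+2} := (tperm (newA n) v * tperm (tperm (newA n) v (newB n)) (mate G v))%g.
have kA : k (newA n) = v.
  have h1 : tperm (newA n) v (newB n) != v.
    apply/eqP => h; have := newAB n.
    by rewrite -(inj_eq (@perm_inj _ (tperm (newA n) v))) tpermL h eqxx.
  by rewrite permM tpermL (tpermD h1 (mate_neq wf v)).
have kB : k (newB n) = mate G v by rewrite permM tpermL.
have [H [wH hH]] := relabel k wf.
have [hpar hds hmt hrel] := hH.
have mAB : mate H (newA n) = newB n.
  by apply: (@perm_inj _ k); rewrite -hmt kA kB.
have [G0 [wG0 insG0]] : exists G0, wf_graph G0 /\ insertion G0 H.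
  apply: form_insertion => //; apply: formP => // c.
  have [j [hj hc]] := hv c; exists j; rewrite hrel kA; split=> //.
  rewrite mAB; case: hc => [[ej hc]|[c' ej hc]]; [left|right].
    split=> //; apply: (can_inj (map_slot_permK k)).
    by rewrite -hpar kB hc /= kA.
  by exists c' => //; rewrite hds /= kA kB.
have redH : redundant H by apply: (iso_by_redundant hH).
have redG0 : redundant G0.
  have [l [_ [hmate [_ [_ [hprop _]]]]]] := ins_common_insertion insG0.
  have [z hins] := insertion_flow rat insG0.
  (* Any values of the two parameters would do: only the old ends are looked at. *)
  move=> x hx; have [hy hend _] := hins x 0%R 0%R hx.
  move=> u i j hr; rewrite -!hend -hmate; apply: (redH _ hy).
  by move: hr; rewrite /prop_rel hmate !hprop.
have [|M0 [mM0 /iso_byP[k0 hk0]]] := IH n G0 _ wG0 redG0.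
  by rewrite -ltnS; apply: leq_trans hm; rewrite ltnS.
exists (pull (kx k0) (kpr M0 H) H); split.
  by apply: (mel_step mM0); apply: (transport_insertion (mel_wf mM0) hk0 insG0).
apply: (@iso_trans _ _ H); apply/iso_byP; last by exists k.
by exists (kx k0); have [] := transport_wf_iso (mel_wf mM0) hk0 insG0.
Qed.

(** * Momentum attributions *)

Section Attributions.
Variables (n r : nat) (G : graph n).
Hypothesis wf : wf_graph G.
Implicit Types (x : slot n -> nat) (v : 'I_n)
  (a : {ffun 'I_n -> nat} * {ffun 'I_n -> nat} * {ffun 'I_n -> nat}).

Definition nat_flow x := [/\ gflow G x, matched G x & x (inl true) = r].

(** With [slotmom r], this puts the admissible attributions in bijection with the matched flows of
    root value [r]. *)
Definition attr x : {ffun 'I_n -> nat} * {ffun 'I_n -> nat} * {ffun 'I_n -> nat} :=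
  ([ffun v => x (par G v) + x (inr (v, c0))], [ffun v => x (par G v)], [ffun v => x (inr (v, c1))]).

Definition nend x v (i : nat) :=
  match i with
  | 0 => x (par G v) | 1 => x (inr (v, c0)) | 2 => x (inr (v, c1)) | _ => x (inr (v, c2))
  end.

Lemma nendE x v (i : 'I_4) : x (endslot G v i) = nend x v i.
Proof.
by case: (I4P i) => [->|[c ->]]; rewrite ?endslot0 ?endslotS //; case: (I3P c) => ->.
Qed.

Lemma gflow_nat x v : gflow G x -> nend x v 0 + nend x v 1 = nend x v 2 + nend x v 3.
Proof. by case=> _ h _; apply: h. Qed.

Lemma matched_nat x v i : matched G x -> v < mate G v -> i < 4 ->
  nend x v i = nend x (mate G v) (pm (prop G v) i).
Proof.
move=> hm hv hi; rewrite -[i]/(nat_of_ord (Ordinal hi)) -nendE.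
have hj := pm_lt (prop G v) (Ordinal hi).
rewrite -[pm _ _]/(nat_of_ord (Ordinal hj)) -nendE; apply: hm.
by rewrite /prop_rel hv /=.
Qed.

Lemma slotmom_attr x s : gflow G x -> x (inl true) = r -> slotmom r (attr x) s = x s.
Proof.
move=> hx hr; have [h1 _ _] := hx.
case: s => [[]|[u c]] /=; rewrite -?h1 //.
have := gflow_nat u hx.
by case: (I3P c) => ->; rewrite /= /aS /aj /ak /= ?ffunE /=; lia.
Qed.

Lemma attr_admissible x : nat_flow x -> admissible G r (attr x).
Proof.
move=> [hx hm hr]; have sm := slotmom_attr _ hx hr.
have [h1 h2 h3] := hx; split.
  move=> v; have := gflow_nat v hx; rewrite /= /aS /aj /ak /= !ffunE; lia.
split; first by move=> v u c e; have := sm (inr (u, c)); rewrite /= => ->; rewrite -e /aj /= ffunE.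
split; first by move=> v b e; rewrite /aj /= ffunE e; case: b {e}; rewrite -?h1.
split.
  by move=> s hs; rewrite !sm; apply: h3; rewrite /dashed hs eqxx.
move=> v hv; have m0 := matched_nat hm hv (isT : 0 < 4); have m1 := matched_nat hm hv (isT : 1 < 4).
have m2 := matched_nat hm hv (isT : 2 < 4); have m3 := matched_nat hm hv (isT : 3 < 4).
have e1 := gflow_nat v hx; have e2 := gflow_nat (mate G v) hx.
rewrite /propagator /aS /aj /ak /= !ffunE.
move: m0 m1 m2 m3 e1 e2; rewrite /=.
by case: (prop G v) => -[|[|[|[|[|[|[|[|]]]]]]]] //= _; lia.
Qed.

Lemma slotmom_par a v : admissible G r a -> slotmom r a (par G v) = aj a v.
Proof.
move=> [_ [h1 [h2 _]]]; case e: (par G v) => [b|[u c]]; first by rewrite /= (h2 _ _ e).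
exact: (h1 v u c e).
Qed.

Lemma nend_slotmom a v i : admissible G r a -> nend (slotmom r a) v i = endmom a v i.
Proof.
move=> ha; case: i => [|[|[|i]]] //; first exact: slotmom_par.
Qed.

Lemma slotmom_flow a : admissible G r a -> nat_flow (slotmom r a).
Proof.
move=> ha; have [h1 [h2 [h3 [h4 h5]]]] := ha.
have dsh s : leafA G s -> slotmom r a s = slotmom r a (dash G s) := h4 s.
split=> //.
  split=> // [v|s t].
    rewrite (slotmom_par _ ha) /=; have [] := h1 v.
    by rewrite /GRing.add /=; lia.
  by case/orP => /andP[hl /eqP <-]; rewrite (dsh _ hl).
have key v i : v < mate G v -> i < 4 -> endmom a v i = endmom a (mate G v) (pm (prop G v) i).
  move=> hv hi; have [] := h1 v; have [] := h1 (mate G v); have := h5 v hv.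
  rewrite /propagator; case: (prop G v) => -[|[|[|[|[|[|[|[|]]]]]]]] //= _;
    by case: i hi => [|[|[|[|i]]]] //= _; lia.
move=> v i j; rewrite !nendE !nend_slotmom // /prop_rel; case: ltngtP => //= hv /eqP.
- by move=> <-; apply: key.
- by move=> <-; rewrite (key (mate G v)) ?(mateK wf).
- by have := mate_neq wf v; rewrite -(inj_eq val_inj) /= -hv eqxx.
Qed.

Lemma attrK a : admissible G r a -> attr (slotmom r a) = a.
Proof.
move=> ha; have [h1 _] := ha; case: a ha h1 => -[S j] k ha h1.
by congr (_, _, _); apply/ffunP => v; rewrite ffunE ?(slotmom_par _ ha) //=;
  have := h1 v; rewrite /aS /aj /ak /=; lia.
Qed.

End Attributions.

(** * Free parameters of melonic graphs *)

Section Family.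

(* [n] free natural parameters for the matched flows of root value [r] *)
Definition has_family n (G : graph n) := forall r, exists (K : nat)
    (phi : {ffun 'I_n -> nat} -> slot n -> nat),
  [/\ forall m, nat_flow r G (phi m), forall m m', phi m =1 phi m' -> m = m' &
      forall m s, phi m s <= K * (1 + \sum_i m i)].

Lemma family_triv : has_family triv.
Proof.
move=> r; exists r, (fun _ _ => r); split=> [m|m m' _|m s].
- by split=> //; split=> // -[].
- by apply/ffunP => -[].
- by rewrite leq_pmulr.
Qed.

Lemma sum_up n (m : 'I_n.+2 -> nat) :
  \sum_i m i = \sum_(u < n) m (up u) + m (newA n) + m (newB n).
Proof.
rewrite !big_ord_recr /=; congr (_ + _ + _).
- by apply: eq_bigr => i _; congr m; apply: val_inj.
- by congr m; apply: val_inj.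
Qed.

Lemma family_insertion n (G : graph n) (H : graph n.+2) :
  insertion G H -> has_family G -> has_family H.
Proof.
move=> hins fam r; have [K [phi [f1 f2 f3]]] := fam r.
have [z hz] := insertion_flow nat hins.
pose res (m : {ffun 'I_n.+2 -> nat}) := [ffun u => m (up u)] : {ffun 'I_n -> nat}.
pose y m := ext (prop H (newA n)) (phi (res m) z) (m (newA n)) (m (newB n)) (phi (res m)).
(* A new momentum is at most an old one plus the two new parameters, so the constant grows by
   one. *)
exists K.+1, y.
have up_ m s : y m (up_slot s) = phi (res m) s by apply: extv_up.
have A_ m c : y m (inr (newA n, c)) = newend (phi (res m) z) (m (newA n)) (m (newB n)) c.+1.
  exact: extv_A.
have B_ m c : y m (inr (newB n, c)) =
    newend (phi (res m) z) (m (newA n)) (m (newB n)) (pm (invp (prop H (newA n))) c.+1).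
  exact: extv_B.
split=> [m|m m' e|m s].
- have [g1 g2 g3] := f1 (res m); have [h1 h2 h3] := hz _ (m (newA n)) (m (newB n)) g1.
  by split=> //; apply: h3.
- have er : res m = res m' by apply: f2 => s; rewrite -(up_ m) -(up_ m') e.
  (* The parameter [b] is the momentum of e4 of [newA]; the parameter [a] is then read off at e2,
     which carries [a + b]. *)
  have eB : m (newB n) = m' (newB n) by have := e (inr (newA n, c2)); rewrite !A_.
  have eA : m (newA n) = m' (newA n).
    have := e (inr (newA n, c0)); rewrite !A_ /= eB /GRing.add /= => h; lia.
  apply/ffunP => w; case: (oldP w) => [u ->|->|->] //.
  by have /ffunP/(_ u) := er; rewrite !ffunE.
- have hs t : phi (res m) t <= K * (1 + \sum_i res m i) := f3 (res m) t.
  have es : \sum_(u < n) m (up u) = \sum_i res m i by apply: eq_bigr => i _; rewrite ffunE.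
  have hnew i : newend (phi (res m) z) (m (newA n)) (m (newB n)) i <= K.+1 * (1 + \sum_i m i).
    have := hs z; rewrite sum_up es; move: (\sum_i res m i) (phi _ z) => S f.
    by case: i => [|[|[|i]]]; rewrite /newend /GRing.add /=; nia.
  case: (slot_oldP s) => [t ->|c ->|c ->]; rewrite ?up_ ?A_ ?B_ //.
  by apply: leq_trans (hs t) _; rewrite sum_up es; apply: leq_mul => //; lia.
Qed.

Lemma family_mel n (G : graph n) : mel G -> has_family G.
Proof. by elim=> [|m G0 G1 _ fam /family_insertion]; [apply: family_triv|apply]. Qed.

Lemma family_melonic n (G : graph n) : melonic G -> has_family G.
Proof.
move=> [G0 [/family_mel fam /iso_byP [k hk]]] r; have [K [phi [f1 f2 f3]]] := fam r.
exists K, (fun m => phi m \o map_slot (k^-1)%g); split=> [m|m m' e|m s].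
- have [g1 g2 g3] := f1 m; split=> //; first exact: iso_by_gflow (iso_by_sym hk) g1.
  exact: iso_by_matched (iso_by_sym hk) g2.
- by apply: f2 => s; have := e (map_slot k s); rewrite /= map_slot_permK.
- exact: f3.
Qed.

End Family.

From mathcomp Require Import boolp.

(** * Leaf momenta as coordinates of flows *)

Section Exchange.
Local Open Scope ring_scope.
Variables (S : finType) (W : (S -> rat) -> Prop) (l : (S -> rat) -> rat) (J : {set S}).
Hypothesis W_lin : forall a x y, W x -> W y -> W (fun s => a * x s + y s).
Hypothesis l_lin : forall a x y, l (fun s => a * x s + y s) = a * l x + l y.
Hypothesis l_0 : forall x, (forall s, x s = 0) -> l x = 0.
Hypothesis J_inj : forall x, W x -> (forall s, s \in J -> x s = 0) -> forall s, x s = 0.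

(* If no coordinate [i] could be dropped, each one could be cancelled in [y]
   without changing [l y], so that [l y] would be the value at [0]. *)
Lemma exchange y : W y -> l y != 0 ->
  exists2 i, i \in J & forall x, W x -> l x = 0 ->
    (forall s, s \in J :\ i -> x s = 0) -> forall s, x s = 0.
Proof.
move=> Wy ly; apply: contrapT => hn.
have hz i : i \in J -> exists z, [/\ W z, l z = 0, forall s, s \in J :\ i -> z s = 0 & z i != 0].
  move=> iJ; apply: contrapT => hz; apply: hn; exists i => // x Wx lx hx; apply: J_inj => // s sJ.
  case: (s =P i) => [->|/eqP si]; last by apply: hx; rewrite !inE si.
  by apply/eqP/negPn/negP => xi; apply: hz; exists x.
have : forall r : seq S, {subset r <= J} ->
    exists w, [/\ W w, l w = l y & forall s, s \in r -> w s = 0].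
  elim=> [|i r IH] hr; first by exists y.
  have [|w [Ww lw hw]] := IH; first by move=> s sr; apply: hr; rewrite inE sr orbT.
  have [|z [Wz lz hzs zi]] := hz i; first by apply: hr; rewrite inE eqxx.
  exists (fun s => - (w i / z i) * z s + w s); split.
  - exact: W_lin.
  - by rewrite l_lin lz mulr0 add0r.
  move=> s; rewrite inE; case: (s =P i) => [-> _|/eqP si /= sr].
    by rewrite mulNr divfK // addNr.
  have sJ : s \in J by apply: hr; rewrite inE sr orbT.
  by rewrite (hw s sr) (hzs s) ?mulr0 ?addr0 // !inE si sJ.
case/(_ (enum J)) => [s|w [Ww lw hw]]; first by rewrite mem_enum.
have w0 : forall s, w s = 0 by apply: J_inj => // s sJ; apply: hw; rewrite mem_enum.
by case/eqP: ly; rewrite -lw l_0.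
Qed.

End Exchange.

Section Chords.
Local Open Scope ring_scope.
Variables (n : nat) (G : graph n).
Hypothesis wf : wf_graph G.

(** A dashed edge passes the zero from its alpha leaf to its anti-leaf. From there zeros climb the
    tree, since conservation gives a parent momentum from those of the three children. *)
Lemma leaf_determined (x : slot n -> rat) : gflow G x ->
  (forall s, leafA G s -> x s = 0) -> forall s, x s = 0.
Proof.
move=> [_ h2 h3] hA.
have hleaf s t : dashed G s t -> x s = 0.
  move=> h; have [l1 l2 hty] := dashed_leaf wf h.
  case tys: (ty G s); first by apply: hA; rewrite /leafA l1 tys.
  rewrite (h3 _ _ h); apply: hA; rewrite /leafA l2 /=.
  by move: hty; rewrite tys => /esym/negbT; rewrite negbK.
have [d hd] := wf_acyclic wf; pose M := (\max_v d v)%N.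
have dM v : (d v <= M)%N by apply: leq_bigmax.
have hp : forall k v, (M - d v < k)%N -> x (par G v) = 0.
  elim=> // k IH v hv; have hc c : x (inr (v, c)) = 0.
    case: (slotP wf (inr (v, c))) => [[w e]|[t ht]]; last exact: hleaf ht.
    by rewrite e; apply: IH; have := hd _ _ _ (esym e); have := dM w; lia.
  by have := h2 v; rewrite !hc !addr0.
move=> s; case: (slotP wf s) => [[w ->]|[t ht]]; last exact: hleaf ht.
exact: hp (ltnSn _).
Qed.

Lemma gflow_lin (a : rat) x y : gflow G x -> gflow G y -> gflow G (fun s => a * x s + y s).
Proof.
move=> [x1 x2 x3] [y1 y2 y3]; split=> [|v|s t h]; rewrite ?x1 ?y1 //.
  by rewrite addrACA -mulrDr x2 y2 mulrDr addrACA.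
by rewrite (x3 _ _ h) (y3 _ _ h).
Qed.

Lemma gflow1 : gflow G (fun _ => 1 : rat).
Proof. by []. Qed.

Lemma gflow_rat (x : slot n -> nat) : gflow G x -> gflow G (fun s => (x s)%:R : rat).
Proof.
move=> [x1 x2 x3]; split=> [|v|s t /x3 ->] //; first by rewrite x1.
by rewrite -!natrD; congr _%:R; apply: x2.
Qed.

Definition leaves := [set s | leafA G s].

Lemma leaf_sum (W : nmodType) (x : slot n -> W) : (forall s t, dashed G s t -> x s = x t) ->
  \sum_(s | leafB G s) x s = \sum_(s | leafA G s) x s.
Proof.
move=> hx; have dA s : leafA G s -> dashed G s (dash G s) by move=> h; rewrite /dashed h eqxx.
transitivity (\sum_(t in [set dash G s | s in leaves]) x t).
  apply: eq_bigl => t; apply/idP/imsetP => [/(dash_surj wf) [s hs <-]|[s]].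
    by exists s; rewrite // inE.
  by rewrite inE => /(dash_leafB wf) h ->.
rewrite big_imset /=; last first.
  by move=> s t; rewrite !inE => hs ht; apply: (dash_inj wf).
rewrite (eq_bigl (leafA G)); last by move=> s; rewrite inE.
by apply: eq_bigr => s hs; rewrite (hx _ _ (dA s hs)).
Qed.

(** Slots are sorted here by what occupies them and in [slot_split] by what they hang on. Equating
    the two sums gives the number of leaves, for the constant 1, and the bound on [r], for an
    attribution. *)
Lemma slot_sum (W : nmodType) (x : slot n -> W) : (forall s t, dashed G s t -> x s = x t) ->
  \sum_s x s = \sum_v x (par G v) + (\sum_(s | leafA G s) x s + \sum_(s | leafA G s) x s).
Proof.
move=> hx; rewrite -{1}(leaf_sum hx) (bigID (occupied G)) /=; congr (_ + _).
  rewrite -(big_imset (h := par G) (A := mem predT)) /=; last by move=> u v _ _ /(wf_inj wf).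
  by apply: eq_bigl => s; apply/existsP/imsetP => [[v /eqP <-]|[v _ ->]]; exists v.
by rewrite addrC (bigID (ty G)) /=; congr (_ + _); apply: eq_bigl => s.
Qed.

Lemma slot_split (W : nmodType) (x : slot n -> W) :
  \sum_s x s = x (inl true) + x (inl false) +
    \sum_v (x (inr (v, c0)) + x (inr (v, c1)) + x (inr (v, c2))).
Proof.
rewrite big_sumType /= big_bool /=; congr (_ + _).
rewrite (eq_bigr (fun p => x (inr (p.1, p.2)))); last by case.
rewrite -(pair_bigA _ (fun v c => x (inr (v, c)))) /=; apply: eq_bigr => v _.
rewrite !big_ord_recl big_ord0 addr0 addrA.
by congr (x (inr (v, _)) + x (inr (v, _)) + x (inr (v, _))); apply: val_inj.
Qed.

Lemma card_leaves : #|leaves| = n.+1.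
Proof.
have h := @slot_sum nat (fun _ => 1%N) (fun _ _ _ => erefl).
rewrite slot_split in h.
have e1 : \sum_(s | leafA G s) (1%N : nat) = #|leaves|.
  by rewrite -sum1_card; apply: eq_bigl => s; rewrite inE.
rewrite e1 in h.
have e2 (k : nat) : \sum_(v < n) (k : nat) = (n * k)%N by rewrite sum_nat_const card_ord.
have := e2 1%N; have := e2 3%N.
move: h; rewrite /GRing.add /= => h h3 h1; move: h.
rewrite h1 [X in (2 + X)%N]h3; lia.
Qed.

(** The double count reads 2r + Q = P + 2 SA, where P sums the parent momenta and Q the child
    momenta; conservation bounds e1 by e3 + e4, whence P <= Q. *)
Lemma root_le_leaves (x : slot n -> nat) r : nat_flow r G x ->
  (r <= \sum_(s | leafA G s) x s)%N.
Proof.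
move=> [[x1 x2 x3] _ hr].
pose SA := (\sum_(s | leafA G s) x s)%N; pose P := (\sum_v x (par G v))%N.
pose Q := (\sum_v (x (inr (v, c0)) + x (inr (v, c1)) + x (inr (v, c2))))%N.
have h2 : (x (inl true) + x (inl false) + Q = P + (SA + SA))%N.
  exact: etrans (esym (slot_split x)) (slot_sum x3).
have h1 : (P <= Q)%N.
  apply: leq_sum => v _; have := x2 v; rewrite /GRing.add /=; lia.
by move: h2; rewrite -x1 hr -/SA; move: h1; lia.
Qed.

Definition determines (J : {set slot n}) r := forall x x' : slot n -> nat,
  nat_flow r G x -> nat_flow r G x' -> (forall s, s \in J -> x s = x' s) -> x =1 x'.

(** The difference of two natural flows is a rational flow of root value zero that still respects
    the wavy edges. *)
Lemma determinesP (J : {set slot n}) r :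
  (forall x : slot n -> rat, gflow G x -> x (inl true) = 0 -> (forall s, s \in J -> x s = 0) ->
    (forall v i j, prop_rel G v (i : 'I_4) (j : 'I_4) -> x (endslot G v i) = x (endslot G (mate G v) j)) ->
    forall s, x s = 0) -> determines J r.
Proof.
move=> h x x' [hx mx rx] [hx' mx' rx'] he s.
suff : -1 * (x s)%:R + (x' s)%:R = 0 :> rat.
  by move/eqP; rewrite mulN1r addrC subr_eq0 eqr_nat => /eqP.
apply: (h (fun s => -1 * (x s)%:R + (x' s)%:R)).
- by apply: gflow_lin; apply: gflow_rat.
- by rewrite rx rx' mulN1r addNr.
- by move=> t /he ->; rewrite mulN1r addNr.
- by move=> v i j hr; rewrite (mx _ _ _ hr) (mx' _ _ _ hr).
Qed.

(** The exchange is made with the root momentum as linear form; the constant flow 1 witnesses that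
    this form is not zero. *)
Lemma drop_leaf : exists2 i, i \in leaves &
  forall x : slot n -> rat, gflow G x -> x (inl true) = 0 ->
    (forall s, s \in leaves :\ i -> x s = 0) -> forall s, x s = 0.
Proof.
apply: (@exchange _ (fun x => gflow G x) (fun x => x (inl true)) leaves _ _ _ _ (fun _ => 1)) => //.
- exact: gflow_lin.
- by move=> x hx h; apply: leaf_determined => // s hs; apply: h; rewrite inE.
Qed.

Lemma flow_coords r : exists J : {set slot n}, [/\ J \subset leaves, #|J| = n & determines J r].
Proof.
have [i hi h] := drop_leaf; exists (leaves :\ i); split; first exact: subD1set.
  by have := cardsD1 i leaves; rewrite hi card_leaves => -[].
by apply: determinesP => x h1 h2 h3 _; apply: h.
Qed.

(** A second exchange, among flows of root value zero, with the defect of a violated wavy edge as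
    linear form. *)
Lemma nonredundant_coords r : ~ redundant G ->
  exists J : {set slot n}, [/\ J \subset leaves, #|J|.+1 = n & determines J r].
Proof.
move=> nred.
have [y [hy [v [i [j [hr hne]]]]]] : exists y : slot n -> rat, gflow G y /\ exists v, exists i j : 'I_4,
    prop_rel G v i j /\ y (endslot G v i) != y (endslot G (mate G v) j).
  apply: contrapT => hn; apply: nred => y hy v i j hr; apply/eqP/negPn/negP => hne; apply: hn.
  by exists y; split=> //; exists v, i, j.
have [i0 hi0 h0] := drop_leaf.
(* Subtracting a constant flow makes the root momentum zero and leaves the defect unchanged. *)
pose y0 s := - y (inl true) * 1 + y s.
have [||||||i1 hi1 h1] := @exchange _ (fun x => gflow G x /\ x (inl true) = 0)
   (fun x => x (endslot G v i) - x (endslot G (mate G v) j)) (leaves :\ i0) _ _ _ _ y0.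
- by move=> a x x' [f1 f2] [f3 f4]; split; [apply: gflow_lin|rewrite f2 f4 mulr0 addr0].
- by move=> a x x'; rewrite mulrBr opprD addrACA.
- by move=> x h; rewrite !h subrr.
- by move=> x [f1 f2] h; apply: h0.
- by split; [apply: gflow_lin => //; apply: gflow1|rewrite /y0 mulr1 addNr].
- by rewrite /y0 opprD addrACA subrr add0r subr_eq0.
exists (leaves :\ i0 :\ i1); split.
- exact: subset_trans (subD1set _ _) (subD1set _ _).
- have := cardsD1 i0 leaves; rewrite hi0 card_leaves => -[].
  by rewrite (cardsD1 i1) hi1 => /esym.
apply: determinesP => x f1 f2 f3 f4; apply: h1 => //.
by rewrite (f4 _ _ _ hr) subrr.
Qed.

End Chords.

(** * Counting melonic graphs *)

Section NonCrossing.
Variables (T : eqType) (P : rel T) (beta : T -> bool).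
Implicit Types (x y : T) (l m a b : seq T).

(* [l] carries a non-crossing perfect matching by pairs of [P], whose left
   ends are the letters marked by [beta] *)
Inductive nc : seq T -> Prop :=
| nc_nil : nc [::]
| nc_pair x y a b : P x y -> beta x -> ~~ beta y -> nc a -> nc b -> nc (x :: a ++ y :: b).

Lemma nc_cat a b : nc a -> nc b -> nc (a ++ b).
Proof.
move=> na nb; elim: na => // x y a1 b1 hP hx hy n1 _ _ IH /=.
by rewrite -catA /=; apply: nc_pair.
Qed.

Lemma cat_split (a b c d : seq T) : a ++ b = c ++ d ->
  (exists k, c = a ++ k /\ b = k ++ d) \/ (exists k, a = c ++ k /\ d = k ++ b).
Proof.
elim: a c => [|x a IH] [|y c] /=; first by move=> ->; left; exists [::].
- by move=> ->; left; exists (y :: c).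
- by move=> <-; right; exists (x :: a).
by case=> -> /IH [] [k [-> ->]]; [left|right]; exists k.
Qed.

(** Wherever the word is cut, the new factor falls inside a block or between two blocks. Needed for
    insertions on a solid edge, whose new letters appear between old ones instead of replacing
    some. *)
Lemma nc_insert a b c : nc (a ++ b) -> nc c -> nc (a ++ c ++ b).
Proof.
move=> h nC; move e: (a ++ b) h => l h; elim: h a b e => [|x y a1 b1 hP hx hy n1 IH1 n2 IH2] a b.
  by case: a => // /= ->; rewrite cats0.
case: a => [|x' a] /=; first by move=> ->; apply: nc_cat => //; apply: nc_pair.
case=> -> /cat_split [] [k].
  move=> [e1 e2]; rewrite e2.
  have -> : a ++ c ++ k ++ y :: b1 = (a ++ c ++ k) ++ y :: b1 by rewrite -!catA.
  by apply: nc_pair => //; apply: IH1.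
move=> [e1]; case: k e1 => [|y' k] /= e1.
  move=> e2; rewrite -e2 e1 cats0.
  have -> : a1 ++ c ++ y :: b1 = (a1 ++ c) ++ y :: b1 by rewrite -catA.
  by apply: nc_pair => //; apply: nc_cat.
case=> ey e2; rewrite e1 -ey -catA /=.
by apply: nc_pair => //; apply: IH2.
Qed.

Lemma nc_wrap x y m : P x y -> beta x -> ~~ beta y -> nc m -> nc (x :: m ++ [:: y]).
Proof. by move=> h1 h2 h3 h4; apply: nc_pair => //; apply: nc_nil. Qed.

(** A stack machine that reads the matching off the word: left ends are pushed, and a right end pops
    its partner. The result depends on [beta] but not on [P]. *)
Fixpoint run l st : seq (T * T) :=
  match l with
  | [::] => [::]
  | x :: l' => if beta x then run l' (x :: st)
               else if st is y :: st' then (y, x) :: run l' st' else [::]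
  end.

Lemma nc_run l : nc l -> forall rest st, exists ps, [/\ run (l ++ rest) st = ps ++ run rest st,
  forall xy, xy \in ps -> P xy.1 xy.2 &
  forall x, x \in l -> exists2 xy, xy \in ps & x = xy.1 \/ x = xy.2].
Proof.
elim=> [|x y a b hP hx hy _ IHa _ IHb] rest st; first by exists [::].
have [pb [eb hb cb]] := IHb rest st.
have [pa [ea ha ca]] := IHa (y :: b ++ rest) (x :: st).
exists (pa ++ (x, y) :: pb); split.
- by rewrite /= hx -catA /= ea /= (negbTE hy) eb -catA.
- by move=> xy; rewrite mem_cat inE => /or3P[/ha|/eqP ->|/hb].
move=> z; rewrite inE mem_cat inE => /or4P[/eqP ->|/ca [xy h1 h2]|/eqP ->|/cb [xy h1 h2]].
- by exists (x, y); [rewrite mem_cat inE eqxx orbT|left].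
- by exists xy => //; rewrite mem_cat h1.
- by exists (x, y); [rewrite mem_cat inE eqxx orbT|right].
- by exists xy => //; rewrite mem_cat inE h1 !orbT.
Qed.

End NonCrossing.

Lemma nc_subst (T T' : eqType) (P : rel T) (P' : rel T') beta beta' (sub : T -> seq T') l :
  nc P beta l ->
  (forall x y m, P x y -> beta x -> ~~ beta y -> nc P' beta' m -> nc P' beta' (sub x ++ m ++ sub y)) ->
  nc P' beta' (flatten (map sub l)).
Proof.
move=> h hs; elim: h => [|x y a b hP hx hy _ IHa _ IHb]; first exact: nc_nil.
rewrite /= map_cat flatten_cat /= [_ ++ sub y ++ _]catA [sub x ++ _ ++ _]catA.
by apply: nc_cat => //; apply: hs.
Qed.

(** * Contour words of trees *)

Section Contour.
Variable n : nat.
Notation letter := (slot n + 'I_n)%type.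
Variables (pa : 'I_n -> slot n) (ord : 'I_n -> 4.-tuple 'I_4).

Definition part (ls : 'I_3 -> seq letter) (v : 'I_n) (i : 'I_4) : seq letter :=
  if unlift ord0 i is Some c then ls c else [:: inr v].

(* contour word of the subtree at a slot, [ord v] being the order in which
   [v] itself (index 0) and its three children are listed *)
Inductive contour : slot n -> seq letter -> Prop :=
| contour_leaf s : (forall v, pa v != s) -> contour s [:: inl s]
| contour_node v ls : (forall c, contour (inr (v, c)) (ls c)) ->
    contour (pa v) (flatten [seq part ls v i | i <- ord v]).

Lemma part0 ls v : part ls v ord0 = [:: inr v].
Proof. by rewrite /part unlift_none. Qed.
Lemma partS ls v c : part ls v (lift ord0 c) = ls c.
Proof. by rewrite /part liftK. Qed.

Hypothesis pa_inj : injective pa.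

Lemma contour_fun s l l' : contour s l -> contour s l' -> l = l'.
Proof.
move=> h; elim: h l' => {s l} [s hs|v ls _ IH] l' h'.
  by case: h' hs => // v ls _ hs; have := hs v; rewrite eqxx.
move e: (pa v) h' => s h'; case: h' e => [{}s hs e|v' ls' h' /pa_inj e].
  by have := hs v; rewrite e eqxx.
rewrite -e in h' *; congr flatten; apply: eq_map => i; rewrite /part.
by case: (unlift _ _) => // c; apply: IH.
Qed.

Lemma contour_nodeE v l : contour (pa v) l ->
  exists2 ls, forall c, contour (inr (v, c)) (ls c) & l = flatten [seq part ls v i | i <- ord v].
Proof.
move e: (pa v) => s h; case: h e => [{}s hs e|v' ls' h' /pa_inj ->]; last by exists ls'.
by have := hs v; rewrite e eqxx.
Qed.

Lemma contour_leafE s l : (forall v, pa v != s) -> contour s l -> l = [:: inl s].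
Proof. by move=> hs h; case: h hs => // v ls _ hs; have := hs v; rewrite eqxx. Qed.

Hypothesis ord_full : forall v i, i \in ord v.

Lemma mem_part ls v i x : x \in part ls v i -> x \in flatten [seq part ls v i | i <- ord v].
Proof. by move=> h; apply/flatten_mapP; exists i => //; apply: ord_full. Qed.

Lemma contour_cover l1 l2 : acyclic pa ->
  contour (inl true) l1 -> contour (inl false) l2 ->
  (forall v, inr v \in l1 ++ l2) /\ (forall s, (forall v, pa v != s) -> inl s \in l1 ++ l2).
Proof.
move=> [d hd] h1 h2.
have root b : exists2 l, contour (inl b) l & {subset l <= l1 ++ l2}.
  by case: b; [exists l1|exists l2] => // x hx; rewrite mem_cat hx ?orbT.
have key : forall k v, d v < k -> exists2 l, contour (pa v) l & {subset l <= l1 ++ l2}.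
  elim=> // k IH v hv; case e: (pa v) => [b|[u c]]; first exact: root.
  have [|l /contour_nodeE [ls hls el] hsub] := IH u.
    by rewrite -ltnS; apply: leq_trans hv; apply: hd e.
  exists (ls c) => // x hx; apply: hsub; rewrite el; apply: (@mem_part _ _ (lift ord0 c)).
  by rewrite partS.
split=> [v|s hs].
  have [l /contour_nodeE [ls hls el] hsub] := key _ v (ltnSn _).
  by apply: hsub; rewrite el; apply: (@mem_part _ _ ord0); rewrite part0 inE.
case: s hs => [b|[u c]] hs.
  have [l hl hsub] := root b; apply: hsub.
  by rewrite (contour_leafE hs hl) inE.
have [l /contour_nodeE [ls hls el] hsub] := key _ u (ltnSn _).
apply: hsub; rewrite el; apply: (@mem_part _ _ (lift ord0 c)); rewrite partS.
by rewrite (contour_leafE hs (hls c)) inE.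
Qed.

End Contour.

(** * Planarity of melonic graphs *)

Section Planar.

Definition partner n (G : graph n) : rel (slot n + 'I_n) := fun x y =>
  match x, y with
  | inl s, inl t => dashed G s t
  | inr u, inr v => mate G u == v
  | _, _ => false
  end.

Definition planar n (G : graph n) := exists (ord : 'I_n -> 4.-tuple 'I_4) (beta : slot n + 'I_n -> bool) l1 l2,
  [/\ forall v i, i \in ord v, contour (par G) ord (inl true) l1,
      contour (par G) ord (inl false) l2 & nc (partner G) beta (l1 ++ l2)].

Lemma planar_triv : planar triv.
Proof.
exists (fun _ => [tuple ord0; ord0; ord0; ord0]),
  (fun x => x == inl (inl true)), [:: inl (inl true)], [:: inl (inl false)]; split.
- by case.
- by apply: contour_leaf => -[].
- by apply: contour_leaf => -[].
apply: (@nc_pair _ _ _ _ _ [::] [::]); try exact: nc_nil; rewrite ?eqxx //.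
have [|t ht] := dashed_tot triv_wf (s := inl true); first by apply/existsP => -[[]].
by have := dashed_neq triv_wf ht; case: t ht => [[]|[[]]].
Qed.

Lemma flatten_map_flatten (T T' : Type) (f : T -> seq T') ss :
  flatten (map f (flatten ss)) = flatten [seq flatten (map f s) | s <- ss].
Proof. by elim: ss => //= s ss IH; rewrite map_cat flatten_cat IH. Qed.

Lemma planar_iso n (G0 G : graph n) : planar G0 -> iso G0 G -> planar G.
Proof.
move=> [ord [beta [l1 [l2 [ho h1 h2 hn]]]]] /iso_byP [k [k1 k2 k3 k4]].
pose kl (x : slot n + 'I_n) : slot n + 'I_n :=
  match x with inl s => inl (map_slot k s) | inr v => inr (k v) end.
pose kV (x : slot n + 'I_n) : slot n + 'I_n :=
  match x with inl s => inl (map_slot (k^-1)%g s) | inr v => inr ((k^-1)%g v) end.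
have klK x : kV (kl x) = x by case: x => [s|v] /=; rewrite ?map_slot_permK ?permK.
have ct s l : contour (par G0) ord s l -> contour (par G) (fun v => ord ((k^-1)%g v)) (map_slot k s) (map kl l).
  elim=> {s l} [s hs|v ls _ IH].
    apply: contour_leaf => v; apply/eqP => e; have /eqP := hs ((k^-1)%g v); apply.
    by apply: (can_inj (map_slot_permK k)); rewrite -k1 permKV.
  rewrite -k1; have -> : map kl (flatten [seq part ls v i | i <- ord v]) =
      flatten [seq part (fun c => map kl (ls c)) (k v) i | i <- ord ((k^-1)%g (k v))].
    rewrite permK map_flatten -map_comp; congr flatten; apply: eq_map => i /=.
    by rewrite /part; case: (unlift _ _).
  by apply: contour_node => c; apply: (IH c).
exists (fun v => ord ((k^-1)%g v)), (beta \o kV), (map kl l1), (map kl l2); split.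
- by move=> v i; apply: ho.
- exact: (ct (inl true)).
- exact: (ct (inl false)).
rewrite -map_cat -[map kl _]flatten_seq1 -map_comp; apply: (nc_subst hn) => x y m hP hx hy hm /=.
apply: nc_wrap => //=; rewrite ?klK //.
by case: x y hP {hx hy} => [s|u] [t|v] //=; rewrite -?k2 // k3 => /eqP ->.
Qed.

End Planar.

Section PlanarInsert.
Variable n : nat.
Local Notation A := (newA n).
Local Notation B := (newB n).
Variables (G : graph n) (H : graph n.+2).
Hypothesis wH : wf_graph H.
Hypothesis mAB : mate H A = B.
Hypothesis mBA : mate H B = A.
Hypothesis mup : forall u, mate H (up u) = up (mate G u).
Local Notation letter := (slot n + 'I_n)%type.
Local Notation letter' := (slot n.+2 + 'I_n.+2)%type.

Definition upl (x : letter) : letter' := match x with inl s => inl (up_slot s) | inr v => inr (up v) end.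

Definition ext_ord (ord : 'I_n -> 4.-tuple 'I_4) oA oB (w : 'I_n.+2) : 4.-tuple 'I_4 :=
  if old w is Some u then ord u else if w == A then oA else oB.

Definition ext_beta (beta : letter -> bool) (bA bB : 'I_3 -> bool) (vA vB : bool) (x : letter') : bool :=
  match x with
  | inl s => extv bA bB (fun s => beta (inl s)) s
  | inr w => if old w is Some u then beta (inr u) else if w == A then vA else vB
  end.

Lemma ext_ord_up ord oA oB u : ext_ord ord oA oB (up u) = ord u.
Proof. by rewrite /ext_ord old_up. Qed.
Lemma ext_ord_A ord oA oB : ext_ord ord oA oB A = oA.
Proof. by rewrite /ext_ord old_newA eqxx. Qed.
Lemma ext_ord_B ord oA oB : ext_ord ord oA oB B = oB.
Proof. by rewrite /ext_ord old_newB eq_sym (negbTE (newAB n)). Qed.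

Lemma ext_beta_up beta bA bB vA vB x : ext_beta beta bA bB vA vB (upl x) = beta x.
Proof. by case: x => [s|u] /=; rewrite ?extv_up ?old_up. Qed.
Lemma ext_beta_vA beta bA bB vA vB : ext_beta beta bA bB vA vB (inr A) = vA.
Proof. by rewrite /= old_newA eqxx. Qed.
Lemma ext_beta_vB beta bA bB vA vB : ext_beta beta bA bB vA vB (inr B) = vB.
Proof. by rewrite /= old_newB eq_sym (negbTE (newAB n)). Qed.
Lemma ext_beta_A beta bA bB vA vB c : ext_beta beta bA bB vA vB (inl (inr (A, c))) = bA c.
Proof. exact: extv_A. Qed.
Lemma ext_beta_B beta bA bB vA vB c : ext_beta beta bA bB vA vB (inl (inr (B, c))) = bB c.
Proof. exact: extv_B. Qed.

Definition tuple4 (i j k l : 'I_4) : 4.-tuple 'I_4 := [tuple i; j; k; l].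

Lemma contour_new (ord : 'I_n.+2 -> 4.-tuple 'I_4) w i j k l ls word :
  ord w = tuple4 i j k l -> (forall c, contour (par H) ord (inr (w, c)) (ls c)) ->
  word = part ls w i ++ part ls w j ++ part ls w k ++ part ls w l ->
  contour (par H) ord (par H w) word.
Proof.
by move=> e h ->; have := contour_node h; rewrite e /= cats0.
Qed.

Lemma leaf_contour ord s t : dashed H s t -> contour (par H) ord s [:: inl s].
Proof.
move=> h; apply: contour_leaf => v; have [h1 _ _] := dashed_leaf wH h.
by apply: contra h1 => h1; apply/existsP; exists v.
Qed.

Lemma contour_subst ord ord' (sub : letter -> seq letter') :
  (forall u, par H (up u) = up_slot (par G u)) -> (forall u, ord' (up u) = ord u) ->
  (forall u, sub (inr u) = [:: inr (up u)]) ->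
  (forall s, (forall v, par G v != s) -> contour (par H) ord' (up_slot s) (sub (inl s))) ->
  forall s l, contour (par G) ord s l -> contour (par H) ord' (up_slot s) (flatten (map sub l)).
Proof.
move=> hp ho hr hl s l; elim=> {s l} [s hs|v ls _ IH]; first by rewrite /= cats0; apply: hl.
rewrite -hp flatten_map_flatten -map_comp.
have -> : [seq ((fun s => flatten [seq sub i | i <- s]) \o part ls v) i | i <- ord v] =
   [seq part (fun c => flatten (map sub (ls c))) (up v) i | i <- ord' (up v)].
  rewrite ho; apply: eq_map => i /=; rewrite /part.
  by case: (unlift _ _) => //=; rewrite cats0 hr.
by apply: contour_node => c; apply: (IH c).
Qed.

Lemma ext_full ord oA oB : (forall v i, i \in ord v) -> (forall i, i \in oA) -> (forall i, i \in oB) ->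
  forall w i, i \in ext_ord ord oA oB w.
Proof.
move=> h hA hB w i; case: (oldP w) => [u ->|->|->]; rewrite ?ext_ord_up ?ext_ord_A ?ext_ord_B //.
Qed.

Definition lf (c : 'I_3) : 'I_4 := lift ord0 c.

Lemma full4 i j k : (forall c : 'I_3, [|| c == i, c == j | c == k]) ->
  forall e, (e \in tuple4 ord0 (lf i) (lf j) (lf k)) /\ (e \in tuple4 (lf i) ord0 (lf j) (lf k))
     /\ (e \in tuple4 (lf i) (lf j) (lf k) ord0).
Proof.
move=> h e; have : (e == ord0) || [|| e == lf i, e == lf j | e == lf k].
  by case: (I4P e) => [->|[c ->]]; rewrite ?eqxx // !(inj_eq lift_inj) h orbT.
by rewrite !inE => /or4P[] ->; rewrite ?orbT.
Qed.

Lemma partner_up x y : (forall s t, dashed G s t -> dashed H (up_slot s) (up_slot t)) ->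
  partner G x y -> partner H (upl x) (upl y).
Proof.
move=> h; case: x y => [s|u] [t|v] //=; first exact: h.
by rewrite mup => /eqP ->.
Qed.

(** Insertion on a dashed edge substitutes the words [X] and [Y] for the letters of its two ends.
    Either end may come first in the contour, so both nestings are required. *)
Lemma planar_join (x y : slot n) (X Y : seq letter') ord ord' beta beta' l1 l2 :
  (forall u, par H (up u) = up_slot (par G u)) -> wf_graph G -> dashed G x y ->
  (forall s t, dashed G s t -> s != x -> s != y -> dashed H (up_slot s) (up_slot t)) ->
  (forall s v, (forall u, par G u != s) -> s != x -> s != y -> par H v != up_slot s) ->
  (forall w i, i \in ord' w) -> (forall u, ord' (up u) = ord u) ->
  (forall e, beta' (upl e) = beta e) ->
  contour (par H) ord' (up_slot x) X -> contour (par H) ord' (up_slot y) Y ->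
  (forall m, nc (partner H) beta' m -> beta (inl x) -> ~~ beta (inl y) ->
     nc (partner H) beta' (X ++ m ++ Y)) ->
  (forall m, nc (partner H) beta' m -> beta (inl y) -> ~~ beta (inl x) ->
     nc (partner H) beta' (Y ++ m ++ X)) ->
  contour (par G) ord (inl true) l1 -> contour (par G) ord (inl false) l2 ->
  nc (partner G) beta (l1 ++ l2) -> planar H.
Proof.
move=> hp wG hxy hd hleaf ho hou hbu hX hY XY YX h1 h2 hn.
pose sub (e : letter) : seq letter' :=
  if e == inl x then X else if e == inl y then Y else [:: upl e].
have xy : y != x by rewrite eq_sym; apply: dashed_neq wG _ _ hxy.
have hyx : dashed G y x by rewrite dashed_sym.
have sb : forall s l, contour (par G) ord s l -> contour (par H) ord' (up_slot s) (flatten (map sub l)).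
  apply: contour_subst => // s hs; rewrite /sub.
  case: eqP => [[->] //|sx]; case: eqP => [[->] //|sy]; apply: contour_leaf => v.
  by apply: hleaf => //; apply/eqP => e; [apply: sx|apply: sy]; rewrite e.
exists ord', beta', (flatten (map sub l1)), (flatten (map sub l2)); split=> //.
- exact: sb (inl true) _ h1.
- exact: sb (inl false) _ h2.
rewrite -flatten_cat -map_cat; apply: (nc_subst hn) => e f m hP be bf hm.
have subx : sub (inl x) = X by rewrite /sub eqxx.
have suby : sub (inl y) = Y.
  by rewrite /sub eqxx ifN //; apply/eqP => -[] /eqP; rewrite (negbTE xy).
case: (e =P inl x) => [ex|nex].
  rewrite ex in hP be *; case: f hP bf => // t /= ht bt.
  by rewrite (dashed_fun wG ht hxy) in bt *; rewrite subx suby; apply: XY.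
case: (e =P inl y) => [ey|ney].
  rewrite ey in hP be *; case: f hP bf => // t /= ht bt.
  by rewrite (dashed_fun wG ht hyx) in bt *; rewrite subx suby; apply: YX.
have se : sub e = [:: upl e] by rewrite /sub !ifN //; apply/eqP.
have sf : sub f = [:: upl f].
  rewrite /sub !ifN //; apply/eqP => ef; rewrite ef in hP; case: (e) hP nex ney => // s /= hs nx ny.
    by apply: nx; congr inl; apply: (dashed_fun wG _ hyx); rewrite dashed_sym.
  by apply: ny; congr inl; apply: (dashed_fun wG _ hxy); rewrite dashed_sym.
rewrite se sf; apply: nc_wrap => //; rewrite ?hbu //.
case: e f hP nex ney {se sf be bf} => [s|u] [t|v] //=; last by rewrite mup => /eqP ->.
by move=> hst nx ny; apply: hd => //; apply/eqP => e; [apply: nx|apply: ny]; rewrite e.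
Qed.

(** The children of [newB] are listed in the mirror order of those of [newA], so that the four new
    pairs are nested whichever vertex comes first. *)
Lemma planar_side (x y : slot n) (c3 c4 : 'I_3) :
  (forall c : 'I_3, [|| c == c0, c == c3 | c == c4]) ->
  (forall u, par H (up u) = up_slot (par G u)) ->
  par H A = up_slot x -> par H B = up_slot y -> dashed G x y -> wf_graph G ->
  dashed H (inr (A, c0)) (inr (B, c0)) -> dashed H (inr (A, c1)) (inr (B, c3)) ->
  dashed H (inr (A, c2)) (inr (B, c4)) ->
  (forall s t, dashed G s t -> s != x -> s != y -> dashed H (up_slot s) (up_slot t)) ->
  planar G -> planar H.
Proof.
move=> hc hp hA hB hxy wG d0 d1 d2 hd [ord [beta [l1 [l2 [ho h1 h2 hn]]]]].
pose b := beta (inl x).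
pose ord' := ext_ord ord (tuple4 ord0 (lf c0) (lf c1) (lf c2)) (tuple4 (lf c4) (lf c3) (lf c0) ord0).
pose beta' := ext_beta beta (fun _ => b) (fun _ => ~~ b) b (~~ b).
pose X : seq letter' := [:: inr A; inl (inr (A, c0)); inl (inr (A, c1)); inl (inr (A, c2))].
pose Y : seq letter' := [:: inl (inr (B, c4)); inl (inr (B, c3)); inl (inr (B, c0)); inr B].
have dS s t : dashed H s t -> dashed H t s by rewrite dashed_sym.
apply: (@planar_join x y X Y ord ord' beta beta' l1 l2) => //.
- move=> s v hs sx sy; case: (oldP v) => [u ->|->|->].
  + by rewrite hp (inj_eq (@up_slot_inj n)).
  + by rewrite hA (inj_eq (@up_slot_inj n)) eq_sym.
  + by rewrite hB (inj_eq (@up_slot_inj n)) eq_sym.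
- apply: ext_full => // i; first by have [] := full4 (i := c0) (j := c1) (k := c2) _ i => // c; case: (I3P c) => ->.
  have [|_ [_ h]] := @full4 c4 c3 c0 _ i; last exact: h.
  by move=> c; have := hc c; rewrite orbC -orbA orbCA.
- by move=> u; apply: ext_ord_up.
- by move=> e; apply: ext_beta_up.
- rewrite -hA; apply: (@contour_new ord' A ord0 (lf c0) (lf c1) (lf c2) (fun c => [:: inl (inr (A, c))])).
  + exact: ext_ord_A.
  + by move=> c; case: (I3P c) => ->; [apply: leaf_contour d0|apply: leaf_contour d1|apply: leaf_contour d2].
  + by rewrite part0 !partS.
- rewrite -hB; apply: (@contour_new ord' B (lf c4) (lf c3) (lf c0) ord0 (fun c => [:: inl (inr (B, c))])).
  + exact: ext_ord_B.
  + move=> c; have /or3P[] := hc c => /eqP ->.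
    * exact: leaf_contour (dS _ _ d0).
    * exact: leaf_contour (dS _ _ d1).
    * exact: leaf_contour (dS _ _ d2).
  + by rewrite part0 !partS.
- move=> m hm hb _; have -> : X ++ m ++ Y = inr A :: (inl (inr (A, c0)) :: (inl (inr (A, c1)) :: (inl (inr (A, c2)) ::
     m ++ [:: inl (inr (B, c4))]) ++ [:: inl (inr (B, c3))]) ++ [:: inl (inr (B, c0))]) ++ [:: inr B].
    by rewrite /X /Y /= -!catA.
  do 4! (apply: nc_wrap; [by rewrite /= ?mAB|by rewrite /beta' ?ext_beta_vA ?ext_beta_vB ?ext_beta_A ?ext_beta_B|
    by rewrite /beta' ?ext_beta_vA ?ext_beta_vB ?ext_beta_A ?ext_beta_B /b ?hb|]).
  exact: hm.
- move=> m hm _ hb; have -> : Y ++ m ++ X = inl (inr (B, c4)) :: (inl (inr (B, c3)) :: (inl (inr (B, c0)) :: (inr B ::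
     m ++ [:: inr A]) ++ [:: inl (inr (A, c0))]) ++ [:: inl (inr (A, c1))]) ++ [:: inl (inr (A, c2))].
    by rewrite /X /Y /= -!catA.
  do 4! (apply: nc_wrap; [by rewrite /= ?mBA // dashed_sym|
    by rewrite /beta' ?ext_beta_vA ?ext_beta_vB ?ext_beta_A ?ext_beta_B|
    by rewrite /beta' ?ext_beta_vA ?ext_beta_vB ?ext_beta_A ?ext_beta_B|]).
  exact: hm.
Qed.

End PlanarInsert.

Section PlanarNested.
Variable n : nat.
Local Notation A := (newA n).
Local Notation B := (newB n).
Variables (G : graph n) (H : graph n.+2).
Hypothesis wH : wf_graph H.
Hypothesis mAB : mate H A = B.
Hypothesis mup : forall u, mate H (up u) = up (mate G u).
Variables (z : slot n) (p a r p' q r' : 'I_3).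
Hypothesis hA3 : forall c : 'I_3, [|| c == p, c == a | c == r].
Hypothesis hB3 : forall c : 'I_3, [|| c == p', c == q | c == r'].
Hypothesis distinct : [&& p != a, r != a, r != p, q != p', r' != p' & r' != q].
Hypothesis pA : par H A = up_slot z.
Hypothesis pB : par H B = inr (A, a).
Hypothesis dp : dashed H (inr (A, p)) (inr (B, p')).
Hypothesis dr : dashed H (inr (A, r)) (inr (B, r')).
Local Notation letter := (slot n + 'I_n)%type.
Local Notation letter' := (slot n.+2 + 'I_n.+2)%type.

(** [newB] hangs at the child [a] of [newA]; the other children [p] and [r] are joined to [p'] and
    [r'], and [q] carries on the old edge. With the orders [oA] and [oB], the contour at [z] is the
    contour at [q] between [pre] and [post], each of which is matched within itself. *)
Let pre : seq letter' := [:: inl (inr (A, p)); inr A; inr B; inl (inr (B, p'))].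
Let post : seq letter' := [:: inl (inr (B, r')); inl (inr (A, r))].
Let oA := tuple4 (lf p) ord0 (lf a) (lf r).
Let oB := tuple4 ord0 (lf p') (lf q) (lf r').
Let bA (c : 'I_3) := c == p.
Let bB b (c : 'I_3) := if c == p' then false else if c == q then b else true.

Lemma nested_nc (beta : letter -> bool) b (beta' := ext_beta beta bA (bB b) true false) :
  nc (partner H) beta' pre /\ nc (partner H) beta' post.
Proof.
have /and5P[d1 d2 d3 d4 /andP[d5 d6]] := distinct; split.
  have -> : pre = inl (inr (A, p)) :: [:: inr A; inr B] ++ [:: inl (inr (B, p'))] by [].
  apply: nc_wrap; rewrite // ?/beta' ?ext_beta_A ?ext_beta_B /bA /bB ?eqxx //.
  apply: (@nc_wrap _ _ _ _ _ [::]); rewrite ?/beta' ?ext_beta_vA ?ext_beta_vB /= ?mAB ?eqxx //.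
  exact: nc_nil.
apply: (@nc_wrap _ _ _ _ _ [::]); rewrite ?/beta' ?ext_beta_A ?ext_beta_B /bA /bB.
- by rewrite /= dashed_sym.
- by rewrite (negbTE d5) (negbTE d6).
- exact: d3.
- exact: nc_nil.
Qed.

Lemma nested_contour (ord : 'I_n -> 4.-tuple 'I_4) lq :
  contour (par H) (ext_ord ord oA oB) (inr (B, q)) lq ->
  contour (par H) (ext_ord ord oA oB) (up_slot z) (pre ++ lq ++ post).
Proof.
have /and5P[d1 d2 d3 d4 /andP[d5 d6]] := distinct; move=> hq.
have hB : contour (par H) (ext_ord ord oA oB) (inr (A, a))
    (inr B :: inl (inr (B, p')) :: lq ++ [:: inl (inr (B, r'))]).
  rewrite -pB; apply: (@contour_new _ H _ _ ord0 (lf p') (lf q) (lf r')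
    (fun c => if c == q then lq else [:: inl (inr (B, c))])).
  - exact: ext_ord_B.
  - move=> c; case: eqP => [->|/eqP cq] //.
    have /or3P[/eqP ->|cq'|/eqP ->] := hB3 c.
    + by apply: (@leaf_contour _ H wH _ _ (inr (A, p))); rewrite dashed_sym.
    + by rewrite cq' in cq.
    + by apply: (@leaf_contour _ H wH _ _ (inr (A, r))); rewrite dashed_sym.
  - by rewrite part0 !partS eqxx (negbTE d6) [p' == q]eq_sym (negbTE d4).
rewrite -pA; apply: (@contour_new _ H _ _ (lf p) ord0 (lf a) (lf r)
    (fun c => if c == a then (inr B :: inl (inr (B, p')) :: lq ++ [:: inl (inr (B, r'))])
              else [:: inl (inr (A, c))])).
- exact: ext_ord_A.
- move=> c; case: eqP => [->|/eqP ca] //.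
  have /or3P[/eqP ->|ca'|/eqP ->] := hA3 c.
  + exact: (@leaf_contour _ H wH _ _ _ dp).
  + by rewrite ca' in ca.
  + exact: (@leaf_contour _ H wH _ _ _ dr).
- by rewrite part0 !partS eqxx (negbTE d1) (negbTE d2) /= -!catA.
Qed.

Lemma nested_full (ord : 'I_n -> 4.-tuple 'I_4) : (forall v i, i \in ord v) -> forall w i, i \in ext_ord ord oA oB w.
Proof.
move=> ho; apply: ext_full => // i.
  by have [_ []] := full4 hA3 i.
by have [] := full4 hB3 i.
Qed.

Lemma planar_nested_dashed (y : slot n) :
  (forall u, par H (up u) = up_slot (par G u)) -> dashed G z y -> wf_graph G ->
  dashed H (inr (B, q)) (up_slot y) ->
  (forall s t, dashed G s t -> s != z -> s != y -> dashed H (up_slot s) (up_slot t)) ->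
  planar G -> planar H.
Proof.
move=> hp hzy wG dq hd [ord [beta [l1 [l2 [ho h1 h2 hn]]]]].
pose b := beta (inl z); pose ord' := ext_ord ord oA oB.
pose beta' := ext_beta beta bA (bB b) true false.
have /and5P[d1 d2 d3 d4 /andP[d5 d6]] := distinct.
pose X := pre ++ [:: inl (inr (B, q))] ++ post.
have [npre npost] := nested_nc beta b.
have bq : beta' (inl (inr (B, q))) = b by rewrite /beta' ext_beta_B /bB (negbTE d4) eqxx.
have by_ : beta' (inl (up_slot y)) = beta (inl y) := ext_beta_up beta _ _ _ _ (inl y).
apply: (@planar_join _ G H mup z y X [:: inl (up_slot y)] ord ord' beta beta' l1 l2) => //.
- move=> s v hs sz _; case: (oldP v) => [u ->|->|->].
  + by rewrite hp (inj_eq (@up_slot_inj n)).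
  + by rewrite pA (inj_eq (@up_slot_inj n)) eq_sym.
  + by rewrite pB eq_sym up_slotA.
- exact: nested_full.
- by move=> u; apply: ext_ord_up.
- by move=> e; apply: ext_beta_up.
- by apply: nested_contour; exact: (@leaf_contour _ H wH _ _ _ dq).
- by apply: (@leaf_contour _ H wH _ _ (inr (B, q))); rewrite dashed_sym.
- move=> m hm hz hy; rewrite /X -!catA; apply: nc_cat => //.
  rewrite [_ ++ _](_ : _ = inl (inr (B, q)) :: (post ++ m) ++ [:: inl (up_slot y)]); last by rewrite /= -?catA.
  by apply: nc_wrap; rewrite ?bq ?by_ //; apply: nc_cat.
move=> m hm hy hz; rewrite /X.
rewrite [_ ++ _](_ : _ = (inl (up_slot y) :: (m ++ pre) ++ [:: inl (inr (B, q))]) ++ post); last by rewrite /= -!catA.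
apply: nc_cat => //; apply: nc_wrap; rewrite ?bq ?by_ //; first by rewrite /= dashed_sym.
exact: nc_cat.
Qed.

Lemma planar_nested_solid (w : 'I_n) :
  (forall u, u != w -> par H (up u) = up_slot (par G u)) ->
  par G w = z -> par H (up w) = inr (B, q) -> wf_graph G ->
  (forall s t, dashed G s t -> dashed H (up_slot s) (up_slot t)) ->
  planar G -> planar H.
Proof.
move=> hp hz hw wG hd [ord [beta [l1 [l2 [ho h1 h2 hn]]]]].
pose ord' := ext_ord ord oA oB.
pose beta' := ext_beta beta bA (bB true) true false.
have [npre npost] := nested_nc beta true.
(* No letter stands for a solid edge, so substitution does not apply. Instead, [insd l l'] says that
   putting [l'] for the lifted [l] keeps any surrounding word matched; it is stable under
   concatenation and hence climbs the tree. *)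
pose insd (l : seq letter) (l' : seq letter') := forall x y : seq letter',
  nc (partner H) beta' (x ++ map (@upl n) l ++ y) -> nc (partner H) beta' (x ++ l' ++ y).
have insd_cat l l' m m' : insd l l' -> insd m m' -> insd (l ++ m) (l' ++ m').
  move=> i1 i2 x y; rewrite map_cat -!catA => /i1.
  by rewrite [x ++ _]catA => /i2; rewrite -!catA.
have sb s l : contour (par G) ord s l -> exists2 l', contour (par H) ord' (up_slot s) l' & insd l l'.
  elim=> {s l} [s hs|v ls _ IH].
    exists [:: inl (up_slot s)]; last by [].
    apply: contour_leaf => v; case: (oldP v) => [u ->|->|->].
    - case: (u =P w) => [->|/eqP uw]; first by rewrite hw eq_sym up_slotB.
      by rewrite hp // (inj_eq (@up_slot_inj n)).
    - by rewrite pA (inj_eq (@up_slot_inj n)) -hz.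
    - by rewrite pB eq_sym up_slotA.
  have [ls' hls'] : exists ls', forall c, contour (par H) ord' (inr (up v, c)) (ls' c) /\ insd (ls c) (ls' c).
    have [m0 k0 j0] := IH c0; have [m1 k1 j1] := IH c1; have [m2 k2 j2] := IH c2.
    exists (fun c : 'I_3 => if c == c0 then m0 else if c == c1 then m1 else m2) => c.
    by case: (I3P c) => ->.
  have hi : insd (flatten [seq part ls v i | i <- ord v]) (flatten [seq part ls' (up v) i | i <- ord' (up v)]).
    rewrite /ord' ext_ord_up; elim: (tval (ord v)) => //= i o IHo; apply: insd_cat => //.
    by rewrite /part; case: (unlift _ _) => // c; case: (hls' c).
  have hc := contour_node (fun c => (hls' c).1).
  case: (v =P w) => [vw|/eqP vw]; last by exists (flatten [seq part ls' (up v) i | i <- ord' (up v)]); rewrite -?hp.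
  rewrite -vw in hz hw; rewrite hz; rewrite hw in hc.
  exists (pre ++ flatten [seq part ls' (up v) i | i <- ord' (up v)] ++ post).
    exact: nested_contour.
  move=> x y /hi => h; rewrite -!catA; apply: nc_insert; last exact: npre.
  by rewrite [x ++ _]catA; apply: (nc_insert (a := x ++ _)); [rewrite -catA|exact: npost].
have [l1' k1 i1] := sb _ _ h1; have [l2' k2 i2] := sb _ _ h2.
exists ord', beta', l1', l2'; split=> //; first exact: nested_full.
have := insd_cat _ _ _ _ i1 i2 [::] [::]; rewrite /= !cats0; apply.
rewrite -[map (@upl n) _]flatten_seq1 -map_comp; apply: (nc_subst hn) => x y m hP hx hy hm /=.
apply: nc_wrap => //; rewrite /beta' ?ext_beta_up //.
exact: partner_up.
Qed.

End PlanarNested.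

Lemma planar_insertion n (G : graph n) (H : graph n.+2) :
  wf_graph G -> insertion G H -> planar G -> planar H.
Proof.
move=> wG hins; have [l [wH [hm [mAB [mBA _]]]]] := ins_common_insertion hins.
have newd (excl : option (slot n * slot n)) news xy : ins_dashed G H excl news -> xy \in news -> dashed H xy.1 xy.2.
  by move=> hd h; apply/hd; right; exists xy => //; left.
have oldd x y news : ins_dashed G H (Some (x, y)) news ->
    forall s t, dashed G s t -> s != x -> s != y -> dashed H (up_slot s) (up_slot t).
  move=> hd s t h sx sy; apply/hd; left; exists s, t; split=> //; split=> //; split=> //.
  by case=> -[e1 e2]; [case/eqP: sx|case/eqP: sy].
have oldd' news : ins_dashed G H None news -> forall s t, dashed G s t -> dashed H (up_slot s) (up_slot t).
  by move=> hd s t h; apply/hd; left; exists s, t.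
have I3 (P : pred 'I_3) : P c0 && P c1 && P c2 -> forall c, P c.
  by case/andP => /andP[h0 h1] h2 c; case: (I3P c) => ->.
case: (hins) => [[x [y [b [hxy [hp [hA [hB [hd hc]]]]]]]]|].
  move: hd; rewrite /ch inord_c0 inord_c1 inord_c2 ccE ccE' => hd.
  apply: (@planar_side _ G H wH mAB mBA hm x y (cc b) (cc (~~ b))) => //.
  - by apply: I3; case: (b).
  - by apply: (newd _ _ (inr (newA n, c0), inr (newB n, c0)) hd); rewrite !inE eqxx.
  - by apply: (newd _ _ (inr (newA n, c1), inr (newB n, cc b)) hd); rewrite !inE eqxx orbT.
  - by apply: (newd _ _ (inr (newA n, c2), inr (newB n, cc (~~ b))) hd); rewrite !inE eqxx !orbT.
  - exact: oldd hd.
case=> [[z [y [b [hxy [hp [hA [hB [hd hc]]]]]]]]|].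
  move: hd hB; rewrite /ch inord_c0 inord_c1 inord_c2 ccE ccE' => hd hB.
  apply: (@planar_nested_dashed _ G H wH mAB hm z c1 c0 c2 (cc b) c0 (cc (~~ b)) _ _ _ hA hB _ _ y) => //.
  - exact: I3.
  - by apply: I3; case: (b).
  - by case: (b).
  - by apply: (newd _ _ (inr (newA n, c1), inr (newB n, cc b)) hd); rewrite !inE eqxx orbT.
  - by apply: (newd _ _ (inr (newA n, c2), inr (newB n, cc (~~ b))) hd); rewrite !inE eqxx !orbT.
  - by apply: (newd _ _ (inr (newB n, c0), up_slot y) hd); rewrite !inE eqxx.
  - exact: oldd hd.
case=> [[z [y [ba [bc [hxy [hp [hA [hB [hd hc]]]]]]]]]|].
  move: hd hB; rewrite /ch inord_c0 !ccE !ccE' => hd hB.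
  apply: (@planar_nested_dashed _ G H wH mAB hm z c0 (cc ba) (cc (~~ ba)) (cc bc) (cc (~~ bc)) c0 _ _ _ hA hB _ _ y) => //.
  - by apply: I3; case: (ba).
  - by apply: I3; case: (bc).
  - by case: (ba); case: (bc).
  - by apply: (newd _ _ (inr (newA n, c0), inr (newB n, cc bc)) hd); rewrite !inE eqxx.
  - by apply: (newd _ _ (inr (newA n, cc (~~ ba)), inr (newB n, c0)) hd); rewrite !inE eqxx !orbT.
  - by apply: (newd _ _ (inr (newB n, cc (~~ bc)), up_slot y) hd); rewrite !inE eqxx !orbT.
  - exact: oldd hd.
case=> [[w [b [hp [hA [hB [hw [hd hc]]]]]]]|[w [ba [bc [hp [hA [hB [hw [hd hc]]]]]]]]].
  move: hd hB hw; rewrite /ch inord_c0 inord_c1 inord_c2 ccE ccE' => hd hB hw.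
  apply: (@planar_nested_solid _ G H wH mAB hm (par G w) c1 c0 c2 (cc b) c0 (cc (~~ b)) _ _ _ hA hB _ _ w) => //.
  - exact: I3.
  - by apply: I3; case: (b).
  - by case: (b).
  - by apply: (newd _ _ (inr (newA n, c1), inr (newB n, cc b)) hd); rewrite !inE eqxx.
  - by apply: (newd _ _ (inr (newA n, c2), inr (newB n, cc (~~ b))) hd); rewrite !inE eqxx !orbT.
  - exact: oldd' hd.
move: hd hB hw; rewrite /ch inord_c0 !ccE !ccE' => hd hB hw.
apply: (@planar_nested_solid _ G H wH mAB hm (par G w) c0 (cc ba) (cc (~~ ba)) (cc (~~ bc)) (cc bc) c0 _ _ _ hA hB _ _ w) => //.
- by apply: I3; case: (ba).
- by apply: I3; case: (bc).
- by case: (ba); case: (bc).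
- by apply: (newd _ _ (inr (newA n, c0), inr (newB n, cc (~~ bc))) hd); rewrite !inE eqxx.
- by apply: (newd _ _ (inr (newA n, cc (~~ ba)), inr (newB n, c0)) hd); rewrite !inE eqxx !orbT.
- exact: oldd' hd.
Qed.

Lemma planar_mel n (G : graph n) : mel G -> planar G.
Proof.
elim=> [|m G0 G1 m0 pl ins]; first exact: planar_triv.
exact: planar_insertion (mel_wf m0) ins pl.
Qed.

Lemma planar_melonic n (G : graph n) : melonic G -> planar G.
Proof. by move=> [G0 [/planar_mel h1 h2]]; apply: planar_iso h1 h2. Qed.

(** * Codes of planar graphs *)

Section Code.
Variable n : nat.
Notation letter := (slot n + 'I_n)%type.
Implicit Types G : graph n.

Definition code : finType :=
  ({ffun 'I_n -> slot n} * ({ffun 'I_n -> 4.-tuple 'I_4} * {ffun letter -> bool} * {ffun 'I_n -> 'I_8}))%type.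

Definition encodes G (cd : code) := exists l1 l2,
  [/\ G.1.1.1 = cd.1, G.2 = cd.2.2, forall v i, i \in cd.2.1.1 v &
   [/\ contour (par G) cd.2.1.1 (inl true) l1, contour (par G) cd.2.1.1 (inl false) l2 &
   nc (partner G) cd.2.1.2 (l1 ++ l2)]].

Lemma planar_encodes G : planar G -> exists cd, encodes G cd.
Proof.
move=> [ord [beta [l1 [l2 [ho h1 h2 hn]]]]].
exists (G.1.1.1, ([ffun v => ord v], [ffun x => beta x], G.2)), l1, l2; split=> //=.
  by move=> v i; rewrite ffunE.
have ct s l : contour (par G) ord s l -> contour (par G) [ffun v => ord v] s l.
  elim=> {s l} [s hs|v ls _ IH]; first exact: contour_leaf.
  have := contour_node (ord := [ffun v => ord v]) IH; by rewrite ffunE.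
split; [exact: ct|exact: ct|].
elim: hn => [|x y a b hP hx hy _ IHa _ IHb]; first exact: nc_nil.
by apply: nc_pair; rewrite ?ffunE.
Qed.

(* The contour words and their matching are recovered from the code. *)
Lemma encodes_inj G G' cd : wf_graph G -> wf_graph G' -> encodes G cd -> encodes G' cd -> G = G'.
Proof.
move=> wf wf' [l1 [l2 [e1 e2 ho [h1 h2 hn]]]] [l1' [l2' [e1' e2' _ [h1' h2' hn']]]].
have ep : par G =1 par G' by move=> v; rewrite /par e1 e1'.
have ct s l : contour (par G') cd.2.1.1 s l -> contour (par G) cd.2.1.1 s l.
  elim=> {s l} [s hs|v ls _ IH]; first by apply: contour_leaf => v; rewrite ep.
  by rewrite -ep; apply: contour_node.
have el1 := contour_fun (wf_inj wf) h1 (ct _ _ h1').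
have el2 := contour_fun (wf_inj wf) h2 (ct _ _ h2').
rewrite -el1 -el2 in hn'.
(* Both matchings are produced by the same run on the same word, hence they coincide. *)
have [ps [r1 P1 C1]] := nc_run hn [::] [::].
have [ps' [r2 P2 _]] := nc_run hn' [::] [::].
have eps : ps = ps' by move: r1; rewrite r2 /= !cats0 => ->.
have [cv cs] := contour_cover (wf_inj wf) ho (wf_acyclic wf) h1 h2.
have em v : mate G v = mate G' v.
  have [[x y] hxy hv] := C1 _ (cv v); have := P1 _ hxy; rewrite eps in hxy; have := P2 _ hxy.
  case: hv => /= <-; [case: y {hxy} => // w /= /eqP <- /eqP ->|case: x {hxy} => // w /= /eqP h' /eqP h] => //.
  by rewrite -{1}h -h' !mateK.
have eo s : occupied G s = occupied G' s by apply: eq_existsb => v; rewrite ep.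
have et s : ty G s = ty G' s by apply: ty_fuel_ext.
have eA s : leafA G s = leafA G' s by rewrite /leafA eo et.
have dashE G0 s t : wf_graph G0 -> leafA G0 s -> dashed G0 s t -> dash G0 s = t.
  by move=> w hs; apply: (dashed_fun w); rewrite /dashed hs eqxx.
have ed s : dash G s = dash G' s.
  case: (boolP (leafA G s)) => hs; last by rewrite !dash_id // -eA.
  have hs' : leafA G' s by rewrite -eA.
  have hl : forall v, par G v != s.
    by move=> v; case/andP: hs => ho' _; apply: contra ho' => h; apply/existsP; exists v.
  have [[x y] hxy hv] := C1 _ (cs s hl); have := P1 _ hxy; rewrite eps in hxy; have := P2 _ hxy.
  case: hv => /= <-; [case: y {hxy} => // t /=|case: x {hxy} => // t /=] => d1 d2.
    by rewrite (dashE G s t) // (dashE G' s t).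
  by rewrite (dashE G s t) ?(dashE G' s t) // dashed_sym.
case: G G' {wf wf' h1 h2 hn h1' h2' hn' ct el1 el2 r1 P1 C1 r2 P2 cv cs eo et eA dashE ep} e1 e2 e1' e2' em ed
  => [[[p1 d1] m1] q1] [[[p2 d2] m2] q2] /= -> -> -> -> em ed.
by congr (_, _, _, _); apply/ffunP.
Qed.

Definition heap_slots (v : 'I_n) : pred (slot n) :=
  fun s => if s is inr (u, _) then (u < v)%N else true.

Definition heap_par : pred {ffun 'I_n -> slot n} := [pred f in family heap_slots].

(** The vertex [v] hangs at one of the 2 root edges or of the 3 child slots of each of the [v]
    smaller labels, and 2 + 3v <= 3(v + 1). *)
Lemma card_heap_par : #|heap_par| <= 3 ^ n * n`!.
Proof.
rewrite (eq_card (B := family heap_slots)) // card_family.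
have hF (v : 'I_n) : #|heap_slots v| <= 3 * v.+1.
  pose g (x : bool + 'I_v * 'I_3) : slot n :=
    match x with inl b => inl b | inr (u, c) => inr (widen_ord (ltnW (ltn_ord v)) u, c) end.
  apply: (@leq_trans #|[set g x | x in predT]|).
    apply/subset_leq_card/subsetP => -[b|[u c]] h; apply/imsetP; first by exists (inl b).
    have {}h : u < v := h; by exists (inr (Ordinal h, c)) => //=; congr (inr (_, _)); apply: val_inj.
  apply: leq_trans (leq_imset_card _ _) _.
  rewrite card_sum card_bool card_prod !card_ord; lia.
rewrite foldrE big_map big_enum /=.
apply: (@leq_trans (\prod_(v < n) (3 * v.+1))); first by apply: leq_prod => v _; apply: hF.
rewrite big_split /= prod_nat_const card_ord leq_mul2l; apply/orP; right.
by rewrite fact_prod big_add1 /= big_mkord.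
Qed.

Definition melonics : {set graph n} := [set G | `[< hgraph G /\ melonic G >]].

Lemma mem_melonics G : (G \in melonics) = `[< hgraph G /\ melonic G >].
Proof. by rewrite inE. Qed.

(** Per vertex: 3 from the heap-ordered trees, 256 = 4^4 lists of four ends, 8 propagators, and 16 =
    2^4 marks for the vertex and its three child slots. The marks of the two root slots give the
    factor 4. *)
Lemma card_melonics : #|melonics| <= 4 * (3 * 256 * 16 * 8) ^ n * n`!.
Proof.
have hcode G : exists cd, G \in melonics -> encodes G cd.
  case: (boolP (G \in melonics)) => [|_]; last by exists (G.1.1.1, ([ffun=> [tuple ord0; ord0; ord0; ord0]], [ffun=> true], G.2)).
  rewrite inE => /asboolP [_ /planar_melonic /planar_encodes [cd h]].
  by exists cd.
pose cd G := projT1 (cid (hcode G)).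
have cdP G : G \in melonics -> encodes G (cd G) := projT2 (cid (hcode G)).
have inj : {in melonics &, injective cd}.
  move=> G G' hG hG' e; have h1 := cdP _ hG; have h2 := cdP _ hG'; rewrite -e in h2.
  by move: hG hG'; rewrite !inE => /asboolP [[w _] _] /asboolP [[w' _] _]; apply: encodes_inj h1 h2.
rewrite -(card_in_imset inj).
apply: (@leq_trans #|predX heap_par (predT : pred ({ffun 'I_n -> 4.-tuple 'I_4} * {ffun letter -> bool} * {ffun 'I_n -> 'I_8})%type)|).
  apply/subset_leq_card/subsetP => _ /imsetP[G hG ->].
  have [l1 [l2 [e1 _ _ _]]] := cdP _ hG; rewrite inE /= andbT -e1.
  move: hG; rewrite inE => /asboolP [[_ hh] _]; apply/familyP => v.
  rewrite unfold_in /heap_slots; case e: (G.1.1.1 v) => [b|[u c]] //; exact: hh e.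
rewrite cardX; apply: leq_trans (leq_mul card_heap_par (leqnn _)) _.
have -> : #|(predT : pred ({ffun 'I_n -> 4.-tuple 'I_4} * {ffun letter -> bool} * {ffun 'I_n -> 'I_8})%type)|
   = 256 ^ n * (4 * 16 ^ n) * 8 ^ n.
  rewrite !card_prod !card_ffun card_tuple !card_ord card_bool card_sum card_sum card_bool card_prod !card_ord.
  have -> : 2 ^ (2 + n * 3 + n) = 4 * 16 ^ n.
    have -> : 2 + n * 3 + n = 2 + 4 * n by lia.
    by rewrite expnD expnM.
  by [].
by rewrite !expnMn; apply/eq_leq; lia.
Qed.

End Code.

Lemma melonics_growth : exists K : nat, 0 < K /\ forall n, #|melonics n| <= 4 * K ^ n * n`!.
Proof. by exists (3 * 256 * 16 * 8); split=> //; apply: card_melonics. Qed.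

From mathcomp Require Import finmap all_classical all_reals all_analysis complex.
Import numFieldNormedType.Exports.
Local Open Scope classical_set_scope.
Local Open Scope ring_scope.
Local Open Scope complex_scope.

(** * Bounds on amplitudes *)

Section Sums.
Variable R : realType.
Implicit Types (p q : R).

Lemma geom_le q L : 0 <= q < 1 -> \sum_(i < L) q ^+ i <= (1 - q)^-1.
Proof.
move=> /andP[q0 q1]; have h : 0 < 1 - q by rewrite subr_gt0.
rewrite -[leRHS]mul1r ler_pdivlMr // mulrC -opprB mulNr -subrX1 opprB.
by rewrite gerBl exprn_ge0.
Qed.

Lemma sum_box (I : finType) (J : {set I}) q L :
  \sum_(f in pffun_on (ord0 : 'I_L.+1) J predT) \prod_(s in J) q ^+ f s = (\sum_(i < L.+1) q ^+ i) ^+ #|J|.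
Proof.
rewrite -(big_distr_big ord0 (mem J) predT (fun _ (i : 'I_L.+1) => q ^+ i)) /=.
by rewrite prodr_const.
Qed.

(* A set of points separated by [#|J|] natural coordinates contributes at most
   the product of the corresponding geometric series. *)
Lemma esum_le_coords (T : choiceType) (I : finType) (J : {set I}) (D : set T)
    (f : T -> I -> nat) (w : T -> R) (C q : R) : 0 <= q < 1 -> 0 <= C ->
  (forall a b, D a -> D b -> (forall s, s \in J -> f a s = f b s) -> a = b) ->
  (forall a, D a -> w a <= C * \prod_(s in J) q ^+ f a s) ->
  (\esum_(a in D) (w a)%:E <= (C * ((1 - q)^-1) ^+ #|J|)%:E)%E.
Proof.
move=> hq C0 hinj hw; have /andP[q0 q1] := hq.
apply: ge_ereal_sup => _ [X [finX XD] <-].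
rewrite fsbig_finite //= sumEFin lee_fin.
set r : seq T := finmap.enum_fset (fset_set X).
have rD a : a \in r -> D a.
  by move=> ar; have : a \in fset_set X by []; rewrite in_fset_set // inE => /XD.
(* The finitely many points lie in a box of side [L + 1], over which the sum factorises. *)
pose L := (\max_(a <- r) \max_s f a s)%N.
have fL a s : a \in r -> (f a s <= L)%N.
  move=> ar; apply: (@leq_trans (\max_s f a s)%N); first exact: (leq_bigmax (F := f a)).
  exact: (leq_bigmax_seq (F := fun a => \max_s f a s)%N).
pose F a : {ffun I -> 'I_L.+1} := [ffun s => if s \in J then inord (f a s) else ord0].
have FE a s : a \in r -> s \in J -> F a s = f a s :> nat.
  by move=> ar sJ; rewrite ffunE sJ inordK // ltnS fL.
have Finj : {in r &, injective F}.
  move=> a b ar br e; apply: hinj; [exact: rD|exact: rD|] => s sJ.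
  by rewrite -FE // e FE.
apply: (@le_trans _ _ (\sum_(a <- r) C * \prod_(s in J) q ^+ F a s)).
  rewrite big_seq [leRHS]big_seq; apply: ler_sum => a ar.
  apply: le_trans (hw a (rD a ar)) _; rewrite le_eqVlt; apply/orP; left; apply/eqP.
  by congr (_ * _); apply: eq_bigr => s sJ; rewrite FE.
rewrite -mulr_sumr ler_wpM2l //.
apply: (@le_trans _ _ ((\sum_(i < L.+1) q ^+ i) ^+ #|J|)); last first.
  apply: lerXn2r; rewrite ?nnegrE.
  - by apply: sumr_ge0 => i _; rewrite exprn_ge0.
  - by rewrite invr_ge0 subr_ge0 ltW.
  - exact: geom_le.
rewrite -sum_box -(big_map F xpredT (fun g : {ffun I -> 'I_L.+1} => \prod_(s in J) q ^+ g s)) /=.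
rewrite big_uniq /=; last first.
  by rewrite map_inj_in_uniq ?fset_uniq.
rewrite big_mkcond [leRHS]big_mkcond; apply: ler_sum => g _.
have g0 : 0 <= \prod_(s in J) q ^+ g s by apply: prodr_ge0 => s _; rewrite exprn_ge0.
case: ifP => [/mapP[a ar ->]|_]; last by case: ifP.
rewrite ifT //; apply/pffun_onP; split=> //.
by apply/supportP => s sJ; rewrite ffunE (negbTE sJ).
Qed.

End Sums.

Section Upper.
Variables (R : realType) (n r : nat) (G : graph n).
Hypothesis wf : wf_graph G.

Definition weight (p : R) a := \prod_(s | leafA G s) p ^+ slotmom r a s.

Lemma amp_le (p q C : R) (J : {set slot n}) : 0 < p < 1 -> 0 <= q < 1 -> 0 <= C ->
  determines G J r ->
  (forall a, admissible G r a -> weight p a <= C * \prod_(s in J) q ^+ slotmom r a s) ->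
  (amp p r G <= ((1 - p) ^+ n * (C * ((1 - q)^-1) ^+ #|J|))%:E)%E.
Proof.
move=> /andP[p0 p1] hq C0 hJ hw; rewrite /amp /Nof invrK EFinM.
apply: lee_wpmul2l; first by rewrite lee_fin exprn_ge0 // subr_ge0 ltW.
apply: (esum_le_coords (f := slotmom r)) => // a b ha hb hab.
rewrite -(attrK ha) -(attrK hb) /attr.
have e := hJ _ _ (slotmom_flow wf ha) (slotmom_flow wf hb) hab.
by congr (_, _, _); apply/ffunP => v; rewrite !ffunE !e.
Qed.

Lemma weight_le (p : R) (J : {set slot n}) a : 0 < p < 1 -> J \subset leaves G ->
  weight p a <= \prod_(s in J) p ^+ slotmom r a s.
Proof.
move=> /andP[p0 p1] hJ; rewrite /weight (bigID (mem J)) /=.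
rewrite [X in X * _](eq_bigl (mem J)); last first.
  move=> s /=; case: (boolP (s \in J)) => [/(fintype.subsetP hJ)|]; rewrite ?andbF //.
  by rewrite inE => ->.
rewrite ler_piMr ?prodr_ge0 // => [s _|]; first by rewrite exprn_ge0 ?ltW.
by apply: prodr_ile1 => s _; rewrite exprn_ge0 ?exprn_ile1 ?ltW.
Qed.

Lemma amp_ge0 (p : R) : 0 < p < 1 -> (0 <= amp p r G)%E.
Proof.
move=> /andP[p0 p1]; apply: mule_ge0; first by rewrite lee_fin exprn_ge0 // /Nof invrK subr_ge0 ltW.
by apply: esum_ge0 => a _; rewrite lee_fin; apply: prodr_ge0 => s _; rewrite exprn_ge0 ?ltW.
Qed.

Lemma amp_le1 (p : R) : 0 < p < 1 -> (amp p r G <= 1%:E)%E.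
Proof.
move=> hp; have [J [hJ cJ dJ]] := flow_coords wf r; have /andP[p0 p1] := hp.
apply: le_trans (amp_le (q := p) (C := 1) hp _ _ dJ _) _ => //.
- by rewrite ltW.
- by move=> a _; rewrite mul1r; apply: weight_le.
by rewrite lee_fin mul1r cJ -exprMn divff ?expr1n // subr_eq0 eq_sym lt_eqF.
Qed.

Lemma amp_nonredundant (p : R) : ~ redundant G -> 0 < p < 1 -> (amp p r G <= (1 / Nof p)%:E)%E.
Proof.
move=> nred hp; have [J [hJ cJ dJ]] := nonredundant_coords wf r nred; have /andP[p0 p1] := hp.
apply: le_trans (amp_le (q := p) (C := 1) hp _ _ dJ _) _ => //.
- by rewrite ltW.
- by move=> a _; rewrite mul1r; apply: weight_le.
have -> : (1 - p) ^+ n = (1 - p) ^+ #|J|.+1 by rewrite cJ.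
rewrite lee_fin mul1r exprS -mulrA -exprMn divff ?expr1n ?subr_eq0 1?eq_sym ?lt_eqF //.
by rewrite /Nof invrK mul1r mulr1.
Qed.

(* The leaf momenta sum up to at least [r], so half of the weight pays for [q ^ r]. *)
Lemma amp_decay (q : R) : 0 < q < 1 -> (amp (q ^+ 2) r G <= (q ^+ r * 2 ^+ n)%:E)%E.
Proof.
move=> hq; have [J [hJ cJ dJ]] := flow_coords wf r; have /andP[q0 q1] := hq.
have hp : 0 < q ^+ 2 < 1 by rewrite exprn_gt0 //= exprn_ilt1 ?ltW.
apply: le_trans (amp_le (q := q) (C := q ^+ r) hp _ _ dJ _) _ => //.
- by rewrite ltW.
- by rewrite exprn_ge0 ?ltW.
- move=> a ha; have hr := root_le_leaves wf (slotmom_flow wf ha).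
  have -> : weight (q ^+ 2) a = weight q a * weight q a.
    rewrite /weight -big_split /=; apply: eq_bigr => s _.
    by rewrite -exprM -exprD mulnC muln2 addnn.
  have w0 : 0 <= weight q a by apply: prodr_ge0 => s _; rewrite exprn_ge0 ?ltW.
  apply: ler_pM => //.
    rewrite /weight; have -> : \prod_(s | leafA G s) q ^+ slotmom r a s = q ^+ (\sum_(s | leafA G s) slotmom r a s)%N.
      by rewrite -(big_morph _ (fun x y => exprD q x y) (expr0 q)).
    by apply: ler_wiXn2l => //; rewrite ltW.
  by have := weight_le a hq hJ; apply.
have h : 0 < 1 - q by rewrite subr_gt0.
rewrite lee_fin mulrCA; apply: ler_wpM2l; first by rewrite exprn_ge0 ?ltW.
(* The quotient of 1 - q^2 by 1 - q is 1 + q, at most 2. *)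
rewrite cJ -exprMn; apply: lerXn2r; rewrite ?nnegrE //.
  by rewrite divr_ge0 ?subr_ge0 ?exprn_ile1 ?ltW.
by rewrite ler_pdivrMr //; nra.
Qed.

End Upper.

(** * Lower bound on amplitudes with a free family *)

Section Lower.
Variables (R : realType) (n r : nat) (G : graph n).
Hypothesis wf : wf_graph G.

Lemma pow_small (q : R) : 0 <= q < 1 -> exists L, q ^+ L <= 2^-1.
Proof.
move=> /andP[q0 q1].
have : (fun k => q ^+ k) @ \oo --> (0 : R) by apply: cvg_expr; rewrite ger0_norm.
move=> /cvgrPdist_le /(_ (2^-1)) []; first by rewrite invr_gt0.
move=> L _ /(_ L (leqnn L)); rewrite sub0r normrN ger0_norm ?exprn_ge0 // => h.
by exists L.
Qed.

(** Bernoulli's inequality. *)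
Lemma one_sub_exp (p : R) k : 0 <= p <= 1 -> 1 - p ^+ k <= k%:R * (1 - p).
Proof.
move=> /andP[p0 p1]; elim: k => [|k IH]; first by rewrite expr0 subrr mul0r.
rewrite exprS -natr1 mulrDl mul1r; have : 0 <= p ^+ k <= 1 by rewrite exprn_ge0 ?exprn_ile1.
by move: IH; move: (p ^+ k) (k%:R * _) => a b; nra.
Qed.

(** Momenta grow at most linearly in the parameters, so the weights dominate a product of [n]
    geometric progressions of ratio [q = p ^+ K1]. By Bernoulli 1 - q is at most K1 (1 - p), so
    their sums compensate the prefactor up to a constant. *)
Lemma amp_family : has_family G -> exists2 c : R, 0 < c &
  forall p : R, 2^-1 <= p < 1 -> (c%:E <= amp p r G)%E.
Proof.
move=> /(_ r) [K [phi [f1 f2 f3]]].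
pose K1 := ((#|{: slot n}| * K).+1)%N.
exists (2^-1 ^+ K1 * (2^-1 * K1%:R^-1) ^+ n).
  by rewrite mulr_gt0 ?exprn_gt0 ?mulr_gt0 ?invr_gt0 ?ltr0n.
move=> p /andP[p2 p1].
have p0 : 0 < p by apply: lt_le_trans p2; rewrite invr_gt0.
pose q := p ^+ K1; have q0 : 0 < q by rewrite exprn_gt0.
have q1 : q < 1 by rewrite exprn_ilt1 ?ltW.
(* The truncation depends on [p], the bound does not: it keeps at least half of each geometric
   series, whence the factor 1/2 per parameter in the constant. The other factor, a power of 1/2,
   bounds [q] below for [p >= 1/2]. *)
have [L hL] : exists L, q ^+ L <= 2^-1 by apply: pow_small; rewrite q1 ltW.
pose m (f : {ffun 'I_n -> 'I_L}) : {ffun 'I_n -> nat} := [ffun i => nat_of_ord (f i)].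
pose h f := attr G (phi (m f)).
have hw (f : {ffun 'I_n -> 'I_L}) : 2^-1 ^+ K1 * \prod_i q ^+ f i <= weight r G p (h f).
  have [g1 g2 g3] := f1 (m f).
  rewrite /weight -(big_morph _ (fun x y => exprD q x y) (expr0 q)).
  rewrite -(big_morph _ (fun x y => exprD p x y) (expr0 p)).
  apply: (@le_trans _ _ (p ^+ (K1 * (1 + \sum_i f i)))).
    rewrite mulnDr muln1 exprD exprM -/q; apply: ler_wpM2r; first by rewrite exprn_ge0 ?ltW.
    by apply: lerXn2r => //; rewrite nnegrE ?invr_ge0 // ltW.
  apply: ler_wiXn2l; rewrite ?ltW //.
  apply: (@leq_trans (\sum_(s : slot n) K * (1 + \sum_i f i))%N); last first.
    by rewrite sum_nat_const mulnA leq_mul2r leqnSn orbT.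
  rewrite [leqRHS](bigID (leafA G)) /=; apply: leq_trans (leq_addr _ _).
  apply: leq_sum => s _; rewrite slotmom_attr //.
  apply: leq_trans (f3 _ _) _; rewrite leq_mul2l; apply/orP; right.
  by rewrite leq_add2l; apply: leq_sum => i _; rewrite ffunE.
have hinj : {in [set: {ffun 'I_n -> 'I_L}] &, injective h}.
  move=> f f' _ _ e; have [g1 _ g3] := f1 (m f); have [g1' _ g3'] := f1 (m f').
  have /ffunP em : m f = m f'.
    by apply: f2 => s; rewrite -(slotmom_attr _ g1 g3) -(slotmom_attr _ g1' g3') -/(h f) e.
  by apply/ffunP => i; apply: val_inj; have := em i; rewrite !ffunE.
rewrite /amp /Nof invrK.
apply: (@le_trans _ _ (((1 - p) ^+ n)%:E * (\sum_f weight r G p (h f))%:E)%E); last first.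
  apply: lee_wpmul2l; first by rewrite lee_fin exprn_ge0 // subr_ge0 ltW.
  apply: esum_ge; exists (h @` setT).
    split; first by apply: finite_image; apply: finite_finset.
    by move=> _ [f _ <-]; apply: attr_admissible.
  rewrite fsbig_image // -sumEFin.
  have -> : [set: {ffun 'I_n -> 'I_L}] = [set` xpredT] by apply/seteqP; split.
  rewrite -(@bigfs _ _ _ _ (index_enum _) xpredT) ?index_enum_uniq //.
  by move=> f _; rewrite mem_index_enum.
rewrite -EFinM lee_fin.
apply: (@le_trans _ _ ((1 - p) ^+ n * (2^-1 ^+ K1 * (\sum_(i < L) q ^+ i) ^+ n))); last first.
  apply: ler_wpM2l; first by rewrite exprn_ge0 // subr_ge0 ltW.
  apply: le_trans (ler_sum _ (fun f _ => hw f)); rewrite -mulr_sumr.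
  apply: ler_wpM2l; first by rewrite exprn_ge0 ?invr_ge0.
  rewrite -(bigA_distr_bigA (fun (_ : 'I_n) (i : 'I_L) => q ^+ i)) /= prodr_const card_ord.
  by [].
rewrite mulrCA; apply: ler_wpM2l; first by rewrite exprn_ge0 ?invr_ge0.
rewrite -exprMn; apply: lerXn2r; rewrite ?nnegrE.
- by rewrite mulr_ge0 ?invr_ge0.
- apply: mulr_ge0; first by rewrite subr_ge0 ltW.
  by apply: sumr_ge0 => i _; rewrite exprn_ge0 ?ltW.
have hq : 1 - q <= K1%:R * (1 - p) by apply: one_sub_exp; rewrite !ltW.
have hs : (1 - q) * \sum_(i < L) q ^+ i = 1 - q ^+ L.
  by rewrite -opprB mulNr -subrX1 opprB.
have hK : 0 < K1%:R :> R by rewrite ltr0n.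
rewrite ler_pdivrMr // mulrC mulrA.
have hS : 0 <= \sum_(i < L) q ^+ i by apply: sumr_ge0 => i _; rewrite exprn_ge0 ?ltW.
apply: (@le_trans _ _ ((1 - q) * \sum_(i < L) q ^+ i)); last by rewrite ler_wpM2r.
rewrite hs; lra.
Qed.

End Lower.

(** * Series *)

Section ComplexSeries.
Variable R : realType.
Implicit Types (f g u : nat -> R[i]) (b : nat -> R) (l z : R[i]).
Local Notation normc := (@Normc.normc R).

Lemma normr_normc z : `|z| = (normc z)%:C.
Proof. by case: z => a c; rewrite normc_def. Qed.

Lemma normc_ge0 z : 0 <= normc z.
Proof. by case: z => a c; rewrite sqrtr_ge0. Qed.

Lemma ler_normcD x y : normc (x + y) <= normc x + normc y.
Proof. by rewrite -lecR rmorphD /= -!normr_normc ler_normD. Qed.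

Lemma normc_sum (I : Type) (r : seq I) (P : pred I) (F : I -> R[i]) :
  normc (\sum_(i <- r | P i) F i) <= \sum_(i <- r | P i) normc (F i).
Proof.
rewrite -lecR rmorph_sum /= -normr_normc; apply: le_trans (ler_norm_sum _ _ _) _.
by apply: ler_sum => i _; rewrite normr_normc.
Qed.

Lemma normc_real (x : R) : 0 <= x -> normc x%:C = x.
Proof. by move=> x0; rewrite /= expr0n /= addr0 sqrtr_sqr ger0_norm. Qed.

Lemma normc_0 : normc 0 = 0.
Proof. exact: (normc_real (lexx 0)). Qed.

Lemma normcX z n : normc (z ^+ n) = normc z ^+ n.
Proof.
elim: n => [|n IH]; last by rewrite !exprS Normc.normcM IH.
by rewrite !expr0 normc_real.
Qed.

Lemma normc_le_ReIm z : normc z <= `|complex.Re z| + `|complex.Im z|.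
Proof.
case: z => a c /=; rewrite -[leRHS]ger0_norm ?addr_ge0 // -sqrtr_sqr ler_wsqrtr //.
rewrite sqrrD !real_normK ?num_real //; have := mulr_ge0 (normr_ge0 a) (normr_ge0 c); lra.
Qed.

Lemma Re_le_normc z : `|complex.Re z| <= normc z.
Proof. by case: z => a c /=; rewrite -sqrtr_sqr ler_wsqrtr // lerDl sqr_ge0. Qed.
Lemma Im_le_normc z : `|complex.Im z| <= normc z.
Proof. by case: z => a c /=; rewrite -sqrtr_sqr ler_wsqrtr // lerDr sqr_ge0. Qed.

(** Convergence in terms of the real-valued modulus: the norm of [R[i]] takes its values in [R[i]],
    which is awkward next to real majorants. *)
Definition tends u l := forall e : R, 0 < e -> exists N, forall n, (N <= n)%N -> normc (l - u n) <= e.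

Lemma tends_cvg u l : tends u l -> u @ \oo --> l.
Proof.
move=> h; suff : (u : nat -> (R[i])^o) @ \oo --> (l : (R[i])^o) by [].
apply/cvgrPdist_le => e e0.
have [e1 e2] : 0 < complex.Re e /\ (complex.Re e)%:C = e.
  by move: e0; rewrite ltcE /=; case: e => a c /= /andP[/eqP -> ->].
have [N hN] := h _ e1; exists N => // n /= hn.
by rewrite normr_normc -e2 lecR; apply: hN.
Qed.

Lemma tends_lim u l : tends u l -> limn u = l.
Proof. by move=> /tends_cvg h; apply: (@norm_cvg_lim _ (R[i])^o). Qed.

Lemma tends_is_cvg u l : tends u l -> cvgn u.
Proof. by move=> /tends_cvg h; apply/cvg_ex; exists l. Qed.

Lemma tendsP_real (v : nat -> R) (x : R) : v @ \oo --> x ->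
  forall e : R, 0 < e -> exists N, forall n, (N <= n)%N -> `|x - v n| <= e.
Proof. by move=> /cvgrPdist_le h e /h [N _ hN]; exists N. Qed.

Lemma tends_ReIm u (a c : R) :
  (fun n => complex.Re (u n)) @ \oo --> a -> (fun n => complex.Im (u n)) @ \oo --> c ->
  tends u (a +i* c).
Proof.
move=> /tendsP_real h1 /tendsP_real h2 e e0.
have e2 : 0 < e / 2 by rewrite divr_gt0.
have [N1 k1] := h1 _ e2; have [N2 k2] := h2 _ e2; exists (maxn N1 N2) => n.
rewrite geq_max => /andP[/k1 j1 /k2 j2]; apply: le_trans (normc_le_ReIm _) _.
by move: j1 j2; case: (u n) => x y /=; lra.
Qed.

Lemma tends_unique u l l' : tends u l -> tends u l' -> l = l'.
Proof. by move=> /tends_lim <- /tends_lim <-. Qed.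

Lemma tends_scale u l z : tends u l -> tends (fun n => z * u n) (z * l).
Proof.
move=> h e e0; have h0 : 0 < normc z + 1 by have := normc_ge0 z; lra.
have [N hN] := h (e / (normc z + 1)) (divr_gt0 e0 h0); exists N => n /hN hn.
rewrite -mulrBr Normc.normcM; apply: (@le_trans _ _ ((normc z + 1) * (e / (normc z + 1)))).
  by apply: ler_pM; rewrite ?normc_ge0 // lerDl.
by rewrite mulrC divfK // gt_eqF.
Qed.

Lemma tends_add u v l m : tends u l -> tends v m -> tends (fun n => u n + v n) (l + m).
Proof.
move=> h1 h2 e e0; have e2 : 0 < e / 2 by rewrite divr_gt0.
have [N1 k1] := h1 _ e2; have [N2 k2] := h2 _ e2; exists (maxn N1 N2) => n.
rewrite geq_max => /andP[/k1 j1 /k2 j2]; rewrite opprD addrACA.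
by apply: le_trans (ler_normcD _ _) _; lra.
Qed.

Lemma tends_bound u l (x : R) : tends u l -> (forall n, normc (u n) <= x) -> normc l <= x.
Proof.
move=> h hx; apply/ler_addgt0Pr => e /h [N /(_ N (leqnn N)) hN].
rewrite -[l](subrK (u N)); apply: le_trans (ler_normcD _ _) _.
by rewrite addrC lerD.
Qed.

Lemma tends_cst l : tends (fun _ => l) l.
Proof. by move=> e e0; exists 0%N => n _; rewrite subrr normc_0 ltW. Qed.

Lemma eq_tends u v l : u =1 v -> tends u l -> tends v l.
Proof. by move=> e h x /h [N hN]; exists N => n /hN; rewrite e. Qed.

Lemma series_mulr f z n : series (fun k => z * f k) n = z * series f n.
Proof. by rewrite /series /= mulr_sumr. Qed.

Lemma tends_sum m (F : nat -> nat -> R[i]) (v : nat -> R[i]) :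
  (forall k, tends (series (F k)) (v k)) ->
  tends (series (fun n => \sum_(k < m) F k n)) (\sum_(k < m) v k).
Proof.
move=> h; elim: m => [|m IH].
  rewrite big_ord0; apply: eq_tends (tends_cst 0) => n.
  by rewrite /series /= big1 // => i _; rewrite big_ord0.
rewrite big_ord_recr /=; apply: eq_tends (tends_add IH (h m)) => n.
by rewrite /series /= -big_split /=; apply: eq_bigr => i _; rewrite big_ord_recr.
Qed.

Lemma normc_series_le f b n : (forall k, normc (f k) <= b k) -> normc (series f n) <= series b n.
Proof. by move=> h; rewrite /series /=; apply: le_trans (normc_sum _ _ _) _; apply: ler_sum. Qed.

Lemma series_le_lim b (s : R) : (forall k, 0 <= b k) -> series b @ \oo --> s ->
  forall n, series b n <= s.
Proof.
move=> b0 hs n; rewrite -(cvg_lim (@Rhausdorff R) hs); apply: nondecreasing_cvgn_le; last first.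
  by apply/cvg_ex; exists s.
by apply/nondecreasing_seqP => k; rewrite seriesSr /=; rewrite lerDl.
Qed.

Lemma abs_summable f b (s : R) : (forall k, normc (f k) <= b k) -> series b @ \oo --> s ->
  exists l, tends (series f) l /\ normc l <= s.
Proof.
move=> hf hs.
have b0 k : 0 <= b k by apply: le_trans (hf k); apply: normc_ge0.
have hr (g : nat -> R) : (forall k, `|g k| <= b k) -> cvgn (series g).
  move=> hg; apply: normed_cvg; apply: (series_le_cvg _ b0 hg); first by move=> k; apply: normr_ge0.
  by apply/cvg_ex; exists s.
have [x hx] : exists x : R, series (fun k => complex.Re (f k)) @ \oo --> x.
  by apply/cvg_ex; apply: hr => k; apply: le_trans (Re_le_normc _) (hf k).
have [y hy] : exists y : R, series (fun k => complex.Im (f k)) @ \oo --> y.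
  by apply/cvg_ex; apply: hr => k; apply: le_trans (Im_le_normc _) (hf k).
have ReS n : complex.Re (series f n) = series (fun k => complex.Re (f k)) n.
  by rewrite /series /= (big_morph (@complex.Re R) (id1 := 0) (op1 := +%R)) // => -[? ?] [? ?].
have ImS n : complex.Im (series f n) = series (fun k => complex.Im (f k)) n.
  by rewrite /series /= (big_morph (@complex.Im R) (id1 := 0) (op1 := +%R)) // => -[? ?] [? ?].
have ht : tends (series f) (x +i* y).
  by apply: tends_ReIm; under eq_fun => n do rewrite ?ReS ?ImS.
exists (x +i* y); split=> //; apply: (tends_bound ht) => n.
exact: le_trans (normc_series_le n hf) (series_le_lim b0 hs n).
Qed.

(** Exchange of summations under a product majorant. The tail of row [r] beyond [m] is at most [A r]
    times the tail of [B]; summing over [r] bounds the difference between the row total and the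
    first [m] columns by [sA] times that tail. *)
Lemma double_series (F : nat -> nat -> R[i]) (A B : nat -> R) (sA sB : R) (u v : nat -> R[i]) :
  (forall r n, normc (F r n) <= A r * B n) -> (forall r, 0 <= A r) -> (forall n, 0 <= B n) ->
  series A @ \oo --> sA -> series B @ \oo --> sB ->
  (forall r, tends (series (F r)) (u r)) -> (forall n, tends (series (fun r => F r n)) (v n)) ->
  exists U, tends (series u) U /\ tends (series v) U.
Proof.
move=> hF A0 B0 hA hB hu hv.
have sA0 : 0 <= sA by have := series_le_lim A0 hA 0%N; rewrite /series /= big_geq.
have tail r m : normc (u r - \sum_(n < m) F r n) <= A r * (sB - series B m).
  have : tends (fun k => series (F r) (k + m)%N - \sum_(n < m) F r n) (u r - \sum_(n < m) F r n).
    apply: tends_add (tends_cst _) => e /(hu r) [N hN]; exists N => k hk.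
    by apply: hN; apply: leq_trans hk (leq_addr _ _).
  move/tends_bound; apply => k.
  have -> : series (F r) (k + m)%N - \sum_(n < m) F r n = \sum_(m <= n < k + m) F r n.
    rewrite /series /= (big_cat_nat _ (n := m)) ?leq_addl //= big_mkord.
    by apply/eqP; rewrite subr_eq addrC.
  apply: le_trans (normc_sum _ _ _) _.
  apply: (@le_trans _ _ (\sum_(m <= n < k + m) A r * B n)); first by apply: ler_sum.
  rewrite -mulr_sumr ler_wpM2l // lerBrDl.
  have := series_le_lim B0 hB (k + m)%N; rewrite {1}/series /=.
  by rewrite (big_cat_nat _ (n := m)) ?leq_addl.
have uA r : normc (u r) <= A r * sB.
  by have := tail r 0%N; rewrite big_ord0 subr0 /series /= big_geq // subr0.
have AsB (x : R) : series (fun r => A r * x) @ \oo --> sA * x.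
  have -> : series (fun r => A r * x) = (fun n => series A n * x).
    by apply/funext => n; rewrite /series /= mulr_suml.
  by apply: cvgMl.
have [U [hU _]] := abs_summable uA (AsB sB).
exists U; split=> // e e0.
(* The denominator is [sA + 1] because [sA] may vanish. *)
have e1 : 0 < e / (sA + 1) by rewrite divr_gt0 //; lra.
have [N hN] := tendsP_real hB e1; exists N => m /hN hm.
have h1 : tends (series (fun r => u r - \sum_(n < m) F r n)) (U - series v m).
  have hs := tends_sum m hv.
  have := tends_add hU (tends_scale (-1) hs); rewrite mulN1r.
  rewrite [\sum_(k < m) v k](_ : _ = series v m); last by rewrite /series /= big_mkord.
  apply: eq_tends => k; rewrite -series_mulr /series /= -big_split /=.
  by apply: eq_bigr => i _; rewrite mulN1r.
have h2 := abs_summable (fun r => tail r m) (AsB _).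
have [l [hl hle]] := h2; rewrite (tends_unique h1 hl).
apply: le_trans hle _; apply: (@le_trans _ _ (sA * (e / (sA + 1)))).
  by rewrite ler_wpM2l // (le_trans _ hm) // ler_norm.
by rewrite mulrA ler_pdivrMr; nra.
Qed.

End ComplexSeries.

(** * Analyticity of the melonic approximation *)

Section Analyticity.
Variable R : realType.
Local Notation normc := (@Normc.normc R).

Lemma normc_epsilon n (G : graph n) : normc (epsilon R G) = 1.
Proof.
have : `|epsilon R G| = 1.
  rewrite /epsilon normr_prod big1 // => v _.
  by case: (ty _ _); rewrite ?normrN normCi.
by rewrite normr_normc => -[].
Qed.

(** The factorial in the number of melonic graphs cancels the one of the Taylor coefficient; each
    amplitude brings [2 ^+ n], whence [growth], and the power of 8 is merely bounded by 1. *)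
Lemma G2coef_le (K : nat) (q : R) r n (growth := K%:R * 2 : R) :
  (#|melonics n| <= 4 * K ^ n * n`!)%N -> 0 < q < 1 ->
  normc (G2coef (q ^+ 2) r n) <= q ^+ r * (4 * growth ^+ n).
Proof.
move=> hK hq; have /andP[q0 q1] := hq.
have g0 : 0 <= growth by rewrite mulr_ge0 ?ler0n.
rewrite /G2coef; case: ifP => _; first by rewrite normc_0; apply: mulr_ge0; [rewrite exprn_ge0 // ltW|rewrite mulr_ge0 // exprn_ge0].
rewrite Normc.normcM normc_real; last by apply: mulr_ge0; rewrite invr_ge0 ?exprn_ge0.
have f0 : 0 < (n`!)%:R :> R by rewrite ltr0n fact_gt0.
have hS : normc (\sum_(G : graph n | `[< hgraph G /\ melonic G >]) epsilon R G * (fine (amp (q ^+ 2) r G))%:C)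
    <= (4 * K ^ n * n`!)%N%:R * (q ^+ r * 2 ^+ n).
  apply: le_trans (normc_sum _ _ _) _.
  apply: (@le_trans _ _ (\sum_(G in melonics n) (q ^+ r * 2 ^+ n))).
    rewrite (eq_bigl (mem (melonics n))); last by move=> G; rewrite /= mem_melonics.
    apply: ler_sum => G; rewrite /= mem_melonics => /asboolP [[wf _] _].
    rewrite Normc.normcM normc_epsilon mul1r.
    have a0 := @amp_ge0 R n r G (q ^+ 2); have a1 := amp_decay r wf hq.
    have {}a0 : (0 <= amp (q ^+ 2) r G)%E by apply: a0; rewrite exprn_gt0 //= exprn_ilt1 // ltW.
    by move: a0 a1; case: (amp _ _ _) => [x| |] //; rewrite !lee_fin => x0 x1; rewrite normc_real.
  rewrite sumr_const -[leLHS]mulr_natl; apply: ler_wpM2r; first by rewrite mulr_ge0 ?exprn_ge0 ?ltW.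
  by rewrite ler_nat.
apply: le_trans (ler_wpM2l _ hS) _; first by apply: mulr_ge0; rewrite invr_ge0 ?exprn_ge0.
have e8 : ((8 : R) ^+ n./2)^-1 <= 1 by rewrite invf_le1 ?exprn_gt0 // exprn_ege1 // ler1n.
set Y := (_ * (q ^+ r * _)).
have Y0 : 0 <= Y by apply: mulr_ge0; rewrite ?ler0n // mulr_ge0 ?exprn_ge0 // ltW.
apply: (@le_trans _ _ ((n`!)%:R^-1 * Y)).
  by apply: ler_wpM2r => //; rewrite -[leRHS]mulr1; apply: ler_wpM2l; rewrite // invr_ge0.
rewrite le_eqVlt; apply/orP; left; apply/eqP.
rewrite /Y !natrM natrX /growth exprMn; field.
by rewrite gt_eqF.
Qed.

(** From [e * r <= expR (e * r)], raised to the power [gamma]; [e] stays free so that the rate can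
    be made as small as needed. *)
Lemma powR_le_exp (gamma : R) (e : R) : 0 <= gamma -> 0 < e ->
  exists C : R, 0 <= C /\ forall r : nat, r%:R `^ gamma <= C * expR (e * gamma) ^+ r.
Proof.
move=> g0 e0; exists ((e^-1) `^ gamma); split=> [|r]; first exact: powR_ge0.
have h : r%:R <= e^-1 * expR (e * r%:R).
  rewrite mulrC ler_pdivlMr // mulrC; apply: le_trans (expR_ge1Dx _); lra.
apply: (@le_trans _ _ ((e^-1 * expR (e * r%:R)) `^ gamma)).
  by apply: ge0_ler_powR => //; rewrite nnegrE // mulr_ge0 ?expR_ge0 // invr_ge0 ltW.
have ei : 0 <= e^-1 by rewrite invr_ge0 ltW.
rewrite powRM ?expR_ge0 //; apply: ler_wpM2l; first exact: powR_ge0.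
by rewrite -expRM_natl -expRM le_eqVlt; apply/orP; left; apply/eqP; congr expR; ring.
Qed.

Lemma powR_geometric_cvg (gamma q : R) : 0 <= gamma -> 0 < q < 1 ->
  exists s : R, series (fun r : nat => r%:R `^ gamma * q ^+ r) @ \oo --> s.
Proof.
move=> g0 /andP[q0 q1]; have lq : ln q < 0 by rewrite ln_lt0 // q0.
(* Small enough for [expR (e * gamma)] times [q] to stay below the square root of [q], up to
   equality; the [+ 1] covers [gamma = 0]. *)
pose e := - ln q / (2 * (gamma + 1)).
have e0 : 0 < e by rewrite divr_gt0 ?oppr_gt0 // mulr_gt0 // ltr_wpDl.
have [C [C0 hC]] := powR_le_exp g0 e0.
pose x := expR (e * gamma) * q.
have x0 : 0 <= x by rewrite mulr_ge0 ?expR_ge0 ?ltW.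
have x1 : x < 1.
  rewrite /x -[q in _ * q]lnK ?posrE // -expRD expR_lt1.
  have : e * gamma <= - ln q / 2.
    have -> : - ln q / 2 = e * (gamma + 1) by rewrite /e; field; lra.
    by apply: ler_wpM2l; [apply: ltW|rewrite lerDl].
  lra.
apply/cvg_ex; apply: (series_le_cvg (v_ := geometric C x)).
- by move=> r; rewrite mulr_ge0 ?powR_ge0 ?exprn_ge0 ?ltW.
- by move=> r; rewrite /geometric /= mulr_ge0 // exprn_ge0.
- move=> r; rewrite /geometric /= /x exprMn mulrA; apply: ler_wpM2r; last exact: hC.
  by rewrite exprn_ge0 ?ltW.
- by apply: is_cvg_geometric_series; rewrite ger0_norm.
Qed.

(** The terms indexed by [r] and [n] are dominated by a product of two convergent series, so summing
    first over [r] is allowed and exhibits a power series in [t]. *)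
Theorem analyticity (gamma p : R) : 0 <= gamma -> 0 < p < 1 ->
  exists rho : R, 0 < rho /\ exists a : nat -> R[i], forall t : R[i], `|t| < rho%:C ->
    (forall r : nat, cvgn (series (fun n => G2coef p r n * t ^+ n))) /\
    cvgn (series (Sterm p gamma t)) /\
    cvgn (series (fun n => a n * t ^+ n)) /\
    limn (series (fun n => a n * t ^+ n)) = Smelo p gamma t.
Proof.
move=> g0 /andP[p0 p1]; pose q := Num.sqrt p.
have q0 : 0 < q by rewrite sqrtr_gt0.
have qp : q ^+ 2 = p by rewrite sqr_sqrtr // ltW.
have q1 : q < 1.
  by rewrite ltNge; apply/negP => h; have := exprn_ege1 2 h; rewrite qp leNgt p1.
have hq : 0 < q < 1 by rewrite q0.
have [K [Kpos hK]] := melonics_growth; pose growth : R := K%:R * 2.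
have K0 : 0 < growth by rewrite mulr_gt0 // ltr0n.
(* Within this radius the ratio [growth * x] of the majorant in [n] is below 1/2. *)
exists ((2 * growth)^-1); split; first by rewrite invr_gt0 mulr_gt0.
pose w (r : nat) : R := r%:R `^ gamma / Nof p.
have N0 : 0 <= (Nof p)^-1 by rewrite /Nof invrK subr_ge0 ltW.
have w0 r : 0 <= w r by rewrite mulr_ge0 // powR_ge0.
pose A (r : nat) := w r * q ^+ r.
have A0 r : 0 <= A r by rewrite mulr_ge0 // exprn_ge0 // ltW.
have [sA hA] : exists s : R, series A @ \oo --> s.
  have [s hs] := powR_geometric_cvg g0 hq; exists (s * (Nof p)^-1).
  have -> : series A = (fun n => series (fun r : nat => r%:R `^ gamma * q ^+ r) n * (Nof p)^-1).
    by apply/funext => n; rewrite /series /= mulr_suml; apply: eq_bigr => r _; rewrite /A /w mulrAC.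
  exact: cvgMl.
have hc r n : normc (G2coef p r n) <= q ^+ r * (4 * growth ^+ n) by rewrite -qp; apply: G2coef_le (hK n) hq.
have ha n : exists a, tends (series (fun r => (w r)%:C * G2coef p r n)) a.
  have [||a [h _]] := @abs_summable R (fun r => (w r)%:C * G2coef p r n)
    (fun r => A r * (4 * growth ^+ n)) (sA * (4 * growth ^+ n)).
  - by move=> r; rewrite Normc.normcM normc_real // /A -mulrA; apply: ler_wpM2l.
  - have -> : series (fun r => A r * (4 * growth ^+ n)) = (fun k => series A k * (4 * growth ^+ n)).
      by apply/funext => k; rewrite /series /= mulr_suml.
    exact: cvgMl.
  - by exists a.
(* The coefficient of order [n] is the sum over [r] of the weighted coefficients, chosen before
   [t]. *)
pose a n := projT1 (cid (ha n)).
have aP n : tends (series (fun r => (w r)%:C * G2coef p r n)) (a n) := projT2 (cid (ha n)).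
exists a => t; rewrite normr_normc ltcR => ht.
pose x := normc t; have x0 : 0 <= x by apply: normc_ge0.
have y0 : 0 <= growth * x by rewrite mulr_ge0 // ltW.
have y1 : growth * x < 1.
  have : growth * x < growth * (2 * growth)^-1 by rewrite ltr_pM2l.
  by rewrite invfM mulrCA divff ?gt_eqF // mulr1; lra.
pose B := geometric (4 : R) (growth * x).
have B0 n : 0 <= B n by rewrite /B /geometric /= mulr_ge0 // exprn_ge0.
have hB : series B @ \oo --> 4 * (1 - growth * x)^-1.
  by apply: cvg_geometric_series; rewrite ger0_norm.
have hg r : exists g, tends (series (fun n => G2coef p r n * t ^+ n)) g.
  have [||g [h _]] := @abs_summable R (fun n => G2coef p r n * t ^+ n)
    (fun n => q ^+ r * B n) (q ^+ r * (4 * (1 - growth * x)^-1)).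
  - move=> n; rewrite Normc.normcM normcX /B /geometric /= exprMn -/x.
    rewrite !mulrA; apply: ler_wpM2r; first by rewrite exprn_ge0.
    by rewrite -mulrA.
  - have -> : series (fun n => q ^+ r * B n) = (fun k => q ^+ r * series B k).
      by apply/funext => k; rewrite /series /= mulr_sumr.
    exact: cvgMr.
  - by exists g.
pose g r := projT1 (cid (hg r)).
have gP r : tends (series (fun n => G2coef p r n * t ^+ n)) (g r) := projT2 (cid (hg r)).
have gE r : G2melo p r t = g r by apply: tends_lim.
have [||| U [h1 h2]] := @double_series R (fun r n => (w r)%:C * (G2coef p r n * t ^+ n)) A B sA
    (4 * (1 - growth * x)^-1) (fun r => (w r)%:C * g r) (fun n => a n * t ^+ n) _ A0 B0 hA hB.
- move=> r n; rewrite !Normc.normcM normcX normc_real // /A /B /geometric /= -/x exprMn.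
  apply: (@le_trans _ _ (w r * (q ^+ r * (4 * growth ^+ n) * x ^+ n))).
    by apply: ler_wpM2l => //; apply: ler_wpM2r; rewrite ?exprn_ge0.
  by rewrite le_eqVlt; apply/orP; left; apply/eqP; ring.
- by move=> r; apply: eq_tends (tends_scale _ (gP r)) => n; rewrite series_mulr.
- move=> n; rewrite mulrC; apply: eq_tends (tends_scale (t ^+ n) (aP n)) => k.
  by rewrite -series_mulr /series /=; apply: eq_bigr => r _; rewrite mulrC mulrA.
have uE : Sterm p gamma t = (fun r => (w r)%:C * g r).
  by apply/funext => r; rewrite /Sterm gE.
split; first by move=> r; apply: tends_is_cvg (gP r).
split; first by rewrite uE; apply: tends_is_cvg h1.
split; first exact: tends_is_cvg h2.
by rewrite /Smelo uE (tends_lim h1) (tends_lim h2).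
Qed.

End Analyticity.

Theorem theorem1 (R : realType) (gamma : R) (hgamma : 0 <= gamma) :
  (* (a) melonic dominance *)
  (forall (n r : nat), ~~ odd n -> forall G : graph n, hgraph G ->
     (melonic G ->
        exists c C : R, 0 < c /\ c <= C /\
          forall p : R, 1 / 2 <= p < 1 ->
            (c%:E <= amp p r G)%E /\ (amp p r G <= C%:E)%E) /\
     (~ melonic G ->
        exists C' : R, forall p : R, 0 < p < 1 ->
          (amp p r G <= (C' / Nof p)%:E)%E)) /\
  (* (b) analyticity of S^melo_gamma on a disk |t| < rho *)
  (forall p : R, 0 < p < 1 ->
     exists rho : R, 0 < rho /\
       exists a : nat -> R[i],
         forall t : R[i], `|t| < rho%:C ->
           (forall r : nat, cvgn (series (fun n => G2coef p r n * t ^+ n))) /\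
           cvgn (series (Sterm p gamma t)) /\
           cvgn (series (fun n => a n * t ^+ n)) /\
           limn (series (fun n => a n * t ^+ n)) = Smelo p gamma t).
Proof.
split; last by move=> p; apply: analyticity.
move=> n r _ G [wf _]; split=> [mel|nmel].
  have [c c0 hc] := amp_family R r (family_melonic mel).
  (* The amplitude is at most 1; [c + 1] is an upper bound that is visibly at least [c]. *)
  exists c, (c + 1); split=> //; split; first by rewrite lerDl.
  move=> p /andP[p2 p1]; rewrite div1r in p2.
  have p0 : 0 < p by apply: lt_le_trans p2; rewrite invr_gt0.
  split; first by apply: hc; rewrite p2.
  by apply: le_trans (amp_le1 r wf _) _; rewrite ?p0 // lee_fin lerDr ltW.
exists 1 => p hp; apply: amp_nonredundant => // red.
by apply: nmel; apply: redundant_melonic.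
Qed.
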